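(* There exists a constant $C<\infty$ such that the following holds for every integer $N\ge 1$. Suppose that either (real case) $A$ is a deterministic $N\times N$ real symmetric matrix, $\varphi\in\mathbb{R}^N\setminus\{0\}$ is a deterministic vector, and $V$ is an $N\times N$ random matrix sampled from the GOE; or (complex case) $A$ is a deterministic $N\times N$ Hermitian matrix, $\varphi\in\mathbb{C}^N\setminus\{0\}$ is a deterministic vector, and $V$ is an $N\times N$ random matrix sampled from the GUE. Let $H:=A+V$. Then: 1. (Fixed vector) for all $t\ge 1$, $$\mathbb{P}\left\{\|H^{-1}\varphi\|\ge t\sqrt{N}\,\|\varphi\|\right\}\le \frac{C}{t};$$ 2. (Frobenius and operator norms) for all $t\ge 1$, $$\mathbb{P}\left\{\|H^{-1}\|_{\mathrm{op}}\ge tN\right\}\le \mathbb{P}\left\{\|H^{-1}\|_{\mathrm{F}}\ge tN\right\}\le \frac{C}{t};$$ 3. (Mean density of states) for any interval $I\subset\mathbb{R}$, $$\mathbb{E}\left[\#\{\text{eigenvalues of } H \text{ in } I\}\right]\le C\,N\,|I|.$$ The constant $C$ does not depend on $N$, $A$, $\varphi$ (nor on $t$, $I$).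
   Context: Normalization of the ensembles: $V=\frac{X+X^*}{\sqrt{2N}}$, where $X$ is an $N\times N$ matrix with independent standard real Gaussian entries (mean $0$, variance $1$) for the GOE, or independent standard complex Gaussian entries (independent real and imaginary parts, each normal with mean $0$ and variance $1/2$) for the GUE, and $X^*$ is the conjugate transpose. Equivalently, $V$ has density proportional to $\exp\{-\frac{\beta N}{4}\mathrm{tr}\,V^2\}$ with respect to Lebesgue measure on real symmetric ($\beta=1$, GOE) or complex Hermitian ($\beta=2$, GUE) $N\times N$ matrices. Notation: $\|\varphi\|$ is the Euclidean norm of a vector; for a matrix $R$, $\|R\|_{\mathrm{F}}=\sqrt{\mathrm{Tr}\,RR^*}$ is the Frobenius norm and $\|R\|_{\mathrm{op}}=\max_{\varphi\ne0}\|R\varphi\|/\|\varphi\|$ is the operator norm. $|I|$ is the Lebesgue measure of $I$. Eigenvalues are counted with multiplicity. The matrix $H$ is almost surely invertible. *)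

(* Defs.v *)
From HB Require Import structures.
From mathcomp Require Import all_boot all_order all_algebra.
From mathcomp Require Import complex.
From mathcomp Require Import all_classical all_reals all_analysis.

Set Implicit Arguments.
Unset Strict Implicit.
Unset Printing Implicit Defensive.

Import Order.TTheory GRing.Theory Num.Theory.
Import numFieldNormedType.Exports.

Local Open Scope classical_set_scope.
Local Open Scope complex_scope.
Local Open Scope sesquilinear_scope.
Local Open Scope ring_scope.

Definition mutually_independent (d : measure_display) (T : measurableType d)
    (R : realType) (P : probability T R) (I : finType)
    (X : I -> {RV P >-> R}) : Prop :=
  forall (J : {set I}) (B : I -> set R),
    (forall i, i \in J -> measurable (B i)) ->
    P (\bigcap_(i in [set` J]) (X i @^-1` B i)) =
    (\prod_(i in J) P (X i @^-1` B i))%E.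

(* [s] is the standard deviation, not the variance.  The equality is only
   required on Borel sets: the values of a measure on other sets are junk. *)
Definition normally_distributed (d : measure_display) (T : measurableType d)
    (R : realType) (P : probability T R) (X : {RV P >-> R}) (m s : R) : Prop :=
  forall B : set R, measurable B -> distribution P X B = normal_prob m s B.

Definition is_GOE (d : measure_display) (T : measurableType d) (R : realType)
    (P : probability T R) (N : nat) (V : T -> 'M[R]_N) : Prop :=
  exists X : 'I_N * 'I_N -> {RV P >-> R},
    [/\ mutually_independent X,
        forall ij, normally_distributed (X ij) 0 1 &
        forall w, let Xw := \matrix_(i, j) X (i, j) w in
          V w = (Num.sqrt (2 * N)%:R)^-1 *: (Xw + Xw^T)].

(* [X (i, j, false)] and [X (i, j, true)] are the real and the imaginary part
   of the (i, j) entry of the Ginibre matrix. *)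
Definition is_GUE (d : measure_display) (T : measurableType d) (R : realType)
    (P : probability T R) (N : nat) (V : T -> 'M[R[i]]_N) : Prop :=
  exists X : 'I_N * 'I_N * bool -> {RV P >-> R},
    [/\ mutually_independent X,
        forall k, normally_distributed (X k) 0 (Num.sqrt 2^-1) &
        forall w, let Xw := \matrix_(i, j)
                    (X (i, j, false) w +i* X (i, j, true) w) in
          V w = ((Num.sqrt (2 * N)%:R)^-1)%:C *: (Xw + Xw ^t*)].

(* The Euclidean and operator norms are parameterized by the real-valued
   modulus of the scalar field: [normr] for R, [Normc.normc] for R[i] (whose
   own [normr] takes values in R[i]).  The norm of the library on matrices is
   the sup norm of the entries. *)
Definition euclid_norm (R : realType) (K : fieldType) (modulus : K -> R)
    (N : nat) (v : 'cV[K]_N) : R :=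
  Num.sqrt (\sum_i modulus (v i 0) ^+ 2).

Definition op_norm (R : realType) (K : fieldType) (modulus : K -> R)
    (N : nat) (M : 'M[K]_N) : R :=
  sup [set euclid_norm modulus (M *m v) / euclid_norm modulus v
      | v in [set v : 'cV[K]_N | v != 0]].

Definition frobenius_norm_real (R : realType) (N : nat) (M : 'M[R]_N) : R :=
  Num.sqrt (\tr (M *m M^T)).

Definition frobenius_norm_complex (R : realType) (N : nat)
    (M : 'M[R[i]]_N) : R :=
  Num.sqrt (complex.Re (\tr (M *m M ^t*))).

(* [mup x p] is the multiplicity of [x] as a root of [p], and the sum is
   finitely supported since [p] is monic.  [embed] is the inclusion of R in
   the scalar field. *)
Definition num_eigenvalues (R : realType) (K : fieldType) (embed : R -> K)
    (N : nat) (M : 'M[K]_N) (I : interval R) : nat :=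
  \big[addn/0%N]_(x \in [set` I]) mup (embed x) (char_poly M).

(* Main.v *)
Require Import Defs.
From HB Require Import structures.
From mathcomp Require Import all_boot all_order all_algebra.
From mathcomp Require Import complex separable.
From mathcomp Require Import all_classical all_reals all_analysis.
From mathcomp Require Import measurable_realfun ring lra.

Set Implicit Arguments.
Unset Strict Implicit.
Unset Printing Implicit Defensive.

Import Order.TTheory GRing.Theory Num.Theory.
Import numFieldNormedType.Exports.

Local Open Scope classical_set_scope.
Local Open Scope complex_scope.
Local Open Scope ring_scope.

(** Resampling.  The matrix H = A + V is an affine function of independent real
    Gaussian variables, and everything is deduced from the rotation invariance
    of Gaussian families.  Let x be a Gaussian vector, let M_k be matrices
    supported on the row j and the column j, and let H(x) be an affine
    matrix in which M_k is the coefficient of x_k.  With an independent copy y of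
    the coordinates of these M_k, the rotated pair
    (cos x + sin y, - sin x + cos y) has the same law as (x, y).  Parametrize the
    angle by the tangent t of its half: up to the factor (1 + t^2)^2, the
    determinant of the rotated matrix is a polynomial of degree at most 4 in t,
    whatever the dimension, because only one row and one column of the matrix
    move.  By Jacobi's formula its logarithmic derivative is, up to explicit
    terms, the trace of D H^-1, where D is the derivative of the rotated matrix.
    A logarithmic derivative is a sum of at most four terms 1 / (t - z), so it
    exceeds lambda only for a proportion O(1 / lambda) of the t in [0, 1]
    (count_bad_angles).  Averaging over the angles, the trace of
    (sum_k y_k M_k) H^-1 exceeds lambda with probability O(1 / lambda).  Given x
    this trace is a Gaussian linear form in y, which is at least a fraction of
    its standard deviation with probability at least one half
    (gaussian_linear_form); this bounds the Euclidean norm of the vector of the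
    traces of M_k H^-1 (affine_column_tail).

    Fixed vector.  For the ensembles, that norm is the norm of a column of H^-1,
    up to the factor sqrt (2 / N): this is the bound for a basis vector.  The law
    of V is invariant under real rotations, and in the complex case under
    diagonal matrices of phases, so every vector can be moved to a basis vector
    (vector_tail_real, vector_tail_complex).

    Norms.  A vector of random signs has norm sqrt N, and H^-1 maps a fixed
    positive proportion of the vectors of signs to vectors of norm at least
    one half of the Frobenius norm of H^-1, by a second moment estimate
    (signed_sum_often_large).  Hence the bound for fixed vectors implies the
    bound for the Frobenius norm (frobenius_tail), which is at least the operator
    norm.  Comparing the two probabilities requires the operator norm to be
    measurable; it is a supremum over rational vectors.

    Density of states.  The inverse of H - x has norm at least 2 / h when an
    eigenvalue lies within h / 2 of x, which has probability O(N h) by the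
    Frobenius bound for the shifted matrix A - x.  Cutting an interval into cells
    of length h, and letting h tend to 0, the number of occupied cells tends to
    the number of distinct eigenvalues, and Fatou's lemma gives the bound.  The
    spectrum is almost surely simple because the resultant of the characteristic
    polynomial with its derivative is a polynomial in the Gaussian variables that
    does not vanish identically, and the zero set of such a polynomial is null
    (polynomial_function_neq0).

    Both ensembles are treated at once: the entries of the matrices are complex
    numbers, which are restricted to the real numbers in the real case, and the
    real Gaussian variables are indexed by a basis of the scalars. *)

(** * Rotation invariance of a pair of Gaussian variables *)

Section GaussianPair.
Context {R : realType}.

Local Notation leb := (@lebesgue_measure R).
Local Notation TR := (measurableTypeR R).
Local Notation leb2 := (leb \x leb)%E.

Lemma measurable_shift (a : R) (A : set TR) :
  measurable A -> measurable [set x | A (x + a)].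
Proof.
move=> mA; have mf : measurable_fun setT (fun x : TR => x + a : TR).
  exact: measurable_funD.
by have := mf measurableT A mA; rewrite setTI.
Qed.

Lemma lebesgue_shift (a : R) (A : set TR) :
  measurable A -> leb [set x | A (x + a)] = leb A.
Proof.
move=> mA; have mf : measurable_fun setT (fun x : TR => x + a : TR).
  exact: measurable_funD.
pose m := pushforward leb (fun x : TR => x + a : TR).
rewrite -[LHS]/(m A); apply/esym/lebesgue_measure_unique => //=.
move=> _ [[x y]] _ <-; rewrite /pushforward.
have -> : (fun z : TR => z + a : TR) @^-1` `]x, y]%classic =
    `](x - a), (y - a)]%classic.
  apply/seteqP; split=> z /=; rewrite !in_itv /=; lra.
rewrite !lebesgue_measure_itv/= !lte_fin ltrD2r.
by case: ifP => // _; rewrite !EFinN -!EFinD; congr EFin; lra.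
Qed.

Lemma measurable_affine2 (a b c d : R) :
  measurable_fun setT (fun z : TR * TR => (a * z.1 + b * z.2, c * z.1 + d * z.2)).
Proof.
apply/measurable_fun_pair; apply: measurable_funD => //=;
  exact: measurable_funM.
Qed.

Lemma lebesgue2_shear2 (a : R) (S : set (TR * TR)) : measurable S ->
  leb2 [set z | S (z.1, a * z.1 + z.2)] = leb2 S.
Proof.
move=> mS; rewrite /product_measure1; apply: eq_integral => x _ /=.
have mx := measurable_xsection x mS.
rewrite -(lebesgue_shift (a * x) mx); congr (lebesgue_measure _).
by apply/seteqP; split=> y; rewrite /xsection/= !inE/= addrC.
Qed.

Lemma lebesgue2_shear1 (a : R) (S : set (TR * TR)) : measurable S ->
  leb2 [set z | S (z.1 + a * z.2, z.2)] = leb2 S.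
Proof.
move=> mS.
have E X : measurable X -> leb2 X = (leb \x^ leb)%E X.
  apply: (@product_measure_unique _ _ _ _ R leb leb
    (product_measure2 leb leb)) => A B mA mB.
  by rewrite /= product_measure2E.
have mS' : measurable [set z : TR * TR | S (z.1 + a * z.2, z.2)].
  have := measurable_affine2 1 a 0 1 measurableT mS; rewrite setTI.
  by congr measurable; apply/seteqP; split=> z; rewrite /= !mul1r !mul0r add0r.
rewrite !E// /product_measure2; apply: eq_integral => y _ /=.
have my := measurable_ysection y mS.
by rewrite -(lebesgue_shift (a * y) my).
Qed.

Definition plane_rot (c s : R) (z : TR * TR) : TR * TR :=
  (c * z.1 + s * z.2, - s * z.1 + c * z.2).

Lemma measurable_rot c s : measurable_fun setT (plane_rot c s).
Proof. exact: measurable_affine2. Qed.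

Lemma measurable_rot_preimage c s S : measurable S ->
  measurable (plane_rot c s @^-1` S).
Proof. by move=> mS; rewrite -[X in measurable X]setTI; exact: measurable_rot. Qed.

(** A rotation of the plane is a product of three shears, and Lebesgue measure
    is invariant under each of them by Fubini and translation invariance.  The
    half-turn, which has no such decomposition, is the square of a rotation by
    a right angle. *)
Lemma lebesgue2_rot (c s : R) (S : set (TR * TR)) : c ^+ 2 + s ^+ 2 = 1 ->
  measurable S -> leb2 (plane_rot c s @^-1` S) = leb2 S.
Proof.
have main c1 s1 S1 : c1 ^+ 2 + s1 ^+ 2 = 1 -> c1 + 1 != 0 -> measurable S1 ->
    leb2 (plane_rot c1 s1 @^-1` S1) = leb2 S1.
  move=> cs c0 mS; pose t := s1 / (c1 + 1).
  have tE : t * (c1 + 1) = s1 by rewrite /t divfK.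
  have t2E : t * s1 = 1 - c1.
    by apply: (mulIf c0); rewrite mulrAC tE -expr2; lra.
  pose S2 := [set z : TR * TR | S1 (z.1 + t * z.2, z.2)].
  pose S3 := [set z : TR * TR | S2 (z.1, - s1 * z.1 + z.2)].
  have mS2 : measurable S2.
    have := measurable_affine2 1 t 0 1 measurableT mS; rewrite setTI.
    by congr measurable; apply/seteqP; split=> z; rewrite /S2/= !mul1r !mul0r add0r.
  have mS3 : measurable S3.
    have := measurable_affine2 1 0 (- s1) 1 measurableT mS2; rewrite setTI.
    by congr measurable; apply/seteqP; split=> z; rewrite /S3/= !mul1r !mul0r addr0.
  rewrite -(lebesgue2_shear1 t mS) -/S2 -(lebesgue2_shear2 (- s1) mS2) -/S3.
  rewrite -(lebesgue2_shear1 t mS3); congr product_measure1.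
  have e1 (x y : R) : c1 * x + s1 * y = x + t * y + t * (- s1 * (x + t * y) + y).
    transitivity ((1 - t * s1) * x + (2 * t - t * (t * s1)) * y); last by ring.
    by rewrite t2E -tE; ring.
  have e2 (x y : R) : - s1 * x + c1 * y = - s1 * (x + t * y) + y.
    transitivity (- s1 * x + (1 - t * s1) * y); last by ring.
    by rewrite t2E; ring.
  apply: eq_set => -[x y]; congr (S1 (_, _)); [exact: e1|exact: e2].
move=> cs mS; have [c0|c0] := eqVneq (c + 1) 0; last exact: main.
have [cE s0] : c = -1 /\ s = 0.
  by split; [lra|apply/eqP; rewrite -sqrf_eq0; apply/eqP; nra].
rewrite -(main 0 1 S _ _ mS); [|lra|by rewrite add0r oner_eq0].
rewrite -(main 0 1 (plane_rot 0 1 @^-1` S));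
  [|lra|by rewrite add0r oner_eq0|exact: measurable_rot_preimage].
have e1 (x y : R) : c * x + s * y = 0 * (0 * x + 1 * y) + 1 * (- 1 * x + 0 * y).
  by rewrite cE s0; ring.
have e2 (x y : R) :
    - s * x + c * y = - 1 * (0 * x + 1 * y) + 0 * (- 1 * x + 0 * y).
  by rewrite cE s0; ring.
congr product_measure1; apply: eq_set => -[x y].
by congr (S (_, _)); [exact: e1|exact: e2].
Qed.

Variable sigma : R.
Hypothesis sigma0 : sigma != 0.

Local Notation pdf := (normal_pdf 0 sigma).
Local Notation gamma := (normal_prob 0 sigma).

Let pdf2 (z : TR * TR) := (pdf z.1 * pdf z.2)%:E.

Let measurable_pdf2 : measurable_fun setT pdf2.
Proof.
apply/measurable_EFinP; apply: measurable_funM;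
  by apply: measurableT_comp => //; exact: measurable_normal_pdf.
Qed.

Let pdf2_ge0 z : (0 <= pdf2 z)%E.
Proof. by rewrite lee_fin mulr_ge0// normal_pdf_ge0. Qed.

Let gauss2 (S : set (TR * TR)) : \bar R := (\int[leb2]_(z in S) pdf2 z)%E.

Let gauss20 : gauss2 set0 = 0%E. Proof. by rewrite /gauss2 integral_set0. Qed.
Let gauss2_ge0 S : (0 <= gauss2 S)%E.
Proof. by rewrite /gauss2; apply: integral_ge0 => z _; exact: pdf2_ge0. Qed.
Let gauss2_sigma_additive : semi_sigma_additive gauss2.
Proof. exact: semi_sigma_additive_nng_induced. Qed.

HB.instance Definition _ := isMeasure.Build _ _ _ gauss2
  gauss20 gauss2_ge0 gauss2_sigma_additive.

Lemma normal_prob_pairE (S : set (TR * TR)) : measurable S ->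
  (gamma \x gamma)%E S = gauss2 S.
Proof.
apply: product_measure_unique => A B mA mB; rewrite /= /gauss2.
have mpdf : measurable_fun setT (EFin \o pdf).
  by apply/measurable_EFinP; exact: measurable_normal_pdf.
have pdf0 x : (0 <= (pdf x)%:E)%E by rewrite lee_fin normal_pdf_ge0.
rewrite integral_mkcond fubini_tonelli1/=; last 2 first.
- by apply/(measurable_restrictT _ _).1; [exact: measurableX|exact: measurable_funTS].
- by move=> z; exact: erestrict_ge0.
rewrite /fubini_F.
transitivity (\int[leb]_x ((EFin \o pdf) \_ A x * gamma B))%E.
  apply: eq_integral => x _; rewrite /patch; case: ifPn => [xA|xA]; last first.
    rewrite mul0e; apply: integral0_eq => y _; case: ifPn => //.
    by rewrite !inE => -[/= /mem_set]; rewrite (negbTE xA).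
  rewrite /normal_prob [X in (_ * X)%E]integral_mkcond -ge0_integralZl//=; last 2 first.
  - by apply/(measurable_restrictT _ _).1 => //; exact: measurable_funTS.
  - by move=> y _; exact: erestrict_ge0.
  apply: eq_integral => y _; rewrite /patch in_setX xA /=; case: ifPn => // _.
  by rewrite mule0.
rewrite ge0_integralZr//=.
- by rewrite -integral_mkcond.
- by apply/(measurable_restrictT _ _).1 => //; exact: measurable_funTS.
- by move=> y _; apply: erestrict_ge0 => x _; exact: pdf0.
Qed.

Let pdf2_rot c s z : c ^+ 2 + s ^+ 2 = 1 -> pdf2 (plane_rot c s z) = pdf2 z.
Proof.
move=> cs; rewrite /pdf2 normal_pdfE//; congr EFin.
rewrite mulrACA [RHS]mulrACA; congr (_ * _); rewrite /normal_fun -!expRD.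
congr expR; rewrite !subr0 -!mulrDl. congr (_ / _) => /=.
have e (x y : R) : - (c * x + s * y) ^+ 2 + - (- s * x + c * y) ^+ 2 =
    - x ^+ 2 + - y ^+ 2.
  transitivity (- (c ^+ 2 + s ^+ 2) * (x ^+ 2 + y ^+ 2)); first by ring.
  by rewrite cs; ring.
exact: e.
Qed.

Lemma normal_prob_pair_rot c s (S : set (TR * TR)) :
  c ^+ 2 + s ^+ 2 = 1 -> measurable S ->
  (gamma \x gamma)%E (plane_rot c s @^-1` S) = (gamma \x gamma)%E S.
Proof.
move=> cs mS; rewrite !normal_prob_pairE//; last exact: measurable_rot_preimage.
have mr := measurable_rot c s.
transitivity (\int[pushforward leb2 (plane_rot c s)]_(z in S) pdf2 z)%E.
  rewrite (ge0_integral_pushforward mr);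
    [|exact: mS|exact: measurable_funTS|by move=> z _; exact: pdf2_ge0].
  by apply: eq_integral => z _; rewrite /= pdf2_rot.
by apply: eq_measure_integral => A mA _; exact: lebesgue2_rot.
Qed.

Hypothesis sigma_large : 1 <= sigma ^+ 2 * pi *+ 2.

(** The Gaussian density is at most 1 / (sigma sqrt (2 pi)). *)
Lemma normal_prob_le_lebesgue (A : set TR) : measurable A ->
  (gamma A <= leb A)%E.
Proof.
move=> mA; rewrite /normal_prob -[leRHS]mul1e -integral_cst//.
apply: ge0_le_integral => //.
- by move=> x _; rewrite lee_fin normal_pdf_ge0.
- by apply/measurable_EFinP; apply: measurable_funTS; exact: measurable_normal_pdf.
move=> x _; rewrite lee_fin; apply: le_trans (normal_pdf_ub _ _ sigma0) _.
rewrite /normal_peak invf_le1 ?sqrtr_gt0//; last exact: lt_le_trans sigma_large.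
by rewrite -[leLHS]sqrtr1 ler_sqrt// (le_trans _ sigma_large).
Qed.

End GaussianPair.

(** * Families of independent centred Gaussian variables *)

Section Configurations.
Variables (K : finType) (R : realType).

Definition configuration := K -> R.

HB.instance Definition _ := gen_eqMixin configuration.
HB.instance Definition _ := gen_choiceMixin configuration.
HB.instance Definition _ := isPointed.Build configuration (fun=> 0).

Definition boxes : set (set configuration) :=
  [set [set x | forall k, B k (x k)] |
    B in [set B : K -> set R | forall k, measurable (B k)]].

(** Configurations with the product sigma-algebra, presented by the boxes
    because these form a pi-system. *)
Definition config := g_sigma_algebraType boxes.

HB.instance Definition _ := Measurable.on config.

End Configurations.

Section MeasurableConfig.
Context d (T : measurableType d) (R : realType) (K : finType).

Lemma measurable_forall (A : K -> set T) :
  (forall k, measurable (A k)) -> measurable [set w | forall k, A k w].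
Proof.
move=> mA; rewrite (_ : [set w | _] = \bigcap_(k in [set: K]) A k).
  by apply: fin_bigcap_measurable => // k _; exact: mA.
by apply/seteqP; split=> w /= Aw k; [move=> _|]; exact: Aw.
Qed.

Lemma measurable_config (X : K -> T -> R) :
  (forall k, measurable_fun setT (X k)) ->
  measurable_fun setT (fun w => (X ^~ w : config K R)).
Proof.
move=> mX; apply: (@measurability _ _ T (config K R) setT _ (@boxes K R)).
  by [].
move=> _ [_ [B /= mB <-] <-]; rewrite setTI.
apply: (@measurable_forall (fun k => X k @^-1` B k)) => k.
by rewrite -[X in measurable X]setTI; apply: mX.
Qed.

Lemma measurable_coordinate (k : K) :
  measurable_fun setT (fun x : config K R => x k : R).
Proof.
move=> _ B mB; rewrite setTI; apply: sub_sigma_algebra.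
exists (fun j => if j == k then B else setT) => [j /=|]; first by case: ifP.
apply/seteqP; split=> x /= xB => [|j]; first by have := xB k; rewrite eqxx.
by case: ifP => // /eqP ->.
Qed.

End MeasurableConfig.

Section GaussianFamily.
Context (R : realType).
Variable sigma : R.

Definition gaussian_family d (T : measurableType d) (P : probability T R)
    (K : finType) (X : K -> T -> R) : Prop :=
  (forall k, measurable_fun setT (X k)) /\
  (forall B : K -> set R, (forall k, measurable (B k)) ->
     P [set w | forall k, B k (X k w)] =
     (\prod_(k : K) normal_prob 0 sigma (B k))%E).

(** Rectangles form a pi-system that generates the product sigma-algebra, so
    a Gaussian family has only one possible law. *)
Lemma gaussian_family_law d (T : measurableType d) (P : probability T R)
    d' (T' : measurableType d') (P' : probability T' R) (K : finType)
    (X : K -> T -> R) (X' : K -> T' -> R) (E : set (config K R)) :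
  gaussian_family P X -> gaussian_family P' X' -> measurable E ->
  P [set w | E (X ^~ w)] = P' [set w | E (X' ^~ w)].
Proof.
move=> [mX PX] [mX' PX'] mE.
have mC := measurable_config mX; have mC' := measurable_config mX'.
pose m := pushforward P (fun w => (X ^~ w : config K R)).
pose m' := pushforward P' (fun w => (X' ^~ w : config K R)).
rewrite -[LHS]/(m E) -[RHS]/(m' E).
apply: (@measure_unique _ R (config K R) (@boxes K R) (fun=> setT)
  _ _ _ _ m m') => //.
- move=> _ _ [B mB <-] [B' mB' <-]; exists (fun k => B k `&` B' k).
    by move=> k; apply: measurableI; [exact: mB|exact: mB'].
  apply/seteqP; split=> x /= => [xB|[xB xB'] k]; last by split.
  by split=> k; have [] := xB k.
- by move=> i; exists (fun=> setT) => //; apply/seteqP; split.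
- by rewrite bigcup_const//; exists 0%N.
- move=> _ [B mB <-]; rewrite /m /m' /pushforward/=.
  by rewrite [LHS](PX B mB) [RHS](PX' B mB).
- move=> k; rewrite [ltLHS](_ : _ = P setT); first by rewrite probability_setT ltry.
  by congr (P _); apply/seteqP; split.
Qed.

Lemma gaussian_family_reindex d (T : measurableType d) (P : probability T R)
    (K K' : finType) (X : K -> T -> R) (e : K' -> K) :
  injective e -> gaussian_family P X -> gaussian_family P (fun k => X (e k)).
Proof.
move=> inje [mX PX]; split=> // B mB.
pose B' k := [set x | forall k', e k' = k -> B k' x].
have B'e k' : B' (e k') = B k'.
  apply/seteqP; split=> x /=; first exact.
  by move=> Bx k'' /inje ->.
have B'N k : k \notin codom e -> B' k = setT.
  move=> ke; apply/seteqP; split=> // x _ k' ek'.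
  by move: ke; rewrite -ek' codom_f.
rewrite [LHS](_ : _ = P [set w | forall k, B' k (X k w)]); last first.
  congr (P _); apply/seteqP; split=> w /= H k; last by rewrite -B'e.
  by move=> k' <-.
rewrite PX => [|k]; last first.
  have [/codomP[k' ->]|/B'N->//] := boolP (k \in codom e).
  by rewrite B'e.
rewrite (bigID (mem (codom e)))/= [X in (_ * X)%E]big1 ?mule1; last first.
  by move=> k /B'N ->; rewrite probability_setT.
have -> : (\prod_(k in codom e) normal_prob 0 sigma (B' k))%E =
    (\prod_(k <- codom e) normal_prob 0 sigma (B' k))%E.
  apply: esym; rewrite big_uniq//=; last by rewrite map_inj_uniq ?enum_uniq.
by rewrite codomE big_map big_enum; apply: eq_bigr => k _; rewrite B'e.
Qed.

(** An independent copy of a family, realized on the square of its probability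
    space: index (k, false) reads the first point, (k, true) the second. *)
Definition doubled (T : Type) (K : Type) (X : K -> T -> R) :
    K * bool -> T * T -> R :=
  fun kb w => X kb.1 (if kb.2 then w.2 else w.1).

Lemma gaussian_family_doubled d (T : measurableType d) (P : probability T R)
    (K : finType) (X : K -> T -> R) :
  gaussian_family P X -> gaussian_family (P \x P)%E (doubled X).
Proof.
move=> [mX PX]; split=> [[k [|]]|B mB].
- exact: measurableT_comp (mX k) measurable_snd.
- exact: measurableT_comp (mX k) measurable_fst.
pose A b := [set w | forall k, B (k, b) (X k w)].
have mA b : measurable (A b).
  apply: (@measurable_forall _ _ _ (fun k => X k @^-1` B (k, b))) => k.
  by rewrite -[X in measurable X]setTI; exact: mX.
rewrite (_ : [set w | _] = A false `*` A true); last first.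
  apply/seteqP; split=> -[w1 w2] /=.
    by move=> H; split=> k; [have := H (k, false)|have := H (k, true)].
  by move=> [H1 H2] [k [|]]; rewrite /doubled/=; [exact: H2|exact: H1].
have PA b : P (A b) = (\prod_k normal_prob 0 sigma (B (k, b)))%E.
  by apply: (PX (fun k => B (k, b))).
transitivity (P (A false) * P (A true))%E; first exact: product_measure1E.
rewrite !PA.
transitivity (\prod_k \prod_(b : bool) normal_prob 0 sigma (B (k, b)))%E.
  by rewrite -big_split/=; apply: eq_bigr => k _; rewrite big_bool muleC.
by rewrite pair_big/=; apply: eq_bigr => -[].
Qed.

Hypothesis sigma0 : sigma != 0.

Definition rotate_pair (K : eqType) (k l : K) (c s : R) (x : K -> R) : K -> R :=
  fun j => if j == k then c * x k + s * x l
           else if j == l then - s * x k + c * x l else x j.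

(** Conditionally on the other coordinates the two rotated ones still have the
    law of a pair of independent Gaussian variables, which is invariant under
    rotations. *)
Lemma gaussian_family_rotate_pair d (T : measurableType d)
    (P : probability T R) (K : finType) (X : K -> T -> R) (k l : K) (c s : R) :
  k != l -> c ^+ 2 + s ^+ 2 = 1 -> gaussian_family P X ->
  gaussian_family P (fun j w => rotate_pair k l c s (X ^~ w) j).
Proof.
move=> kl cs [mX PX]; split=> [j|B mB].
  rewrite /rotate_pair; case: eqP => _; last case: eqP => _ //.
    by apply: measurable_funD; exact: measurable_funM.
  by apply: measurable_funD; exact: measurable_funM.
pose gamma := normal_prob 0 sigma.
pose F := [set w | forall j, (if (j == k) || (j == l) then setT else B j) (X j w)].
have mF : measurable F.
  apply: (@measurable_forall _ _ _
    (fun j => X j @^-1` (if (j == k) || (j == l) then setT else B j))) => j.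
  rewrite -[X in measurable X]setTI; apply: mX => //.
  by case: ifP.
pose TR := measurableTypeR R.
pose c0 := (\prod_(j | (j != k) && (j != l)) gamma (B j))%E.
have c0_fin : c0 \is a fin_num.
  by apply: prode_fin_num => j _; apply: (fin_num_measure gamma); exact: mB.
have c0_ge0 : 0 <= fine c0.
  by apply: fine_ge0; apply: prode_ge0 => j _.
have boxP (B' : K -> set R) : (forall j, measurable (B' j)) ->
    (forall j, j != k -> j != l -> B' j = B j) ->
    (\prod_(j : K) gamma (B' j))%E = (c0 * (gamma (B' k) * gamma (B' l)))%E.
  move=> mB' B'B; rewrite (bigD1 k)//= (bigD1 l)/=; last by rewrite eq_sym.
  rewrite muleA muleC; congr (_ * _)%E.
  by apply: eq_bigr => j /andP[jk jl]; rewrite B'B.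
have mXY : measurable_fun setT (fun w => (X k w, X l w) : TR * TR).
  apply/measurable_fun_pair; exact: mX.
pose m1 := pushforward (mrestr P mF) (fun w => (X k w, X l w) : TR * TR).
pose m2 := mscale (NngNum c0_ge0) (gamma \x gamma)%E.
have m2E S : m2 S = (c0 * (gamma \x gamma)%E S)%E.
  by rewrite -[in RHS](fineK c0_fin).
have gX (A1 A2 : set TR) : measurable A1 -> measurable A2 ->
    ((gamma \x gamma) (A1 `*` A2) = gamma A1 * gamma A2)%E.
  exact: product_measure1E.
have m12 S : measurable S -> m1 S = m2 S.
  apply: (@measure_unique _ R (TR * TR)%type
    [set A `*` B | A in measurable & B in measurable] (fun=> setT)
    _ _ _ _ m1 m2) => //.
  - exact: measurable_prod_measurableType.
  - move=> _ _ [A1 mA1 [A2 mA2 <-]] [B1 mB1 [B2 mB2 <-]].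
    exists (A1 `&` B1); first exact: measurableI.
    by exists (A2 `&` B2); [exact: measurableI|rewrite setXI].
  - by move=> _; exists setT => //; exists setT => //; rewrite setXTT.
  - by rewrite bigcup_const//; exists 0%N.
  - move=> _ [A1 mA1 [A2 mA2 <-]].
    transitivity (c0 * (gamma A1 * gamma A2))%E; last first.
      by rewrite -gX//; exact/esym/m2E.
    rewrite /m1 /pushforward /mrestr/=.
    pose B' j := if j == k then A1 else if j == l then A2 else B j.
    have B'k : B' k = A1 by rewrite /B' eqxx.
    have B'l : B' l = A2 by rewrite /B' eqxx eq_sym (negbTE kl).
    rewrite [LHS](_ : _ = P [set w | forall j, B' j (X j w)]).
      rewrite PX; last by move=> j; rewrite /B'; case: ifP => // _; case: ifP.
      rewrite boxP ?B'k ?B'l// => [j|j /negbTE jk /negbTE jl].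
        by rewrite /B'; case: ifP => // _; case: ifP.
      by rewrite /B' jk jl.
    congr (P _); apply/seteqP; split=> w /=.
      move=> [[w1 w2] Fw] j; rewrite /B'; have := Fw j.
      by case: eqP => [->//|_]; case: eqP => [->//|_].
    move=> Hw; split; first by split; [rewrite -B'k|rewrite -B'l].
    by move=> j; have := Hw j; rewrite /B'; case: eqP => //= _; case: eqP.
  - move=> _; rewrite [ltLHS](_ : _ = P F).
      by rewrite (le_lt_trans (probability_le1 _ _))// ltry.
    by congr (P _); apply/seteqP; split=> w // [].
have mBkl : measurable (B k `*` B l : set (TR * TR)).
  by apply: (@measurableX _ _ TR TR); exact: mB.
transitivity (m1 (plane_rot c s @^-1` (B k `*` B l))); last first.
  rewrite m12; last exact: measurable_rot_preimage.
  transitivity (c0 * (gamma \x gamma)%E (plane_rot c s @^-1` (B k `*` B l)))%E.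
    exact: m2E.
  rewrite boxP//; congr (_ * _)%E.
  transitivity ((gamma \x gamma)%E (B k `*` B l)); last first.
    by apply: gX; exact: mB.
  exact: normal_prob_pair_rot.
rewrite /m1 /pushforward /mrestr/=.
congr (P _); apply/seteqP; split=> w /=.
  move=> Hw; split.
    by split; [have := Hw k|have := Hw l]; rewrite /rotate_pair eqxx//=
      eq_sym (negbTE kl).
  by move=> j; have := Hw j; rewrite /rotate_pair; case: eqP => //= _; case: eqP.
move=> [[Bk Bl] Fw] j; rewrite /rotate_pair; have := Fw j.
by case: eqP => [->//|_]; case: eqP => [->//|_].
Qed.

(** Simultaneous rotations of disjoint pairs of coordinates. *)
Lemma gaussian_family_rotate d (T : measurableType d) (P : probability T R)
    (K L : finType) (X Y : K -> T -> R) (e1 e2 : L -> K) (c s : L -> R) :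
  injective e1 -> injective e2 -> (forall l l', e1 l != e2 l') ->
  (forall l, c l ^+ 2 + s l ^+ 2 = 1) ->
  (forall l w, Y (e1 l) w = c l * X (e1 l) w + s l * X (e2 l) w) ->
  (forall l w, Y (e2 l) w = - s l * X (e1 l) w + c l * X (e2 l) w) ->
  (forall k, k \notin codom e1 -> k \notin codom e2 -> forall w, Y k w = X k w) ->
  gaussian_family P X -> gaussian_family P Y.
Proof.
move=> i1 i2 e12 cs Y1 Y2 YN GX.
have e21 l l' : e2 l != e1 l' by rewrite eq_sym.
pose step l (x : K -> R) := rotate_pair (e1 l) (e2 l) (c l) (s l) x.
pose Z (ls : seq L) := fun k w => foldr step (X ^~ w) ls k.
have GZ ls : gaussian_family P (Z ls).
  elim: ls => [//|l ls IH]; rewrite /Z/=.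
  exact: (gaussian_family_rotate_pair (e12 l l) (cs l) IH).
have ZE ls w : uniq ls -> forall l,
    Z ls (e1 l) w = (if l \in ls then Y (e1 l) w else X (e1 l) w) /\
    Z ls (e2 l) w = (if l \in ls then Y (e2 l) w else X (e2 l) w).
  elim: ls => [//|l0 ls IH] /= /andP[l0ls /IH{}IH] l.
  have [E1 E2] := IH l; have [F1 F2] := IH l0.
  move: E1 E2 F1 F2; rewrite /Z/= => E1 E2 F1 F2.
  rewrite /step /rotate_pair inE (inj_eq i1) (inj_eq i2) (negbTE (e12 _ _)).
  rewrite (negbTE (e21 _ _)) E1 E2 F1 F2 (negbTE l0ls).
  by have [->|] := eqVneq l l0; rewrite /= ?Y1 ?Y2.
have ZN ls w k : k \notin codom e1 -> k \notin codom e2 -> Z ls k w = X k w.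
  move=> k1 k2; elim: ls => [//|l ls IH]; rewrite /Z/= /step /rotate_pair.
  case: eqP => [kE|_]; first by rewrite kE codom_f in k1.
  by case: eqP => [kE|_]; first by rewrite kE codom_f in k2.
have -> : Y = Z (enum L); last exact: GZ.
apply/funext => k; apply/funext => w.
have [/codomP[l ->]|k1] := boolP (k \in codom e1).
  by have [-> _] := ZE _ w (enum_uniq L) l; rewrite mem_enum.
have [/codomP[l ->]|k2] := boolP (k \in codom e2).
  by have [_ ->] := ZE _ w (enum_uniq L) l; rewrite mem_enum.
by rewrite ZN// YN.
Qed.

Hypothesis sigma_large : 1 <= sigma ^+ 2 * pi *+ 2.

Lemma gaussian_family_coordinate d (T : measurableType d) (P : probability T R)
    (K : finType) (X : K -> T -> R) (k : K) (B : set R) :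
  gaussian_family P X -> measurable B ->
  P [set w | B (X k w)] = normal_prob 0 sigma B.
Proof.
move=> [mX PX] mB; pose B' j := if j == k then B else setT.
rewrite (_ : [set w | _] = [set w | forall j, B' j (X j w)]); last first.
  apply/seteqP; split=> w /= H => [j|]; first by rewrite /B'; case: eqP => // ->.
  by have := H k; rewrite /B' eqxx.
rewrite PX; last by move=> j; rewrite /B'; case: ifP.
rewrite (bigD1 k)//= big1 ?mule1 /B' ?eqxx// => j /negbTE ->.
exact: probability_setT.
Qed.

(** Rotating coordinates pairwise turns a linear form into a multiple of a
    single Gaussian variable, whose density is at most one. *)
Lemma gaussian_linear_form d (T : measurableType d) (P : probability T R)
    (K : finType) (X : K -> T -> R) (a : K -> R) :
  gaussian_family P X -> 0 < \sum_k a k ^+ 2 ->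
  (2^-1%:E <= P [set w | (Num.sqrt (\sum_k a k ^+ 2) / 4 <=
                           `|\sum_k a k * X k w|)%R])%E.
Proof.
have [n] := ubnP #|[pred k | a k != 0]|; elim: n => // n IH in X a * => + GX.
rewrite ltnS => an a_gt0.
have [mX _] := GX.
have [k ak] : exists k, a k != 0.
  apply/existsP; apply: contraTT a_gt0; rewrite negb_exists => /forallP a0.
  by rewrite big1 ?ltxx// => k _; rewrite (eqP (negPn (a0 k))) expr0n.
have [[l /andP[lk al]]|allk] := pselect (exists l, (l != k) && (a l != 0)).
  pose r := Num.sqrt (a k ^+ 2 + a l ^+ 2).
  have r2 : r ^+ 2 = a k ^+ 2 + a l ^+ 2 by rewrite sqr_sqrtr// addr_ge0 ?sqr_ge0.
  have r0 : r != 0.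
    by rewrite -sqrf_eq0 r2 paddr_eq0 ?sqr_ge0// !sqrf_eq0 (negbTE ak).
  pose a' j := if j == k then r else if j == l then 0 else a j.
  have kl : k != l by rewrite eq_sym.
  have a'k : a' k = r by rewrite /a' eqxx.
  have a'l : a' l = 0 by rewrite /a' (negbTE lk) eqxx.
  have a'N j : j != k -> j != l -> a' j = a j.
    by rewrite /a' => /negbTE -> /negbTE ->.
  have cs : (a k / r) ^+ 2 + (a l / r) ^+ 2 = 1.
    by rewrite !expr_div_n -mulrDl -r2 divff// sqrf_eq0.
  pose Y j w := rotate_pair k l (a k / r) (a l / r) (X ^~ w) j.
  have GY : gaussian_family P Y by exact: gaussian_family_rotate_pair.
  have sum_a' : \sum_j a' j ^+ 2 = \sum_j a j ^+ 2.
    rewrite (bigD1 k)//= [RHS](bigD1 k)//= (bigD1 l)//= [in RHS](bigD1 l)//=.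
    rewrite a'k a'l expr0n/= add0r r2 addrA; congr (_ + _).
    by apply: eq_bigr => j /andP[jk jl]; rewrite a'N.
  have sum_Y w : \sum_j a' j * Y j w = \sum_j a j * X j w.
    rewrite (bigD1 k)//= [RHS](bigD1 k)//= (bigD1 l)//= [in RHS](bigD1 l)//=.
    rewrite a'k a'l mul0r add0r addrA; congr (_ + _).
      by rewrite /Y /rotate_pair eqxx; field.
    apply: eq_bigr => j /andP[jk jl]; rewrite a'N//.
    by rewrite /Y /rotate_pair (negbTE jk) (negbTE jl).
  rewrite -sum_a' (_ : [set w | _] = [set w |
      (Num.sqrt (\sum_j a' j ^+ 2) / 4 <= `|\sum_j a' j * Y j w|)%R]); last first.
    by apply: eq_set => w; rewrite sum_Y.
  apply: IH; [|exact: GY|by rewrite sum_a'].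
  apply: leq_trans an; apply: proper_card.
  apply/properP; split.
    apply/fintype.subsetP => j; rewrite !inE /a'.
    have [->//|_] := eqVneq j k.
    by have [_|//] := eqVneq j l; rewrite eqxx.
  by exists l; rewrite !inE ?a'l ?eqxx.
have a0 j : j != k -> a j = 0.
  by move=> jk; apply: contrapT => /eqP aj; apply: allk; exists j; rewrite jk.
have -> : \sum_j a j ^+ 2 = a k ^+ 2.
  by rewrite (bigD1 k)//= big1 ?addr0// => j /a0 ->; rewrite expr0n.
rewrite sqrtr_sqr.
pose B := [set x : R | (4^-1 <= `|x|)%R].
have mBC : measurable (~` B).
  rewrite (_ : ~` B = `]-4^-1, 4^-1[%classic)//.
  apply/seteqP; split=> x; rewrite /B /= in_itv/= -ltr_norml.
    by move=> /negP; rewrite -ltNge.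
  by rewrite ltNge => /negP.
have mB : measurable B by rewrite -[B]setCK; exact: measurableC.
rewrite (_ : [set w | _] = [set w | B (X k w)]); last first.
  have E w : \sum_j a j * X j w = a k * X k w.
    by rewrite (bigD1 k)//= big1 ?addr0// => j /a0 ->; rewrite mul0r.
  apply: eq_set => w; rewrite E normrM ler_pM2l ?normr_gt0//.
rewrite (gaussian_family_coordinate k GX mB) -[B]setCK.
rewrite probability_setC//.
apply: (@le_trans _ _ (1 - lebesgue_measure (~` B))%E); last first.
  by apply: leeB => //; exact: normal_prob_le_lebesgue.
rewrite (_ : ~` B = `]-4^-1, 4^-1[%classic); last first.
  apply/seteqP; split=> x; rewrite /B /= in_itv/= -ltr_norml.
    by move=> /negP; rewrite -ltNge.
  by rewrite ltNge => /negP.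
rewrite lebesgue_measure_itv/= lte_fin; case: ifP => _;
  rewrite -?EFinN -?EFinD ?lee_fin; lra.
Qed.

End GaussianFamily.

(** * Determinants of polynomial matrices and logarithmic derivatives *)

Section PolynomialMatrix.
Variable S : comNzRingType.

Lemma deriv_prod (I : finType) (F : I -> {poly S}) :
  (\prod_i F i)^`() = \sum_i (F i)^`() * \prod_(j | j != i) F j.
Proof.
suff H (s : seq I) : uniq s -> (\prod_(i <- s) F i)^`() =
    \sum_(i <- s) (F i)^`() * \prod_(j <- s | j != i) F j.
  by rewrite H ?index_enum_uniq.
elim: s => [_|k s IH /= /andP[ks us]]; first by rewrite !big_nil -[1]/(1%:P) derivC.
rewrite !big_cons derivM IH// eqxx/=; congr (_ * _ + _).
  rewrite big_seq_cond [RHS]big_seq_cond; apply: eq_bigl => j.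
  by case: eqVneq => [->|]; rewrite ?andbT ?andbF// (negbTE ks).
rewrite big_distrr/= [LHS]big_seq [RHS]big_seq; apply: eq_bigr => i ims.
rewrite big_cons (_ : k != i); first by rewrite mulrCA.
by apply: contraNneq ks => ->.
Qed.

(** Jacobi's formula, obtained by differentiating Leibniz's expansion row by
    row and expanding each resulting determinant along the differentiated
    row. *)
Lemma deriv_det n (M : 'M[{poly S}]_n) :
  (\det M)^`() = \sum_i \sum_j (M i j)^`() * cofactor M i j.
Proof.
pose D i := \matrix_(a, b) (if a == i then (M a b)^`() else M a b).
transitivity (\sum_i \det (D i)); last first.
  apply: eq_bigr => i _; rewrite (expand_det_row _ i); apply: eq_bigr => j _.
  rewrite !mxE eqxx; congr (_ * _); rewrite /cofactor; congr (_ * \det _).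
  apply/matrixP => a b; rewrite !mxE; case: eqP => // /eqP.
  by rewrite eq_sym (negbTE (neq_lift _ _)).
rewrite /determinant linear_sum/= exchange_big/=; apply: eq_bigr => s _.
have derivS (b : bool) (p : {poly S}) :
    ((-1) ^+ b * p)^`() = (-1) ^+ b * p^`().
  by case: b; rewrite ?expr1 ?expr0 ?mul1r// !mulN1r derivN.
rewrite derivS deriv_prod big_distrr/=; apply: eq_bigr => i _.
congr (_ * _); rewrite [RHS](bigD1 i)//= mxE eqxx; congr (_ * _).
by apply: eq_bigr => j /negbTE ji; rewrite mxE ji.
Qed.

Lemma size_prod_ler (I : finType) (F : I -> {poly S}) (d : I -> nat) :
  (forall i, (size (F i) <= (d i).+1)%N) ->
  (size (\prod_i F i)%R <= (\sum_i d i).+1)%N.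
Proof.
move=> Fd; apply: (big_ind2 (fun (p : {poly S}) m => (size p <= m.+1)%N)) => //.
  by rewrite size_poly1.
move=> p m q k pm qk; apply: leq_trans (size_polyMleq _ _) _.
by have := leq_add pm qk; rewrite addSn addnS; case: (_ + _)%N.
Qed.

Lemma size_det_leq n (M : 'M[{poly S}]_n) (d e : 'I_n -> nat) :
  (forall i j, (size (M i j) <= (d i + e j).+1)%N) ->
  (size (\det M)%R <= (\sum_i d i + \sum_j e j).+1)%N.
Proof.
move=> Mde; rewrite /determinant; apply: (leq_trans (size_sum _ _ _)).
apply/bigmax_leqP => s _.
have szS (b : bool) (p : {poly S}) : size ((-1) ^+ b * p) = size p.
  by case: b; rewrite ?expr1 ?expr0 ?mul1r// mulN1r size_polyN.
rewrite szS.
rewrite [X in (_ + X)%N](reindex_inj (@perm.perm_inj _ s))/= -big_split/=.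
exact: size_prod_ler.
Qed.

End PolynomialMatrix.

Section LogarithmicDerivative.
Context {R : realType}.
Local Notation C := R[i].
Local Notation modulus := (@Normc.normc R).

Lemma normrE (z : C) : `|z| = (modulus z)%:C.
Proof. by rewrite normc_def; case: z. Qed.

Lemma modulus_ge0 (z : C) : 0 <= modulus z.
Proof. by case: z => a b; exact: sqrtr_ge0. Qed.

Lemma modulus_real (x : R) : modulus x%:C = `|x|.
Proof. by rewrite /= expr0n/= addr0 sqrtr_sqr. Qed.

Lemma modulus0 : modulus 0 = 0. Proof. exact: Normc.normc0. Qed.

Lemma modulus_eq0 (z : C) : (modulus z == 0) = (z == 0).
Proof. by apply/eqP/eqP => [/Normc.eq0_normc//|->]; exact: modulus0. Qed.

Lemma modulus_Re (z : C) : `|complex.Re z| <= modulus z.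
Proof. by rewrite -lecR -normrE; exact: normc_ge_Re. Qed.

Lemma modulus_sqr (z : C) :
  modulus z ^+ 2 = complex.Re z ^+ 2 + complex.Im z ^+ 2.
Proof. by case: z => a b /=; rewrite sqr_sqrtr// addr_ge0// sqr_ge0. Qed.

Lemma log_derivative_prod (rs : seq C) (t : C) (delta : R) : 0 < delta ->
  {in rs, forall z, delta < modulus (t - z)} ->
  let q := \prod_(z <- rs) ('X - z%:P) in
  delta * modulus (q^`()).[t] <= (size rs)%:R * modulus q.[t].
Proof.
move=> d0; elim: rs => [_|z rs IH dz] /=.
  by rewrite big_nil -[1]/(1%:P) derivC horner0 modulus0 mulr0 mul0r.
rewrite big_cons derivM hornerD !hornerM derivXsubC hornerC mul1r hornerXsubC.
set q := \prod_(_ <- _) _.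
have {}IH : delta * modulus (q^`()).[t] <= (size rs)%:R * modulus q.[t].
  by apply: IH => y yrs; apply: dz; rewrite inE yrs orbT.
have dz0 : delta < modulus (t - z) by apply: dz; rewrite inE eqxx.
apply: (@le_trans _ _ (delta * (modulus q.[t] +
    modulus (t - z) * modulus (q^`()).[t]))).
  by rewrite ler_pM2l// -Normc.normcM; exact: le_normcD.
rewrite Normc.normcM mulrDr -natr1 mulrDl mul1r addrC mulrCA.
apply: lerD; last by apply: ler_wpM2r; [exact: modulus_ge0|exact: ltW].
rewrite [leRHS]mulrCA; apply: ler_wpM2l IH; exact: modulus_ge0.
Qed.

(** Since p'/p is the sum of the 1/(t - z) over the roots z of p, a large
    logarithmic derivative at a real point forces a root close to it; in
    particular the real part of that root is close. *)
Lemma log_derivative_root (p : {poly C}) n : p != 0 -> (size p <= n.+1)%N ->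
  exists2 rs : seq C, (size rs <= n)%N &
    forall t mu : R, p.[t%:C] != 0 -> 0 < mu ->
      mu * modulus p.[t%:C] <= modulus (p^`()).[t%:C] ->
      exists2 z, z \in rs & `|t - complex.Re z| <= 2 * n%:R / mu.
Proof.
move=> p0 pn; have [rs pE] := closed_field_poly_normal p.
have lp0 : lead_coef p != 0 by rewrite lead_coef_eq0.
have rsn : (size rs <= n)%N.
  by move: pn; rewrite {1}pE size_scale// size_prod_XsubC ltnS.
exists rs => // t mu pt mu0 pmu.
apply: contrapT => nz.
pose delta := 2 * n%:R / mu.
have far : {in rs, forall z, delta < modulus (t%:C - z)}.
  move=> z zrs; apply: (@lt_le_trans _ _ `|t - complex.Re z|); last first.
    by apply: le_trans (modulus_Re _); case: (z).
  by rewrite ltNge; apply/negP => H; apply: nz; exists z.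
set q := \prod_(z <- rs) ('X - z%:P) in pE.
have qt : q.[t%:C] != 0.
  by move: pt; rewrite pE hornerZ mulf_eq0 negb_or => /andP[].
have qmu : mu * modulus q.[t%:C] <= modulus (q^`()).[t%:C].
  move: pmu; rewrite pE derivZ !hornerZ !Normc.normcM mulrCA.
  by rewrite ler_pM2l// lt_neqAle eq_sym modulus_eq0 lp0 modulus_ge0.
have mq : 0 < modulus q.[t%:C].
  by rewrite lt_neqAle eq_sym modulus_eq0 qt modulus_ge0.
case: n => [|n] in pn rsn delta nz far *.
  move: rsn; rewrite leqn0 => /nilP rs0; move: qmu.
  rewrite {2}/q rs0 big_nil -[1]/(1%:P) derivC horner0 modulus0.
  by apply/negP; rewrite -ltNge mulr_gt0.
have d0 : 0 < delta by rewrite divr_gt0// mulr_gt0// ltr0n.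
have := log_derivative_prod d0 far; rewrite -/q /= => H.
have : delta * (mu * modulus q.[t%:C]) <= n.+1%:R * modulus q.[t%:C].
  apply: le_trans (le_trans H _).
    by rewrite ler_pM2l.
  by rewrite ler_pM2r// ler_nat.
apply/negP; rewrite -ltNge mulrA ltr_pM2r// divfK ?gt_eqF//.
by rewrite ltr_pMl ?ltr0n// ltr1n.
Qed.

Lemma count_near (M : nat) (x delta : R) : (0 < M)%N -> 0 <= delta ->
  (\sum_(m < M) (`|m%:R / M%:R - x| <= delta)%R)%:R <= 2 * delta * M%:R + 1 :> R.
Proof.
move=> M0 d0; have M0' : 0 < M%:R :> R by rewrite ltr0n.
pose A := [pred m : nat | `|m%:R / M%:R - x| <= delta].
have -> : (\sum_(m < M) (`|m%:R / M%:R - x| <= delta)%R = count A (iota 0 M))%N.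
  rewrite -(big_mkord xpredT
    (fun m => (`|m%:R / M%:R - x| <= delta)%R : nat)) /index_iota subn0.
  by rewrite -sum1_count [RHS]big_mkcond; apply: eq_bigr => i _ /=; case: (_ <= _).
pose s := [seq m <- iota 0 M | A m]; rewrite -size_filter -/s.
have us : uniq s by rewrite filter_uniq ?iota_uniq.
have ss : sorted leq s by apply: (sorted_filter leq_trans); exact: iota_sorted.
case E : s => [|a s'].
  by rewrite addr_ge0// !mulr_ge0// ltW.
pose b := last a s'.
have As m : m \in s -> `|m%:R / M%:R - x| <= delta.
  by rewrite mem_filter => /andP[].
have mab m : m \in s -> (a <= m <= b)%N.
  move=> ms; move: ss; rewrite E => ss; apply/andP; split.
    move: ms; rewrite E inE => /predU1P[->//|ms'].
    by have /allP/(_ _ ms') := order_path_min leq_trans ss.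
  rewrite /b; move: ms; rewrite E; move: ss; rewrite /=.
  elim: s' a m {E b} => [|c s' IH] a m /=; first by rewrite inE => _ /eqP ->.
  move=> /andP[ac cs]; rewrite inE => /predU1P[->|]; last exact: IH.
  by apply: (leq_trans ac); apply: IH => //; rewrite inE eqxx.
have size_s : (size s <= b.+1 - a)%N.
  rewrite -(size_iota a (b.+1 - a)); apply: uniq_leq_size => // m /mab /andP[am mb].
  by rewrite mem_iota am/= subnKC ?ltnS// (leq_trans am)// leqW.
have sa : a \in s by rewrite E inE eqxx.
have sb : b \in s by rewrite E mem_last.
have ab : (a <= b)%N by have /andP[] := mab _ sb.
apply: (@le_trans _ _ (b.+1 - a)%N%:R); first by rewrite -E ler_nat.
rewrite subSn// -natr1 lerD2r natrB//.
have := As _ sa; have := As _ sb; rewrite !ler_norml => /andP[_ h1] /andP[h2 _].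
have : b%:R / M%:R - a%:R / M%:R <= 2 * delta by lra.
by rewrite -mulrBl ler_pdivrMr.
Qed.

End LogarithmicDerivative.

(** * Rotating one row and one column of a matrix *)

Section RotationPolynomials.
Variable F : fieldType.

Definition rot_denom : {poly F} := 1 + 'X^2.
Definition rot_numer (u v : F) : {poly F} :=
  (1 - 'X^2) * u%:P + 2%:P * 'X * v%:P.

Variables (t : F) (w0 : 1 + t ^+ 2 != 0).
Let w := 1 + t ^+ 2.

Lemma horner_rot_denom : rot_denom.[t] = w.
Proof. by rewrite hornerD hornerXn -[1]/(1%:P) hornerC. Qed.

Lemma horner_deriv_rot_denom : (rot_denom^`()).[t] = 2 * t.
Proof.
rewrite derivD derivXn -[1]/(1%:P) derivC add0r hornerMn hornerXn expr1.
by rewrite mulr_natl.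
Qed.

Lemma horner_rot_numer u v :
  (rot_numer u v).[t] = (1 - t ^+ 2) * u + 2 * t * v.
Proof.
by rewrite hornerD !hornerM !hornerC hornerX hornerD hornerN hornerXn
  -[1]/(1%:P) hornerC.
Qed.

Lemma horner_deriv_rot_numer u v :
  ((rot_numer u v)^`()).[t] = - (2 * t) * u + 2 * v.
Proof.
rewrite /rot_numer !poly.derivE !hornerE/=.
by ring.
Qed.

Lemma horner_rot_entry a u v : (rot_denom * a%:P + rot_numer u v).[t] =
  w * (a + (1 - t ^+ 2) / w * u + 2 * t / w * v).
Proof.
rewrite hornerD hornerM horner_rot_denom horner_rot_numer hornerC.
by rewrite /w; field.
Qed.

Lemma horner_deriv_rot_entry a u v :
  ((rot_denom * a%:P + rot_numer u v)^`()).[t] =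
  2 * t / w * (rot_denom * a%:P + rot_numer u v).[t] +
  2 / w * (w * (- (2 * t / w) * u + (1 - t ^+ 2) / w * v)).
Proof.
rewrite horner_rot_entry derivD derivM derivC mulr0 addr0 hornerD hornerM.
rewrite horner_deriv_rot_denom horner_deriv_rot_numer hornerC.
by rewrite /w; field.
Qed.

Lemma rot_corner_deriv (x y z : F) : z != 0 ->
  x * y + z * (x / z * y) = 2%:R * (x / z) * (z * y).
Proof. by move=> z0; field. Qed.

End RotationPolynomials.

Section CofactorSums.
Variables (F : fieldType) (N : nat).
Implicit Types (B D H L : 'M[F]_N) (j : 'I_N).

Lemma sum_cofactor_row B j :
  \sum_a \sum_b (a == j)%:R * B a b * cofactor B a b = \det B.
Proof.
rewrite (bigD1 j)//= [X in _ + X]big1 => [|a /negbTE aj]; last first.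
  by rewrite big1// => b _; rewrite aj !mul0r.
rewrite addr0 (expand_det_row _ j); apply: eq_bigr => b _.
by rewrite eqxx mul1r.
Qed.

Lemma sum_cofactor_col B j :
  \sum_a \sum_b (b == j)%:R * B a b * cofactor B a b = \det B.
Proof.
rewrite exchange_big (bigD1 j)//= [X in _ + X]big1 => [|a /negbTE aj]; last first.
  by rewrite big1// => b _; rewrite aj !mul0r.
rewrite addr0 (expand_det_col _ j); apply: eq_bigr => b _.
by rewrite eqxx mul1r.
Qed.

Lemma sum_cofactor_trace B D :
  \sum_a \sum_b D a b * cofactor B a b = \tr (D *m \adj B).
Proof.
by apply: eq_bigr => a _; rewrite mxE; apply: eq_bigr => b _; rewrite !mxE.
Qed.

(** Clearing denominators multiplies rows and columns by L; the trace of D H^-1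
    is not affected. *)
Lemma trace_mul_adj_conj L H D : L \in unitmx -> H \in unitmx ->
  \tr (L *m D *m L *m \adj (L *m H *m L)) =
  \det (L *m H *m L) * \tr (D *m invmx H).
Proof.
move=> Lu Hu; set B := L *m H *m L; pose X := L *m \adj B *m L.
have HX : H *m X = (\det B)%:M.
  have LHX : L *m (H *m X) = \det B *: L.
    by rewrite /X !mulmxA -/B mul_mx_adj mul_scalar_mx.
  by rewrite -[LHS](mulKmx Lu) LHX -scalemxAr mulVmx// scalemx1.
have XE : X = \det B *: invmx H.
  by rewrite -[X](mulKmx Hu) HX mul_mx_scalar.
transitivity (\tr (D *m X)); last by rewrite XE -scalemxAr linearZ.
by rewrite /X -!mulmxA [LHS]mxtrace_mulC -!mulmxA.
Qed.

Lemma horner_deriv_det_cross (M : 'M[{poly F}]_N) B D j (t x y : F) :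
  (forall a b, (M a b).[t] = B a b) ->
  (forall a b, ((M a b)^`()).[t] =
     ((a == j) + (b == j))%:R * x * B a b + y * D a b) ->
  ((\det M)^`()).[t] = \det B * (2 * x) + y * \tr (D *m \adj B).
Proof.
move=> MB MD.
have cofE a b : (cofactor M a b).[t] = cofactor B a b.
  rewrite -/(horner_eval t _) -cofactor_map_mx; congr (cofactor _ _ _).
  by apply/matrixP => i k; rewrite mxE -MB.
rewrite deriv_det horner_sum -sum_cofactor_trace.
have -> : \det B * (2 * x) = x * \det B + x * \det B by ring.
rewrite -{1}(sum_cofactor_row B j) -(sum_cofactor_col B j).
rewrite !mulr_sumr -!big_split/=; apply: eq_bigr => a _; rewrite horner_sum.
rewrite !mulr_sumr -!big_split/=; apply: eq_bigr => b _.
by rewrite hornerM MD cofE natrD; ring.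
Qed.

End CofactorSums.

Section Cross.
Context {R : realType}.
Local Notation C := R[i].
Local Notation modulus := (@Normc.normc R).

(** Rational parametrization of the circle by the tangent of the half angle. *)
Definition rcos (t : R) : R := (1 - t ^+ 2) / (1 + t ^+ 2).
Definition rsin (t : R) : R := 2 * t / (1 + t ^+ 2).

Lemma one_sqr_gt0 (t : R) : 0 < 1 + t ^+ 2.
Proof. by rewrite ltr_wpDr ?sqr_ge0. Qed.

Lemma rcos2Drsin2 t : rcos t ^+ 2 + rsin t ^+ 2 = 1.
Proof.
rewrite /rcos /rsin; field; exact: lt0r_neq0 (one_sqr_gt0 t).
Qed.

Definition in_cross (N : nat) (j : 'I_N) (U : 'M[C]_N) : Prop :=
  forall a b, a != j -> b != j -> U a b = 0.

Section PolynomialModel.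
Context (N : nat) (j : 'I_N) (A U V : 'M[C]_N).
Hypotheses (jU : in_cross j U) (jV : in_cross j V).

Definition rotated_matrix (t : R) : 'M[C]_N :=
  A + (rcos t)%:C *: U + (rsin t)%:C *: V.

Definition rotated_derivative (t : R) : 'M[C]_N :=
  - (rsin t)%:C *: U + (rcos t)%:C *: V.

Let q := rot_denom C.
Let r := @rot_numer C.

(* Entries of rotated_matrix with row j and column j multiplied by 1 + t^2. *)
Let M : 'M[{poly C}]_N := \matrix_(a, b)
  if (a == j) && (b == j) then q * (q * (A a b)%:P + r (U a b) (V a b))
  else if (a == j) || (b == j) then q * (A a b)%:P + r (U a b) (V a b)
  else (A a b)%:P.

Let w (t : R) : C := 1 + t%:C ^+ 2.

Let w_neq0 t : w t != 0.
Proof.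
rewrite /w -[1]/(1%:C) -rmorphXn -rmorphD/= (inj_eq (@complexI R) _ 0).
exact: lt0r_neq0 (one_sqr_gt0 t).
Qed.

Let rcosC t : (rcos t)%:C = (1 - t%:C ^+ 2) / w t.
Proof. by rewrite /rcos rmorphM fmorphV rmorphB rmorphD rmorphXn rmorph1. Qed.

Let rsinC t : (rsin t)%:C = 2 * t%:C / w t.
Proof.
by rewrite /rsin rmorphM fmorphV rmorphD rmorphXn rmorphM rmorph1 rmorph_nat.
Qed.

Let E t (a : 'I_N) : C := if a == j then w t else 1.

Let hornerM_ent t a b : (M a b).[t%:C] = E t a * rotated_matrix t a b * E t b.
Proof.
rewrite /rotated_matrix /E !mxE rcosC rsinC; have w0 := w_neq0 t.
have [aj|aj] := eqVneq a j; have [bj|bj] := eqVneq b j; rewrite /= ?mulr1 ?mul1r.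
- by rewrite hornerM horner_rot_denom horner_rot_entry// -/(w t) [RHS]mulrC.
- by rewrite horner_rot_entry.
- by rewrite horner_rot_entry// [RHS]mulrC.
by rewrite hornerC jU// jV// !mulr0 !addr0.
Qed.

Let deriv_ent t a b : ((M a b)^`()).[t%:C] =
  (((a == j) + (b == j))%:R * (2 * t%:C / w t)) * (M a b).[t%:C] +
  (2 / w t) * (E t a * rotated_derivative t a b * E t b).
Proof.
rewrite /rotated_derivative /E !mxE rcosC rsinC; have w0 := w_neq0 t.
have [aj|aj] := eqVneq a j; have [bj|bj] := eqVneq b j; rewrite /= ?mulr1 ?mul1r.
- rewrite derivM hornerD !hornerM horner_deriv_rot_denom horner_deriv_rot_entry//.
  rewrite horner_rot_denom -/(w t) mulrDr addrA; congr (_ + _); last first.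
    by rewrite mulrCA; congr (_ * _); rewrite [RHS]mulrC.
  exact: rot_corner_deriv.
- by rewrite horner_deriv_rot_entry.
- by rewrite horner_deriv_rot_entry// [_ * w t]mulrC.
by rewrite derivC horner0 jU// jV// !mulr0 addr0 !mulr0 !mul0r addr0.
Qed.

Let Delta t : 'M[C]_N := diag_mx (\row_a E t a).

Let Delta_unit t : Delta t \in unitmx.
Proof.
rewrite unitmxE det_diag unitfE; apply/prodf_neq0 => a _; rewrite mxE /E.
by case: ifP => _; [exact: w_neq0|exact: oner_neq0].
Qed.

Let map_hornerM t : map_mx (horner_eval t%:C) M =
  Delta t *m rotated_matrix t *m Delta t.
Proof.
apply/matrixP => a b; rewrite mul_diag_mx mul_mx_diag !mxE.
by have := hornerM_ent t a b; rewrite !mxE.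
Qed.

Let horner_det t : (\det M).[t%:C] = \det (Delta t *m rotated_matrix t *m Delta t).
Proof. by rewrite -map_hornerM det_map_mx. Qed.

Let deriv_horner_det t : rotated_matrix t \in unitmx ->
  ((\det M)^`()).[t%:C] = (\det M).[t%:C] *
    (4 * t%:C / w t +
     2 / w t * \tr (rotated_derivative t *m invmx (rotated_matrix t))).
Proof.
move=> Hu; rewrite (@horner_deriv_det_cross _ _ M
  (Delta t *m rotated_matrix t *m Delta t)
  (Delta t *m rotated_derivative t *m Delta t) j _ (2 * t%:C / w t) (2 / w t)).
- rewrite trace_mul_adj_conj ?Delta_unit// -horner_det.
  rewrite [X in _ + X]mulrCA -mulrDr; congr (_ * (_ + _)).
  by rewrite !mulrA -natrM.
- by move=> a b; rewrite -map_hornerM [RHS]mxE.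
- move=> a b; rewrite deriv_ent; congr (_ * _ + _ * _).
    by rewrite -map_hornerM [RHS]mxE.
  by rewrite mul_diag_mx mul_mx_diag !mxE.
Qed.

Let size_det : (size (\det M) <= 5)%N.
Proof.
pose d (a : 'I_N) := if a == j then 2%N else 0%N.
have sd : (\sum_a d a = 2)%N.
  by rewrite (bigD1 j)//= big1 ?addn0 /d ?eqxx// => a /negbTE ->.
suff H a b : (size (M a b) <= (d a + d b).+1)%N.
  by have := size_det_leq H; rewrite sd.
have szD (p1 p2 : {poly C}) n : (size p1 <= n)%N -> (size p2 <= n)%N ->
    (size (p1 + p2)%R <= n)%N.
  by move=> h1 h2; rewrite (leq_trans (size_polyD _ _))// geq_max h1.
have szM (p1 p2 : {poly C}) n m : (size p1 <= n.+1)%N -> (size p2 <= m.+1)%N ->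
    (size (p1 * p2)%R <= (n + m).+1)%N.
  move=> h1 h2; apply: leq_trans (size_polyMleq _ _) _.
  by have := leq_add h1 h2; rewrite addSn addnS; case: (_ + _)%N.
have szC (c : C) n : (size c%:P <= n.+1)%N.
  by rewrite (leq_trans (size_polyC_leq1 _)).
have szq : (size q <= 3)%N.
  by apply: (szD _ _ _); rewrite ?size_polyXn// -[1]/(1%:P) szC.
have szr u v : (size (r u v) <= 3)%N.
  apply: (szD _ _ _); first apply: (szM _ _ 2 0)%N; rewrite ?szC//.
    by apply: (szD _ _ _); rewrite ?size_polyN ?size_polyXn// -[1]/(1%:P) szC.
  apply: (leq_trans (szM _ _ 1 0 _ _)%N); rewrite ?szC//.
  by apply: (leq_trans (szM _ _ 0 1 _ _)%N); rewrite ?szC ?size_polyX.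
have sz1 : (size (q * (A a b)%:P + r (U a b) (V a b))%R <= 3)%N.
  by apply: (szD _ _ _) => //; apply: (szM _ _ 2 0)%N; rewrite ?szC.
rewrite mxE /d; have [_|_] := eqVneq a j; have [_|_] := eqVneq b j => /=.
- exact: (szM _ _ 2 2)%N.
- exact: sz1.
- exact: sz1.
- exact: (szC _ 0)%N.
Qed.

(** The determinant of the rotated matrix, multiplied by the square of 1 + t^2,
    is a polynomial of degree at most 4 in t whose logarithmic derivative is
    essentially the trace below.  A large logarithmic derivative happens only
    close to one of its at most 4 roots, whence a bound, uniform in all the
    data, on the proportion of bad angles. *)
Lemma count_bad_angles (lambda : R) (m : nat) : 4 <= lambda -> (0 < m)%N ->
  (\sum_(i < m) ((\det (rotated_matrix (i%:R / m%:R)) != 0)%R &&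
     (lambda <= modulus (\tr (rotated_derivative (i%:R / m%:R) *m
        invmx (rotated_matrix (i%:R / m%:R)))))%R : nat))%N%:R <=
  4 * (32 / lambda * m%:R + 1) :> R.
Proof.
move=> l4 m0; have l0 : 0 < lambda by lra.
have rhs0 : 0 <= 4 * (32 / lambda * m%:R + 1).
  by rewrite mulr_ge0// addr_ge0// mulr_ge0// divr_ge0// ltW.
have detE t : \det (rotated_matrix t) != 0 -> (\det M).[t%:C] != 0.
  rewrite horner_det -!unitfE -!unitmxE => Hu.
  by rewrite !unitmx_mul Delta_unit Hu.
have [M0|M0] := eqVneq (\det M) 0.
  rewrite big1// => i _; have := detE (i%:R / m%:R); rewrite M0 horner0 eqxx.
  by case: (_ != 0) => // /(_ isT).
have [rs srs rsP] := log_derivative_root M0 size_det.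
pose delta := 16 / lambda : R.
have near (t : R) : 0 <= t <= 1 -> \det (rotated_matrix t) != 0 ->
    lambda <= modulus (\tr (rotated_derivative t *m invmx (rotated_matrix t))) ->
    exists2 z, z \in rs & `|t - complex.Re z| <= delta.
  move=> /andP[t0 t1] dt lt.
  have Hu : rotated_matrix t \in unitmx by rewrite unitmxE unitfE.
  have -> : delta = 2 * 4%:R / (lambda / 2).
    by rewrite /delta; field; exact: lt0r_neq0.
  apply: rsP; [exact: detE|by rewrite divr_gt0|].
  rewrite deriv_horner_det// Normc.normcM mulrC ler_wpM2l ?modulus_ge0//.
  set tr := \tr _ in lt *.
  have w1 : 1 <= 1 + t ^+ 2 by rewrite lerDl sqr_ge0.
  have w2 : 1 + t ^+ 2 <= 2 by have := exprn_ile1 2 t0 t1; lra.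
  have w0 := one_sqr_gt0 t.
  have e1 : 4 * t%:C / w t = (4 * t / (1 + t ^+ 2))%:C.
    by rewrite rmorphM fmorphV rmorphD rmorphXn rmorphM rmorph1 rmorph_nat.
  have wE : w t = (1 + t ^+ 2)%:C by rewrite rmorphD rmorphXn rmorph1.
  have e2 : 2 / w t = (2 / (1 + t ^+ 2))%:C.
    rewrite wE -fmorphV -[2 in LHS](rmorph_nat (real_complex R)) -rmorphM.
    by [].
  have b1 : modulus (4 * t%:C / w t) <= 2.
    rewrite e1 modulus_real ger0_norm; last first.
      by rewrite divr_ge0// ?mulr_ge0// ltW.
    rewrite ler_pdivrMr//; have := sqr_ge0 (t - 1); nra.
  have b2 : modulus tr <= modulus (2 / w t * tr).
    have b0 : 1 <= 2 / (1 + t ^+ 2) by rewrite ler_pdivlMr// mul1r.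
    rewrite Normc.normcM e2 modulus_real ler_peMl ?modulus_ge0//.
    by rewrite (le_trans b0)// ler_norm.
  have b3 : modulus (2 / w t * tr) <=
      modulus (4 * t%:C / w t + 2 / w t * tr) + modulus (4 * t%:C / w t).
    have := le_normcD (4 * t%:C / w t + 2 / w t * tr) (- (4 * t%:C / w t)).
    by rewrite normcN addrAC subrr add0r.
  lra.
apply: (@le_trans _ _ (\sum_(i < m) \sum_(z <- rs)
    (`|i%:R / m%:R - complex.Re z| <= delta)%R)%N%:R).
  rewrite ler_nat; apply: leq_sum => i _.
  case: (boolP (_ && _)) => // /andP[di li].
  have i01 : 0 <= (i%:R / m%:R : R) <= 1.
    by rewrite divr_ge0//= ler_pdivrMr ?ltr0n// mul1r ler_nat ltnW.
  have [z zrs zi] := near _ i01 di li.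
  by rewrite (big_rem _ zrs)/= zi.
rewrite exchange_big/= natr_sum.
apply: (@le_trans _ _ (\sum_(z <- rs) (32 / lambda * m%:R + 1))).
  apply: ler_sum => z _; apply: le_trans (count_near _ m0 _) _.
    by rewrite divr_ge0// ltW.
  by rewrite lerD2r ler_wpM2r// /delta mulrA -natrM.
rewrite big_const_seq count_predT iter_addr addr0 -[leLHS]mulr_natl.
apply: ler_wpM2r; last by rewrite ler_nat.
by rewrite addr_ge0// mulr_ge0// divr_ge0// ltW.
Qed.

End PolynomialModel.
End Cross.

(** * Measurability of complex matrices *)

Section MeasurableReal.
Context d (T : measurableType d) (R : realType).

Lemma measurable_true (b : T -> bool) :
  measurable_fun setT b -> measurable [set w | b w].
Proof. by move=> /(_ measurableT [set true] I); rewrite setTI. Qed.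

Lemma measurable_ge_set (f : T -> R) (c : R) :
  measurable_fun setT f -> measurable [set w | c <= f w].
Proof.
move=> mf; apply: measurable_true; apply: measurable_fun_ler => //.
Qed.

Lemma measurable_inv (f : T -> R) :
  measurable_fun setT f -> measurable_fun setT (fun w => (f w)^-1).
Proof.
move=> mf; rewrite (_ : (fun w => _) = (fun w => f w * (f w ^+ 2) `^ (-1))).
  apply: measurable_funM => //.
  by apply: measurableT_comp (measurable_powR _) _; exact: measurable_funX.
apply/funext => w; rewrite powR_inv1 ?sqr_ge0//.
have [->|f0] := eqVneq (f w) 0; first by rewrite invr0 mul0r.
by rewrite expr2 invfM mulrA divff// mul1r.
Qed.

End MeasurableReal.

Section ComplexMeasurability.
Context d (T : measurableType d) (R : realType).
Local Notation C := R[i].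
Local Notation modulus := (@Normc.normc R).
Implicit Types f g : T -> C.

Definition cmeasurable f : Prop :=
  measurable_fun setT (fun w => complex.Re (f w)) /\
  measurable_fun setT (fun w => complex.Im (f w)).

Lemma cmeasurable_cst (c : C) : cmeasurable (fun=> c).
Proof. by split; exact: measurable_cst. Qed.

Lemma cmeasurable_real (f : T -> R) :
  measurable_fun setT f -> cmeasurable (fun w => (f w)%:C).
Proof. by move=> mf; split=> //=; exact: measurable_cst. Qed.

Lemma cmeasurableD f g :
  cmeasurable f -> cmeasurable g -> cmeasurable (fun w => f w + g w).
Proof.
move=> [rf jf] [rg jg]; split.
  rewrite (_ : (fun w => _) = (fun w => complex.Re (f w) + complex.Re (g w))).
    exact: measurable_funD.
  by apply/funext => w; case: (f w) (g w) => a b [].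
rewrite (_ : (fun w => _) = (fun w => complex.Im (f w) + complex.Im (g w))).
  exact: measurable_funD.
by apply/funext => w; case: (f w) (g w) => a b [].
Qed.

Lemma cmeasurableM f g :
  cmeasurable f -> cmeasurable g -> cmeasurable (fun w => f w * g w).
Proof.
move=> [rf jf] [rg jg]; split.
  rewrite (_ : (fun w => _) = (fun w => complex.Re (f w) * complex.Re (g w) -
    complex.Im (f w) * complex.Im (g w))).
    by apply: measurable_funB; exact: measurable_funM.
  by apply/funext => w; case: (f w) (g w) => a b [].
rewrite (_ : (fun w => _) = (fun w => complex.Re (f w) * complex.Im (g w) +
  complex.Im (f w) * complex.Re (g w))).
  by apply: measurable_funD; exact: measurable_funM.
by apply/funext => w; case: (f w) (g w) => a b [].
Qed.

Lemma cmeasurableV f : cmeasurable f -> cmeasurable (fun w => (f w)^-1).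
Proof.
move=> [rf jf].
have mn : measurable_fun setT (fun w =>
    (complex.Re (f w) ^+ 2 + complex.Im (f w) ^+ 2)^-1).
  by apply: measurable_inv; apply: measurable_funD; exact: measurable_funX.
split.
  rewrite (_ : (fun w => _) = (fun w => complex.Re (f w) *
      (complex.Re (f w) ^+ 2 + complex.Im (f w) ^+ 2)^-1)).
    exact: measurable_funM.
  by apply/funext => w; case: (f w).
rewrite (_ : (fun w => _) = (fun w => - (complex.Im (f w) *
    (complex.Re (f w) ^+ 2 + complex.Im (f w) ^+ 2)^-1))).
  by apply: measurable_funN; exact: measurable_funM.
by apply/funext => w; case: (f w).
Qed.

Lemma cmeasurable_sum (I : Type) (s : seq I) (p : pred I) (F : I -> T -> C) :
  (forall i, cmeasurable (F i)) -> cmeasurable (fun w => \sum_(i <- s | p i) F i w).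
Proof.
move=> mF; elim: s => [|i s IH].
  by under eq_fun do rewrite big_nil; exact: cmeasurable_cst.
under eq_fun do rewrite big_cons.
by case: (p i) => //; exact: cmeasurableD.
Qed.

Lemma cmeasurable_prod (I : Type) (s : seq I) (p : pred I) (F : I -> T -> C) :
  (forall i, cmeasurable (F i)) -> cmeasurable (fun w => \prod_(i <- s | p i) F i w).
Proof.
move=> mF; elim: s => [|i s IH].
  by under eq_fun do rewrite big_nil; exact: cmeasurable_cst.
under eq_fun do rewrite big_cons.
by case: (p i) => //; exact: cmeasurableM.
Qed.

Lemma cmeasurable_if (b : T -> bool) f g : measurable_fun setT b ->
  cmeasurable f -> cmeasurable g ->
  cmeasurable (fun w => if b w then f w else g w).
Proof.
move=> mb [rf jf] [rg jg]; split.
  rewrite (_ : (fun w => _) = (fun w => if b w then complex.Re (f w)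
    else complex.Re (g w))); first exact: measurable_fun_ifT.
  by apply/funext => w; case: ifP.
rewrite (_ : (fun w => _) = (fun w => if b w then complex.Im (f w)
  else complex.Im (g w))); first exact: measurable_fun_ifT.
by apply/funext => w; case: ifP.
Qed.

Lemma measurable_modulus2 f :
  cmeasurable f -> measurable_fun setT (fun w => modulus (f w) ^+ 2).
Proof.
move=> [rf jf]; under eq_fun do rewrite modulus_sqr.
by apply: measurable_funD; exact: measurable_funX.
Qed.

Lemma measurable_sqrt (h : T -> R) :
  measurable_fun setT h -> measurable_fun setT (fun w => Num.sqrt (h w)).
Proof.
move=> mh; rewrite (_ : (fun w => _) = (fun w => Num.max (h w) 0 `^ (2^-1))).
  apply: measurableT_comp (measurable_powR _) _.
  exact: measurable_maxr.
apply/funext => w; have [h0|h0] := leP 0 (h w).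
  by rewrite powR12_sqrt.
by rewrite ltr0_sqrtr// powR0// invr_eq0.
Qed.

Lemma measurable_modulus f :
  cmeasurable f -> measurable_fun setT (fun w => modulus (f w)).
Proof.
move=> mf.
rewrite (_ : (fun w => _) = (fun w => Num.sqrt (modulus (f w) ^+ 2))).
  by apply: measurable_sqrt; exact: measurable_modulus2.
by apply/funext => w; rewrite sqrtr_sqr ger0_norm// modulus_ge0.
Qed.

Lemma measurable_neq0 f :
  cmeasurable f -> measurable_fun setT (fun w => f w != 0).
Proof.
move=> mf; apply: measurable_neg; under eq_fun do rewrite -modulus_eq0.
by apply: measurable_fun_eqr => //; exact: measurable_modulus.
Qed.

Definition mx_measurable m n (F : T -> 'M[C]_(m, n)) : Prop :=
  forall i j, cmeasurable (fun w => F w i j).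

Lemma mx_measurable_cst m n (M : 'M[C]_(m, n)) : mx_measurable (fun=> M).
Proof. by move=> i j; exact: cmeasurable_cst. Qed.

Lemma mx_measurableD m n (F G : T -> 'M[C]_(m, n)) :
  mx_measurable F -> mx_measurable G -> mx_measurable (fun w => F w + G w).
Proof.
move=> mF mG i j; under eq_fun do rewrite mxE; exact: cmeasurableD.
Qed.

Lemma mx_measurableZ m n f (F : T -> 'M[C]_(m, n)) :
  cmeasurable f -> mx_measurable F -> mx_measurable (fun w => f w *: F w).
Proof.
move=> mF mG i j; under eq_fun do rewrite mxE; exact: cmeasurableM.
Qed.

Lemma mx_measurable_sum m n (I : Type) (s : seq I) (p : pred I)
    (F : I -> T -> 'M[C]_(m, n)) : (forall i, mx_measurable (F i)) ->
  mx_measurable (fun w => \sum_(i <- s | p i) F i w).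
Proof.
move=> mF i j; under eq_fun do rewrite summxE.
by apply: cmeasurable_sum => k; exact: mF.
Qed.

Lemma mx_measurableM m n k (F : T -> 'M[C]_(m, n)) (G : T -> 'M[C]_(n, k)) :
  mx_measurable F -> mx_measurable G -> mx_measurable (fun w => F w *m G w).
Proof.
move=> mF mG i j; under eq_fun do rewrite mxE.
by apply: cmeasurable_sum => l; exact: cmeasurableM.
Qed.

Lemma cmeasurable_det n (F : T -> 'M[C]_n) :
  mx_measurable F -> cmeasurable (fun w => \det (F w)).
Proof.
move=> mF; rewrite /determinant; apply: cmeasurable_sum => s.
apply: cmeasurableM; first exact: cmeasurable_cst.
by apply: cmeasurable_prod => i; exact: mF.
Qed.

Lemma cmeasurable_trace n (F : T -> 'M[C]_n) :
  mx_measurable F -> cmeasurable (fun w => \tr (F w)).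
Proof. by move=> mF; apply: cmeasurable_sum => i; exact: mF. Qed.

Lemma mx_measurable_inv n (F : T -> 'M[C]_n) :
  mx_measurable F -> mx_measurable (fun w => invmx (F w)).
Proof.
move=> mF i j.
rewrite (_ : (fun w => _) = (fun w => if \det (F w) != 0
    then (\det (F w))^-1 * cofactor (F w) j i else F w i j)).
  apply: cmeasurable_if; last exact: mF.
    by apply: measurable_neq0; exact: cmeasurable_det.
  apply: cmeasurableM; first by apply: cmeasurableV; exact: cmeasurable_det.
  apply: cmeasurableM; first exact: cmeasurable_cst.
  apply: cmeasurable_det => a b; under eq_fun do rewrite !mxE; exact: mF.
apply/funext => w; rewrite /invmx unitmxE unitfE.
by case: ifP => // _; rewrite !mxE.
Qed.

End ComplexMeasurability.

(** * The tail of one column of the inverse *)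

Section CountingProbabilities.
Context d (T : measurableType d) (R : realType) (P : probability T R).

Lemma sum_probabilityE (I : finType) (E : I -> set T) (a : R) : 0 <= a ->
  (forall i, measurable (E i)) ->
  (a%:E * \sum_(i : I) P (E i) = \int[P]_w (a * \sum_(i : I) \1_(E i) w)%:E)%E.
Proof.
move=> a0 mE.
transitivity (a%:E * \int[P]_w (\sum_(i : I) (\1_(E i) w)%:E))%E.
  rewrite ge0_integral_sum//.
  - by congr (_ * _)%E; apply: eq_bigr => i _; rewrite integral_indic// setIT.
  - by move=> i; apply/measurable_EFinP; exact: measurable_indic.
rewrite -(@ge0_integralZl_EFin _ _ _ P setT measurableT
  (fun w => \sum_(i : I) (\1_(E i) w)%:E)%E)//.
- by apply: eq_integral => w _; rewrite EFinM -sumEFin.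
- by move=> w _; apply: sume_ge0 => i _; rewrite lee_fin.
- apply: emeasurable_sum => i; apply/measurable_EFinP; exact: measurable_indic.
Qed.

Lemma ler_count_probability (I J : finType) (E : I -> set T) (F : J -> set T)
    (a b : R) : 0 <= a -> 0 <= b ->
  (forall i, measurable (E i)) -> (forall j, measurable (F j)) ->
  (forall w, a * \sum_(i : I) \1_(E i) w <= b * \sum_(j : J) \1_(F j) w) ->
  (a%:E * \sum_(i : I) P (E i) <= b%:E * \sum_(j : J) P (F j))%E.
Proof.
move=> a0 b0 mE mF EF; rewrite !sum_probabilityE//.
have m (K : finType) (G : K -> set T) c : (forall k, measurable (G k)) ->
    measurable_fun setT (fun w => (c * \sum_(k : K) \1_(G k) w)%:E).
  move=> mG; apply/measurable_EFinP; apply: measurable_funM => //.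
  by apply: measurable_sum => k; exact: measurable_indic.
apply: ge0_le_integral => //; [|exact: m|exact: m|].
- by move=> w _; rewrite lee_fin mulr_ge0// sumr_ge0.
- by move=> w _; rewrite lee_fin.
Qed.

End CountingProbabilities.

Section ColumnTail.
Context (R : realType).
Local Notation C := R[i].
Local Notation modulus := (@Normc.normc R).
Context (sigma : R) (sigma0 : sigma != 0).
Hypothesis sigma_large : 1 <= sigma ^+ 2 * pi *+ 2.

Lemma ReM_real (x : R) (z : C) : complex.Re (x%:C * z) = x * complex.Re z.
Proof. by case: z => a b /=; rewrite mul0r subr0. Qed.

Definition affine_matrix (K : finType) N (A : 'M[C]_N) (M : K -> 'M[C]_N)
    (x : K -> R) : 'M[C]_N := A + \sum_k (x k)%:C *: M k.

Lemma mx_measurable_affine d (T : measurableType d) (K : finType) N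
    (A : 'M[C]_N) (M : K -> 'M[C]_N) (X : K -> T -> R) :
  (forall k, measurable_fun setT (X k)) ->
  mx_measurable (fun w => affine_matrix A M (X ^~ w)).
Proof.
move=> mX; apply: mx_measurableD; first exact: mx_measurable_cst.
apply: mx_measurable_sum => k; apply: mx_measurableZ; last exact: mx_measurable_cst.
exact: cmeasurable_real.
Qed.

Context d (T : measurableType d) (P : probability T R).
Context (K : finType) (X : K -> T -> R).
Hypothesis GX : gaussian_family sigma P X.
Context (N : nat) (A : 'M[C]_N) (M : K -> 'M[C]_N) (J : pred K) (j : 'I_N).
Hypothesis JM : forall k, J k -> in_cross j (M k).

Let H (x : K -> R) := affine_matrix A M x.

(* z (k, false) is the configuration, z (k, true) an independent copy of it
   that serves as a direction of differentiation. *)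
Let bad (lambda : R) (z : K * bool -> R) : Prop :=
  (\det (H (fun k => z (k, false))) != 0) &&
  (lambda <= modulus (\tr ((\sum_(k | J k) (z (k, true))%:C *: M k) *m
     invmx (H (fun k => z (k, false)))))).

Let measurable_bad lambda d' (T' : measurableType d') (Z : K * bool -> T' -> R) :
  (forall k, measurable_fun setT (Z k)) ->
  measurable [set w | bad lambda (Z ^~ w)].
Proof.
move=> mZ; apply: measurable_true; apply: measurable_and.
  apply: measurable_neq0; apply: cmeasurable_det.
  exact: (mx_measurable_affine _ _ (fun k => mZ (k, false))).
apply: measurable_fun_ler => //; apply: measurable_modulus.
apply: cmeasurable_trace; apply: mx_measurableM.
  apply: mx_measurable_sum => k; apply: mx_measurableZ.
    by apply: cmeasurable_real; exact: mZ.
  exact: mx_measurable_cst.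
apply: mx_measurable_inv.
exact: (mx_measurable_affine _ _ (fun k => mZ (k, false))).
Qed.

Local Notation P2 := (P \x P)%E.
Let Z := doubled X.

Let turn (t : R) (kb : K * bool) (w : T * T) : R :=
  if J kb.1 then
    if kb.2 then - rsin t * Z (kb.1, false) w + rcos t * Z (kb.1, true) w
    else rcos t * Z (kb.1, false) w + rsin t * Z (kb.1, true) w
  else Z kb w.

Let gaussian_turn t : gaussian_family sigma P2 (turn t).
Proof.
have GZ := gaussian_family_doubled GX.
apply: (@gaussian_family_rotate _ _ sigma0 _ _ P2 (K * bool)%type
  {k : K | J k} Z (turn t)
  (fun l => (val l, false)) (fun l => (val l, true))
  (fun=> rcos t) (fun=> rsin t) _ _ _ _ _ _ _ GZ).
- by move=> l l' [] /val_inj.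
- by move=> l l' [] /val_inj.
- by move=> l l'; apply/eqP => -[].
- by move=> l; exact: rcos2Drsin2.
- by move=> [k Jk] w; rewrite /turn /= Jk.
- by move=> [k Jk] w; rewrite /turn /= Jk.
- move=> [k b] k1 k2 w; rewrite /turn /=; case: ifP => // Jk.
  have l : {k : K | J k} by exists k.
  case: b k1 k2 => k1 k2.
    by move: k2 => /codomP []; exists (exist (fun k => J k) k Jk).
  by move: k1 => /codomP []; exists (exist (fun k => J k) k Jk).
Qed.

(* Averaging over m rotations, each of which preserves the law. *)
Let bad_le lambda : 4 <= lambda ->
  (P2 [set w | bad lambda (Z ^~ w)] <= (132 / lambda)%:E)%E.
Proof.
move=> l4; have l0 : 0 < lambda by lra.
(* With m of the order of lambda, the rounding term 1 / m of the count of the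
   bad angles is also O(1 / lambda). *)
pose m := (Num.truncn lambda).+1.
have lm : lambda < m%:R by exact: truncnS_gt.
have m0 : 0 < m%:R :> R by rewrite ltr0n.
pose E (i : 'I_m) := [set w | bad lambda (turn (i%:R / m%:R) ^~ w)].
have mE i : measurable (E i).
  by apply: measurable_bad; have [] := gaussian_turn (i%:R / m%:R).
have PE i : P2 (E i) = P2 [set w | bad lambda (Z ^~ w)].
  apply: (gaussian_family_law (E := [set z : config (K * bool)%type R |
    bad lambda z]) (gaussian_turn _) (gaussian_family_doubled GX)).
  exact: (measurable_bad _ (@measurable_coordinate R (K * bool)%type)).
have count w : 1 * \sum_(i < m) \1_(E i) w <=
    4 * (32 / lambda * m%:R + 1) * \sum_(i : unit) \1_[set: T * T] w :> R.
  rewrite mul1r big_const card_unit /= addr0 indicT mulr1.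
  have crossU b : in_cross j (\sum_(k | J k) (Z (k, b) w)%:C *: M k).
    move=> a a' aj a'j; rewrite summxE big1// => k Jk.
    by rewrite mxE (JM Jk)// mulr0.
  pose A' := A + \sum_(k | ~~ J k) (Z (k, false) w)%:C *: M k.
  apply: le_trans (count_bad_angles A' (crossU false) (crossU true) l4 _);
    last by [].
  rewrite natr_sum; apply: ler_sum => i _; rewrite indicE ler_nat.
  case: (boolP (_ \in _)) => // /set_mem; rewrite /E /= /bad.
  set t := i%:R / m%:R.
  have -> : H (fun k => turn t (k, false) w) = rotated_matrix A'
      (\sum_(k | J k) (Z (k, false) w)%:C *: M k)
      (\sum_(k | J k) (Z (k, true) w)%:C *: M k) t.
    rewrite /H /affine_matrix /rotated_matrix /A' -addrA -[RHS]addrA; congr (_ + _).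
    rewrite (bigID J)/= addrC; congr (_ + _).
      by apply: eq_bigr => k /negbTE Jk; rewrite /turn /= Jk.
    rewrite !scaler_sumr -big_split/=; apply: eq_bigr => k Jk.
    by rewrite /turn /= Jk !scalerA -scalerDl -!rmorphM -rmorphD.
  have -> : \sum_(k | J k) (turn t (k, true) w)%:C *: M k = rotated_derivative
      (\sum_(k | J k) (Z (k, false) w)%:C *: M k)
      (\sum_(k | J k) (Z (k, true) w)%:C *: M k) t.
    rewrite /rotated_derivative !scaler_sumr -big_split/=; apply: eq_bigr => k Jk.
    by rewrite /turn /= Jk !scalerA -scalerDl -rmorphN -!rmorphM -rmorphD.
  by move=> ->.
have rhs0 : 0 <= 4 * (32 / lambda * m%:R + 1).
  by rewrite mulr_ge0// addr_ge0// mulr_ge0// divr_ge0// ltW.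
have := ler_count_probability P2 ler01 rhs0 mE (fun=> measurableT) count.
have -> : (\sum_(i : 'I_m) P2 (E i) =
    \sum_(i : 'I_m) P2 [set w | bad lambda (Z ^~ w)])%E.
  by apply: eq_bigr => i _; exact: PE.
have -> : (\sum_(i : unit) P2 [set: T * T] = 1)%E.
  by rewrite big_const card_unit /= adde0; exact: probability_setT.
rewrite mul1e mule1.
set p := P2 _; have p_fin : p \is a fin_num.
  have p0 : (0 <= p)%E by exact: measure_ge0.
  rewrite ge0_fin_numE//; apply: le_lt_trans (ltry 1%R).
  apply: (probability_le1 (P \x P)%E); apply: measurable_bad.
  exact: (gaussian_family_doubled GX).1.
rewrite -(fineK p_fin) sumEFin sumr_const card_ord !lee_fin => pm.
rewrite -(ler_pM2r m0) [leLHS]mulr_natr; apply: (le_trans pm).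
have -> : 132 / lambda * m%:R = 4 * (32 / lambda * m%:R + m%:R / lambda).
  by field; exact: lt0r_neq0.
by rewrite ler_pM2l// lerD2l ler_pdivlMr// mul1r ltW.
Qed.

(** Given the matrix, the trace against a random combination of the M k is a
    Gaussian linear form in the independent copy.  With probability at least 1/2
    it exceeds a quarter of the norm of its coefficients, so the probability that
    this norm is large is at most twice the probability of a bad event. *)
Lemma affine_column_tail (lambda : R) : 4 <= lambda ->
  (P [set w | ((\det (H (X ^~ w)) != 0) && (4 * lambda <= Num.sqrt
     (\sum_(k | J k) complex.Re (\tr (M k *m invmx (H (X ^~ w)))) ^+ 2)))%R]
   <= (264 / lambda)%:E)%E.
Proof.
move=> l4; have l0 : 0 < lambda by lra.
have [mX _] := GX.
set F := [set w | _].
have mH := mx_measurable_affine A M mX.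
have mF : measurable F.
  apply: measurable_true; apply: measurable_and.
    by apply: measurable_neq0; exact: cmeasurable_det.
  apply: measurable_fun_ler => //; apply: measurable_sqrt.
  under eq_fun do rewrite big_mkcond.
  apply: measurable_sum => k; case: (J k) => //; apply: measurable_funX.
  suff [] : cmeasurable (fun w => \tr (M k *m invmx (H (X ^~ w)))) by [].
  apply: cmeasurable_trace; apply: mx_measurableM; first exact: mx_measurable_cst.
  exact: mx_measurable_inv.
have mB := measurable_bad lambda (gaussian_family_doubled GX).1.
have half : (2^-1%:E * P F <= P2 [set w | bad lambda (Z ^~ w)])%E.
  rewrite /product_measure1.
  rewrite -[X in P X]setIT -(integral_indic P measurableT mF).
  have mF1 : measurable_fun setT (fun w => (\1_F w : R)%:E).
    by apply/measurable_EFinP; exact: measurable_indic.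
  have F0 w : setT w -> (0 <= (\1_F w : R)%:E)%E by move=> _; rewrite lee_fin.
  have h0 : 0 <= 2^-1 :> R by [].
  rewrite -(ge0_integralZl_EFin P measurableT F0 mF1 h0).
  apply: ge0_le_integral.
  - by [].
  - by move=> w _; rewrite mule_ge0// lee_fin.
  - exact: measurable_funeM.
  - exact: measurable_fun_xsection.
  move=> w _; rewrite indicE; case: (boolP (w \in F)) => [/set_mem|_]; last first.
    by rewrite mule0.
  rewrite mule1 /F /= => /andP[dw lw].
  pose a k := if J k then complex.Re (\tr (M k *m invmx (H (X ^~ w)))) else 0.
  have sa : \sum_(k | J k) complex.Re (\tr (M k *m invmx (H (X ^~ w)))) ^+ 2 =
      \sum_k a k ^+ 2.
    rewrite big_mkcond; apply: eq_bigr => k _; rewrite /a.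
    by case: ifP => //; rewrite expr0n.
  rewrite sa in lw.
  have a0 : 0 < \sum_k a k ^+ 2.
    by rewrite -sqrtr_gt0 (lt_le_trans _ lw)// mulr_gt0.
  apply: le_trans (gaussian_linear_form sigma0 sigma_large GX a0) _.
  apply: le_measure; rewrite ?inE.
  - apply: measurable_ge_set; apply: measurableT_comp => //.
    by apply: measurable_sum => k; exact: measurable_funM.
  - exact: measurable_xsection.
  move=> w2 /= lw2; rewrite /xsection /= inE /= /bad; apply/andP; split=> //.
  rewrite mulmx_suml linear_sum/=; apply: le_trans (modulus_Re _).
  rewrite raddf_sum/= big_mkcond/=.
  have -> : \sum_k (if J k then complex.Re (\tr ((Z (k, true) (w, w2))%:C *: M k *m
      invmx (H (fun k => Z (k, false) (w, w2))))) else 0) = \sum_k a k * X k w2.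
    apply: eq_bigr => k _; rewrite /a; case: ifP => _; last by rewrite mul0r.
    by rewrite -scalemxAl linearZ /= ReM_real mulrC.
  by apply: le_trans lw2; rewrite ler_pdivlMr// mulrC.
rewrite -(@lee_pmul2l _ 2^-1%:E)// ?lte_fin ?invr_gt0//.
apply: (le_trans half); apply: (le_trans (bad_le l4)).
rewrite -EFinM lee_fin (_ : 2^-1 * (264 / lambda) = 132 / lambda)//.
by field; exact: lt0r_neq0.
Qed.

End ColumnTail.

(** * Gaussian ensembles and the tail of the inverse applied to a vector *)

Section MatrixConjugation.
Variables (F : fieldType) (n m : nat) (U W H : 'M[F]_n).
Hypotheses (UW : U *m W = 1%:M) (WU : W *m U = 1%:M).

Lemma det_conj_eq0 : (\det (U *m H *m W) != 0) = (\det H != 0).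
Proof.
have [Uu Wu] := mulmx1_unit UW.
by rewrite -!unitfE -!unitmxE !unitmx_mul Uu Wu andbT.
Qed.

Lemma invmx_conj_mul (v : 'M[F]_(n, m)) : \det H != 0 ->
  invmx (U *m H *m W) *m (U *m v) = U *m (invmx H *m v).
Proof.
move=> dH; have Hu : H \in unitmx by rewrite unitmxE unitfE.
have H'u : U *m H *m W \in unitmx by rewrite unitmxE unitfE det_conj_eq0.
apply: (can_inj (mulKmx H'u)); rewrite mulKVmx// -!mulmxA [W *m _]mulmxA WU.
by rewrite mul1mx [H *m _]mulmxA mulmxV// mul1mx.
Qed.

End MatrixConjugation.

Section ComplexMatrices.
Context (R : realType).
Local Notation C := R[i].
Local Notation modulus := (@Normc.normc R).
Local Notation conj := (@conjc R).

Definition star m n (M : 'M[C]_(m, n)) : 'M[C]_(n, m) := map_mx conj M^T.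

Lemma starE m n (M : 'M[C]_(m, n)) i j : star M i j = conj (M j i).
Proof. by rewrite !mxE. Qed.

Lemma star_mul m n k (M : 'M[C]_(m, n)) (L : 'M[C]_(n, k)) :
  star (M *m L) = star L *m star M.
Proof. by rewrite /star trmx_mul map_mxM. Qed.

Lemma starD m n (M L : 'M[C]_(m, n)) : star (M + L) = star M + star L.
Proof. by rewrite /star linearD map_mxD. Qed.

Lemma starK m n : cancel (@star m n) (@star n m).
Proof. by move=> M; apply/matrixP => i j; rewrite !mxE conjcK. Qed.

Lemma star_invmx n (M : 'M[C]_n) : star (invmx M) = invmx (star M).
Proof. by rewrite /star trmx_inv map_invmx. Qed.

Lemma mulcJ (z : C) : z * conj z = (modulus z ^+ 2)%:C.
Proof.
case: z => a b /=; rewrite sqr_sqrtr ?addr_ge0 ?sqr_ge0//.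
by apply/eqP; rewrite eq_complex /=; apply/andP; split; apply/eqP; ring.
Qed.

Lemma conjM_real (x : R) (z : C) : conj (x%:C * z) = x%:C * conj z.
Proof. by case: z => a b; apply/eqP; rewrite eq_complex /= !mul0r !subr0 !addr0 mulrN !eqxx. Qed.

Lemma modulusJ (z : C) : modulus (conj z) = modulus z.
Proof. by case: z => a b /=; rewrite sqrrN. Qed.

Definition sqnorm m (v : 'cV[C]_m) : R := \sum_i modulus (v i 0) ^+ 2.

Lemma sqnorm_ge0 m (v : 'cV[C]_m) : 0 <= sqnorm v.
Proof. by apply: sumr_ge0 => i _; exact: sqr_ge0. Qed.

Lemma sqnormZ m c (v : 'cV[C]_m) : sqnorm (c *: v) = modulus c ^+ 2 * sqnorm v.
Proof.
rewrite mulr_sumr; apply: eq_bigr => i _.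
by rewrite mxE Normc.normcM exprMn.
Qed.

Lemma sqnormE m (v : 'cV[C]_m) : (sqnorm v)%:C = (star v *m v) 0 0.
Proof.
rewrite mxE /sqnorm rmorph_sum; apply: eq_bigr => i _.
by rewrite starE mulrC mulcJ.
Qed.

Lemma sqnorm_isometry m n (U : 'M[C]_(m, n)) (v : 'cV[C]_n) :
  star U *m U = 1%:M -> sqnorm (U *m v) = sqnorm v.
Proof.
move=> UU; apply: (@complexI R); rewrite !sqnormE star_mul.
by rewrite -mulmxA [star U *m _]mulmxA UU mul1mx.
Qed.

Lemma sqnorm_eq0 m (v : 'cV[C]_m) : (sqnorm v == 0) = (v == 0).
Proof.
rewrite psumr_eq0; last by move=> i _; exact: sqr_ge0.
apply/allP/eqP => [v0|-> i _]; last by rewrite mxE modulus0 expr0n/= eqxx.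
apply/matrixP => i k; rewrite ord1 [RHS]mxE; apply/eqP.
by rewrite -modulus_eq0 -sqrf_eq0 (implyP (v0 i _))// mem_index_enum.
Qed.

End ComplexMatrices.

Section Ensemble.
Context (R : realType).
Local Notation C := R[i].
Local Notation modulus := (@Normc.normc R).
Local Notation conj := (@conjc R).

Context (N : nat) (B : finType) (beta : B -> C) (real_case : bool).
Hypothesis N0 : (0 < N)%N.

Local Notation K := ('I_N * 'I_N * B)%type.

(** The scalars of the ensemble: all complex numbers, or the real ones. *)
Definition scalar_number (z : C) : Prop := real_case -> conj z = z.

Hypothesis scalar_beta : forall b, scalar_number (beta b).
(* beta is an orthonormal basis of the scalars over the real numbers. *)
Hypothesis beta_dual : forall z, scalar_number z ->
  \sum_b (complex.Re (conj (beta b) * z))%:C * beta b = z.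

Lemma beta_frame z : scalar_number z ->
  \sum_b complex.Re (conj (beta b) * z) ^+ 2 = modulus z ^+ 2.
Proof.
move=> sz; transitivity (complex.Re (z * conj z)); last by rewrite mulcJ.
rewrite -{2}(beta_dual sz) mulr_suml raddf_sum/=; apply: eq_bigr => b _.
by rewrite -mulrA ReM_real -[beta b]conjcK -rmorphM conjcK/= expr2;
  case: (_ * z).
Qed.

Definition ginibre (x : K -> R) : 'M[C]_N :=
  \matrix_(i, j) \sum_b (x (i, j, b))%:C * beta b.

Definition wscale : R := (Num.sqrt (2 * N)%:R)^-1.

Definition ensemble (A : 'M[C]_N) (x : K -> R) : 'M[C]_N :=
  A + wscale%:C *: (ginibre x + star (ginibre x)).

Definition self_adjoint (A : 'M[C]_N) : Prop := star A = A.
Definition scalar_entries (A : 'M[C]_N) : Prop := forall i j, scalar_number (A i j).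

Let direction (k : K) : 'M[C]_N := wscale%:C *:
  (beta k.2 *: delta_mx k.1.1 k.1.2 + conj (beta k.2) *: delta_mx k.1.2 k.1.1).

Lemma ensembleE A x : ensemble A x = affine_matrix A direction x.
Proof.
rewrite /ensemble /affine_matrix; congr (_ + _).
apply/matrixP => i j; rewrite !mxE summxE [conj _]rmorph_sum mulrDr !mulr_sumr/=.
have E (a b : 'I_N) (c : B -> C) :
    \sum_(k : K) (c k.2 * ((a == k.1.1) && (b == k.1.2))%:R * (x k)%:C) =
    \sum_b0 c b0 * (x (a, b, b0))%:C.
  transitivity (\sum_(p : 'I_N * 'I_N) \sum_(b0 : B)
      c b0 * ((a == p.1) && (b == p.2))%:R * (x (p, b0))%:C).
    by rewrite pair_big/=; apply: eq_bigr => -[].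
  rewrite (bigD1 (a, b))//= [X in _ + X]big1 => [|[a' b'] ab]; last first.
    rewrite big1// => b0 _ /=; move: ab; rewrite -pair_eqE /= negb_and.
    rewrite ![_ == a]eq_sym ![_ == b]eq_sym => /orP[] /negbTE ->;
      by rewrite ?andbF mulr0 mul0r.
  by rewrite addr0; apply: eq_bigr => b0 _; rewrite !eqxx mulr1.
rewrite (eq_bigr (fun b => wscale%:C * beta b * (x (i, j, b))%:C)); last first.
  by move=> b _; rewrite mulrA mulrAC.
rewrite [X in _ + X](eq_bigr (fun b => wscale%:C * conj (beta b) * (x (j, i, b))%:C));
  last first.
  by move=> b _; rewrite conjM_real mulrA mulrAC.
rewrite -(E _ _ (fun b => wscale%:C * beta b)).
rewrite -(E _ _ (fun b => wscale%:C * conj (beta b))) -big_split/=.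
apply: eq_bigr => k _; rewrite !mxE [(j == _) && _]andbC; ring.
Qed.

Lemma hermitian_ensemble A x : self_adjoint A -> self_adjoint (ensemble A x).
Proof.
move=> hA; rewrite /self_adjoint /ensemble starD hA; congr (_ + _).
apply/matrixP => i j; rewrite !mxE conjM_real; congr (_ * _).
by rewrite rmorphD/= conjcK addrC.
Qed.

Lemma scalar_sum (I : Type) (s : seq I) (p : pred I) (F : I -> C) :
  (forall i, scalar_number (F i)) -> scalar_number (\sum_(i <- s | p i) F i).
Proof. by move=> sF r; rewrite rmorph_sum; apply: eq_bigr => i _; exact: sF i r. Qed.

Lemma scalar_ensemble A x : scalar_entries A -> scalar_entries (ensemble A x).
Proof.
move=> sA i j r; rewrite !mxE rmorphD/= conjM_real sA// rmorphD/=.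
have sg a b : scalar_number (\sum_b0 (x (a, b, b0))%:C * beta b0).
  by apply: scalar_sum => b0 r0; rewrite conjM_real scalar_beta.
by rewrite conjcK !sg.
Qed.

Lemma scalar_invmx (M : 'M[C]_N) : scalar_entries M -> scalar_entries (invmx M).
Proof.
move=> sM i j r; have E : map_mx conj M = M.
  by apply/matrixP => a b; rewrite mxE sM.
by rewrite -{2}E -map_invmx [RHS]mxE.
Qed.

Context (sigma : R) (sigma0 : sigma != 0).
Hypothesis sigma_large : 1 <= sigma ^+ 2 * pi *+ 2.

Context d (T : measurableType d) (P : probability T R).

Lemma measurable_ensemble A (X : K -> T -> R) : gaussian_family sigma P X ->
  mx_measurable (fun w => ensemble A (X ^~ w)).
Proof.
move=> [mX _] i j; under eq_fun do rewrite ensembleE.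
exact: mx_measurable_affine.
Qed.

Lemma measurable_sqnorm m (F : T -> 'cV[C]_m) : mx_measurable F ->
  measurable_fun setT (fun w => sqnorm (F w)).
Proof.
by move=> mF; apply: measurable_sum => i; apply: measurable_modulus2; exact: mF.
Qed.

Definition large A (X : K -> T -> R) (phi : 'cV[C]_N) (t : R) : set T :=
  [set w | (\det (ensemble A (X ^~ w)) != 0) &&
    (t ^+ 2 * N%:R * sqnorm phi <= sqnorm (invmx (ensemble A (X ^~ w)) *m phi))%R].

Lemma measurable_large A X phi t : gaussian_family sigma P X ->
  measurable (large A X phi t).
Proof.
move=> GX; have mH := measurable_ensemble A GX.
apply: measurable_true; apply: measurable_and.
  by apply: measurable_neq0; exact: cmeasurable_det.
apply: measurable_fun_ler => //; apply: measurable_sqnorm.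
by apply: mx_measurableM; [exact: mx_measurable_inv|exact: mx_measurable_cst].
Qed.

Definition vector_tail (phi : 'cV[C]_N) : Prop :=
  forall A X, self_adjoint A -> scalar_entries A -> gaussian_family sigma P X ->
  forall t : R, 0 < t -> (P (large A X phi t) <= (1056 / t)%:E)%E.

Let wscale2 : wscale ^+ 2 = (2 * N%:R)^-1.
Proof. by rewrite /wscale exprVn sqr_sqrtr// natrM. Qed.

(** For k = (i, j, b), the trace of the direction k against the inverse of H is
    2 wscale times the coordinate along beta b of the entry (i, j) of that
    inverse, so the norm bounded by affine_column_tail is sqrt (2 / N) times the
    norm of the column j. *)
Lemma vector_tail_delta (c : C) (j : 'I_N) : c != 0 ->
  vector_tail (c *: delta_mx j 0).
Proof.
move=> c0 A X hA sA GX t t0.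
have [t16|t16] := leP 16 t; last first.
  apply: (le_trans (probability_le1 P (measurable_large _ _ _ GX))).
  by rewrite lee_fin ler_pdivlMr//; lra.
pose J (k : K) := k.1.2 == j.
have Jcross k : J k -> in_cross j (direction k).
  move=> /eqP kj a b aj bj; rewrite !mxE kj (negbTE aj) (negbTE bj).
  by rewrite andbF !mulr0 addr0 mulr0.
(* The norm of the column exceeds t sqrt N when the norm of the traces exceeds
   4 lambda = sqrt 2 t. *)
pose lambda := Num.sqrt 2 * (t / 4).
have s21 : 1 <= Num.sqrt 2 :> R by rewrite -[leLHS]sqrtr1 ler_sqrt// ler1n.
have lt4 : t / 4 <= lambda by rewrite ler_peMl// divr_ge0// ltW.
have l4 : 4 <= lambda by apply: le_trans lt4; rewrite ler_pdivlMr//; lra.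
have := affine_column_tail sigma0 sigma_large GX A Jcross l4.
set F := [set w | _] => PF; apply: (@le_trans _ _ (264 / lambda)%:E); last first.
  rewrite lee_fin (_ : 1056 / t = 264 / (t / 4)); last first.
    by field; exact: lt0r_neq0.
  have l0 : 0 < lambda by apply: lt_le_trans l4.
  have t40 : 0 < t / 4 by apply: divr_gt0.
  have mono (a : R) : 0 <= a -> a / lambda <= a / (t / 4).
    by move=> a0; apply: ler_wpM2l => //; rewrite lef_pV2.
  by apply: mono; exact: ler0n.
apply: le_trans PF; rewrite (_ : large _ _ _ _ = F)//.
apply: eq_set => w; rewrite -ensembleE.
set H := ensemble A _; case: (boolP (\det H != 0)) => //= dH.
have hH : star (invmx H) = invmx H.
  by rewrite star_invmx (hermitian_ensemble _ hA).
have sH : scalar_entries (invmx H) by apply: scalar_invmx; exact: scalar_ensemble.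
have trE k : complex.Re (\tr (direction k *m invmx H)) =
    2 * wscale * complex.Re (conj (beta k.2) * invmx H k.1.1 k.1.2).
  rewrite /direction -scalemxAl linearZ/= ReM_real mulmxDl linearD/= -!scalemxAl.
  rewrite !linearZ/=.
  have trd a b : \tr (delta_mx a b *m invmx H) = invmx H b a.
    rewrite /mxtrace (bigD1 a)//= big1 ?addr0 => [|a' a'a]; last first.
      by rewrite mxE big1// => l _; rewrite mxE (negbTE a'a) mul0r.
    rewrite mxE (bigD1 b)//= big1 ?addr0 => [|b' b'b]; last first.
      by rewrite mxE (negbTE b'b) andbF mul0r.
    by rewrite mxE !eqxx mul1r.
  rewrite !trd -{1}hH starE; set z := invmx H _ _.
  rewrite [2 * wscale]mulrC -mulrA; congr (_ * _).
  by case: (beta _) z => a b [x y] /=; ring.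
have -> : \sum_(k | J k) complex.Re (\tr (direction k *m invmx H)) ^+ 2 =
    2 / N%:R * \sum_i modulus (invmx H i j) ^+ 2.
  under eq_bigr do rewrite trE exprMn.
  rewrite -mulr_sumr exprMn wscale2; congr (_ * _).
    by field; rewrite pnatr_eq0 -lt0n.
  transitivity (\sum_(p : 'I_N * 'I_N | p.2 == j) \sum_b
      complex.Re (conj (beta b) * invmx H p.1 p.2) ^+ 2).
    by rewrite pair_big/=; apply: eq_bigl => -[[a b] e]; rewrite andbT.
  under eq_bigr do rewrite beta_frame//.
  transitivity (\sum_i \sum_(l | l == j) modulus (invmx H i l) ^+ 2).
    by rewrite pair_big/=.
  by apply: eq_bigr => i _; rewrite big_pred1_eq.
have -> : sqnorm (invmx H *m (c *: delta_mx j 0)) =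
    modulus c ^+ 2 * \sum_i modulus (invmx H i j) ^+ 2.
  rewrite -scalemxAr sqnormZ; congr (_ * _); apply: eq_bigr => i _.
  congr (modulus _ ^+ 2); rewrite mxE (bigD1 j)//= big1 ?addr0.
    by rewrite mxE !eqxx mulr1.
  by move=> l lj; rewrite mxE (negbTE lj) mulr0.
have -> : sqnorm (c *: delta_mx j 0 : 'cV[C]_N) = modulus c ^+ 2.
  rewrite sqnormZ /sqnorm (bigD1 j)//= big1 ?addr0 => [|l lj]; last first.
    by rewrite mxE (negbTE lj) modulus0 expr0n.
  by rewrite mxE !eqxx -[1]/(1%:C) modulus_real normr1 expr1n mulr1.
congr is_true; rewrite [_ * modulus c ^+ 2]mulrC ler_pM2l; last first.
  by rewrite exprn_gt0// lt_neqAle eq_sym modulus_eq0 c0 modulus_ge0.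
set S := \sum_i _; have N0' : 0 < N%:R :> R by rewrite ltr0n.
have -> : 4 * lambda = Num.sqrt (2 * t ^+ 2).
  rewrite /lambda sqrtrM// sqrtr_sqr ger0_norm ?ltW//.
  by field.
have S0 : 0 <= S by apply: sumr_ge0 => i _; exact: sqr_ge0.
rewrite ler_sqrt; last by rewrite mulr_ge0// divr_ge0// ltW.
by rewrite -mulrA ler_pM2l// [_^-1 * _]mulrC ler_pdivlMr.
Qed.

(** Invariance of the law is witnessed by another Gaussian family on the same
    probability space. *)
Definition preserves_law (U : 'M[C]_N) : Prop :=
  [/\ star U *m U = 1%:M, U *m star U = 1%:M, scalar_entries U &
    forall X, gaussian_family sigma P X ->
    exists2 X', gaussian_family sigma P X' &
      forall w, ginibre (X' ^~ w) = U *m ginibre (X ^~ w) *m star U].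

Lemma scalarM z1 z2 : scalar_number z1 -> scalar_number z2 -> scalar_number (z1 * z2).
Proof. by move=> s1 s2 r; rewrite rmorphM/= s1// s2. Qed.

Lemma scalar_mulmx (M L : 'M[C]_N) :
  scalar_entries M -> scalar_entries L -> scalar_entries (M *m L).
Proof.
by move=> sM sL i j; rewrite mxE; apply: scalar_sum => k; exact: scalarM.
Qed.

Lemma scalar_star (M : 'M[C]_N) : scalar_entries M -> scalar_entries (star M).
Proof. by move=> sM i j r; rewrite starE conjcK sM. Qed.

(** The conjugate U H U^* belongs to the ensemble around U A U^*, and vector_tail
    is uniform in A. *)
Lemma vector_tail_unitary (U : 'M[C]_N) phi :
  preserves_law U -> vector_tail (U *m phi) -> vector_tail phi.
Proof.
move=> [UU UU' sU lU] tU A X hA sA GX t t0.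
have [X' GX' X'E] := lU X GX.
pose A' := U *m A *m star U.
have hA' : self_adjoint A' by rewrite /self_adjoint /A' !star_mul starK hA mulmxA.
have sA' : scalar_entries A'.
  by apply: scalar_mulmx; [exact: scalar_mulmx|exact: scalar_star].
apply: le_trans (tU A' X' hA' sA' GX' t t0).
rewrite (_ : large A X phi t = large A' X' (U *m phi) t)//.
apply: eq_set => w.
have HE : ensemble A' (X' ^~ w) = U *m ensemble A (X ^~ w) *m star U.
  rewrite /ensemble X'E !star_mul starK mulmxDr mulmxDl -/A'; congr (_ + _).
  by rewrite -scalemxAr -scalemxAl mulmxDr mulmxDl !mulmxA.
rewrite HE det_conj_eq0//; case: (boolP (\det _ != 0)) => //= dH.
by rewrite invmx_conj_mul// !(sqnorm_isometry _ UU).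
Qed.

(** ** Real rotations *)

Let rotmx (p q : 'I_N) (c s : R) : 'M[C]_N := \matrix_(i, j)
  (if i == p then c * (j == p)%:R + s * (j == q)%:R
   else if i == q then - s * (j == p)%:R + c * (j == q)%:R
   else (i == j)%:R)%:C.

Let rotmx_mul m (p q : 'I_N) (c s : R) (M : 'M[C]_(N, m)) i j : p != q ->
  (rotmx p q c s *m M) i j =
  if i == p then c%:C * M p j + s%:C * M q j
  else if i == q then - s%:C * M p j + c%:C * M q j else M i j.
Proof.
move=> pq; rewrite mxE.
have delta k : \sum_l ((l == k)%:R : R)%:C * M l j = M k j.
  rewrite (bigD1 k)//= eqxx mul1r big1 ?addr0// => l /negbTE ->.
  by rewrite mul0r.
have two a b k l : \sum_i0 (a * (i0 == k)%:R + b * (i0 == l)%:R)%:C * M i0 j =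
    a%:C * M k j + b%:C * M l j.
  rewrite -(delta k) -(delta l) !mulr_sumr -big_split/=; apply: eq_bigr => i0 _.
  by rewrite rmorphD !rmorphM mulrDl !mulrA.
case: (eqVneq i p) => ip.
  by rewrite -two; apply: eq_bigr => l _; rewrite mxE ip eqxx.
case: (eqVneq i q) => iq.
  rewrite -rmorphN -two; apply: eq_bigr => l _; rewrite mxE iq eqxx.
  by rewrite eq_sym (negbTE pq).
rewrite -(delta i); apply: eq_bigr => l _; rewrite mxE (negbTE ip) (negbTE iq).
by rewrite eq_sym.
Qed.

Let row_rotation (p q : 'I_N) (c s : R) (X : K -> T -> R) (k : K) (w : T) : R :=
  if k.1.1 == p then c * X (p, k.1.2, k.2) w + s * X (q, k.1.2, k.2) w
  else if k.1.1 == q then - s * X (p, k.1.2, k.2) w + c * X (q, k.1.2, k.2) w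
  else X k w.

Let transposed (X : K -> T -> R) (k : K) : T -> R := X (k.1.2, k.1.1, k.2).

Let gaussian_transposed X :
  gaussian_family sigma P X -> gaussian_family sigma P (transposed X).
Proof.
apply: (@gaussian_family_reindex _ _ _ _ _ _ _ X
  (fun k : K => (k.1.2, k.1.1, k.2))).
by move=> [[i j] b] [[i' j'] b'] [] -> -> ->.
Qed.

Let ginibre_transposed X w :
  ginibre (transposed X ^~ w) = (ginibre (X ^~ w))^T.
Proof. by apply/matrixP => i j; rewrite !mxE. Qed.

Let gaussian_row_rotation p q c s X : p != q -> c ^+ 2 + s ^+ 2 = 1 ->
  gaussian_family sigma P X -> gaussian_family sigma P (row_rotation p q c s X).
Proof.
move=> pq cs; have qp : q != p by rewrite eq_sym.
apply: (@gaussian_family_rotate _ _ sigma0 _ _ _ K ('I_N * B)%type X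
  (row_rotation p q c s X) (fun l => (p, l.1, l.2)) (fun l => (q, l.1, l.2))
  (fun=> c) (fun=> s)).
- by move=> [? ?] [? ?] [] -> ->.
- by move=> [? ?] [? ?] [] -> ->.
- by move=> l l'; apply/eqP => -[] /eqP; rewrite (negbTE pq).
- by [].
- by move=> [i b] w; rewrite /row_rotation/= eqxx.
- by move=> [i b] w; rewrite /row_rotation/= eqxx (negbTE qp).
- move=> [[i j] b] k1 k2 w; rewrite /row_rotation/=.
  case: eqP => [ip|_].
    by move: k1; rewrite ip => /codomP []; exists (j, b).
  by case: eqP => [iq|//]; move: k2; rewrite iq => /codomP []; exists (j, b).
Qed.

Let ginibre_row_rotation p q c s X w : p != q ->
  ginibre (row_rotation p q c s X ^~ w) = rotmx p q c s *m ginibre (X ^~ w).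
Proof.
move=> pq; apply/matrixP => i j; rewrite rotmx_mul// !mxE /row_rotation/=.
have [_|_] := eqVneq i p; last have [_|//] := eqVneq i q.
  rewrite !mulr_sumr -big_split/=; apply: eq_bigr => b _.
  by rewrite rmorphD !rmorphM mulrDl !mulrA.
rewrite !mulr_sumr -big_split/=; apply: eq_bigr => b _.
by rewrite rmorphD !rmorphM rmorphN mulrDl !mulrA.
Qed.

Let star_rotmx p q c s : star (rotmx p q c s) = (rotmx p q c s)^T.
Proof. by apply/matrixP => i j; rewrite starE !mxE conjc_real. Qed.

Let rotmx_orth p q c s : p != q -> c ^+ 2 + s ^+ 2 = 1 ->
  rotmx p q c s *m star (rotmx p q c s) = 1%:M.
Proof.
move=> pq cs; rewrite star_rotmx; apply/matrixP => i j.
have qp : q != p by rewrite eq_sym.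
have E (a b : R) : a = b -> a%:C = b%:C by move=> ->.
rewrite rotmx_mul// !mxE !eqxx (negbTE pq) (negbTE qp).
have [ip|ip] := eqVneq i p; last have [iq|iq] := eqVneq i q.
- rewrite -!rmorphM -!rmorphD -(rmorph_nat (real_complex R)); apply: E.
  have [jp|jp] := eqVneq j p; last have [jq|jq] := eqVneq j q.
  + by rewrite ip jp eqxx !mulr1n !mulr0n -[RHS]cs; ring.
  + by rewrite ip jq (negbTE pq); rewrite ?mulr1n ?mulr0n; ring.
  + by rewrite ip eq_sym (negbTE jp); rewrite ?mulr1n ?mulr0n; ring.
- rewrite -rmorphN -!rmorphM -!rmorphD -(rmorph_nat (real_complex R)); apply: E.
  have [jp|jp] := eqVneq j p; last have [jq|jq] := eqVneq j q.
  + by rewrite iq jp (negbTE qp); rewrite ?mulr1n ?mulr0n; ring.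
  + by rewrite iq jq eqxx !mulr1n !mulr0n -[RHS]cs; ring.
  + by rewrite iq eq_sym (negbTE jq); rewrite ?mulr1n ?mulr0n; ring.
rewrite -(rmorph_nat (real_complex R)); apply: E.
have [jp|jp] := eqVneq j p; last have [jq|//] := eqVneq j q.
- by rewrite jp (negbTE ip); rewrite ?mulr1n ?mulr0n; ring.
- by rewrite jq (negbTE iq); rewrite ?mulr1n ?mulr0n; ring.
by rewrite [j == i]eq_sym.
Qed.

Lemma preserves_law_rotation p q c s : p != q -> c ^+ 2 + s ^+ 2 = 1 ->
  preserves_law (rotmx p q c s).
Proof.
move=> pq cs; have UU := rotmx_orth pq cs.
split=> [|//||X GX]; first exact: mulmx1C.
  by move=> i j r; rewrite mxE conjc_real.
exists (transposed (row_rotation p q c s (transposed (row_rotation p q c s X)))).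
  apply: gaussian_transposed; apply: gaussian_row_rotation => //.
  by apply: gaussian_transposed; exact: gaussian_row_rotation.
move=> w; rewrite ginibre_transposed ginibre_row_rotation// ginibre_transposed.
by rewrite ginibre_row_rotation// trmx_mul trmxK star_rotmx.
Qed.

(** Rotations annihilate the coordinates of a real vector one after the other,
    until a multiple of a basis vector remains. *)
Lemma vector_tail_real (r : 'I_N -> R) :
  (exists i, r i != 0) -> vector_tail (\col_i (r i)%:C).
Proof.
have [n] := ubnP #|[pred i | r i != 0]|; elim: n => // n IH in r *.
rewrite ltnS => rn [p rp].
have [[q /andP[qp rq]]|only] := pselect (exists q, (q != p) && (r q != 0)).
  have pq : p != q by rewrite eq_sym.
  pose rho := Num.sqrt (r p ^+ 2 + r q ^+ 2).
  have rho2 : rho ^+ 2 = r p ^+ 2 + r q ^+ 2.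
    by rewrite sqr_sqrtr// addr_ge0 ?sqr_ge0.
  have rho0 : rho != 0.
    by rewrite -sqrf_eq0 rho2 paddr_eq0 ?sqr_ge0// !sqrf_eq0 (negbTE rp).
  have cs : (r p / rho) ^+ 2 + (r q / rho) ^+ 2 = 1.
    by rewrite !expr_div_n -mulrDl -rho2 divff// sqrf_eq0.
  apply: (vector_tail_unitary (preserves_law_rotation pq cs)).
  pose r' i := if i == p then rho else if i == q then 0 else r i.
  have -> : rotmx p q (r p / rho) (r q / rho) *m (\col_i (r i)%:C) =
      \col_i (r' i)%:C.
    apply/matrixP => i j; rewrite rotmx_mul// !mxE -!rmorphM -rmorphN -!rmorphM.
    rewrite -!rmorphD /r'; have [ip|ip] := eqVneq i p.
      congr (_ %:C); rewrite -[RHS](mulfK rho0) -expr2 rho2; ring.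
    have [iq|//] := eqVneq i q.
    by congr (_ %:C); ring.
  apply: IH; last by exists p; rewrite /r' eqxx.
  apply: leq_trans rn; apply: proper_card; apply/properP; split.
    apply/fintype.subsetP => i; rewrite !inE /r'.
    by have [->//|_] := eqVneq i p; have [_|//] := eqVneq i q; rewrite eqxx.
  by exists q; rewrite !inE ?rq// /r' (negbTE qp) eqxx eqxx.
rewrite (_ : \col_i _ = (r p)%:C *: delta_mx p 0); last first.
  apply/matrixP => i j; rewrite ord1 !mxE eqxx andbT.
  have [->|ip] := eqVneq i p; first by rewrite mulr1.
  rewrite mulr0 (_ : r i = 0)//; apply: contrapT => /eqP ri.
  by apply: only; exists i; rewrite ip.
by apply: vector_tail_delta; rewrite -modulus_eq0 modulus_real normr_eq0.
Qed.

End Ensemble.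

(** * Averaging over signs: the Frobenius norm of the inverse *)

Lemma sum_cauchy_schwarz (R : realFieldType) (J : finType) (u u' : J -> R) :
  (\sum_j u j * u' j) ^+ 2 <= (\sum_j u j ^+ 2) * (\sum_j u' j ^+ 2).
Proof.
pose n2 (u : J -> R) := \sum_j u j ^+ 2; pose inner (u u' : J -> R) := \sum_j u j * u' j.
rewrite -/(n2 u) -/(n2 u') -/(inner u u').
have [u0|u0] := eqVneq (n2 u) 0.
  suff -> : inner u u' = 0 by rewrite u0 mul0r expr0n.
  rewrite /inner big1// => j _.
  have /eqP : n2 u == 0 by rewrite u0.
  rewrite /n2 => /psumr_eq0P uj; apply/eqP; rewrite mulf_eq0 -sqrf_eq0 uj ?eqxx//.
  by move=> *; exact: sqr_ge0.
have up : 0 < n2 u by rewrite lt_def u0; apply: sumr_ge0 => *; exact: sqr_ge0.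
rewrite -(ler_pM2l up) -subr_ge0.
have -> : n2 u * (n2 u * n2 u') - n2 u * inner u u' ^+ 2 =
    \sum_j (n2 u * u' j - inner u u' * u j) ^+ 2.
  have E (a b : R) : \sum_j (a * u' j - b * u j) ^+ 2 =
      a ^+ 2 * (\sum_j u' j ^+ 2) - 2 * a * b * (\sum_j u j * u' j)
      + b ^+ 2 * (\sum_j u j ^+ 2).
    rewrite !mulr_sumr -sumrB -big_split/=; apply: eq_bigr => j _; ring.
  by rewrite E -/(n2 u) -/(n2 u') -/(inner u u'); ring.
by apply: sumr_ge0 => *; exact: sqr_ge0.
Qed.

Section SignAverage.
Context (R : realType) (I J : finType) (v : I -> J -> R).
Local Notation signs := {ffun I -> bool}.

Let sg (b : bool) : R := if b then -1 else 1.
Let signed_sum (r : seq I) (e : signs) (j : J) : R := \sum_(i <- r) sg (e i) * v i j.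
Let n2 (u : J -> R) : R := \sum_j u j ^+ 2.

Let flip (i : I) (e : signs) : signs := [ffun k => if k == i then ~~ e k else e k].

Let flipK i : involutive (flip i).
Proof. by move=> e; apply/ffunP => k; rewrite !ffunE; case: eqP => //; rewrite negbK. Qed.

Let sum_flip i (f : signs -> R) :
  \sum_e f e = 2^-1 * \sum_e (f e + f (flip i e)).
Proof.
have E : \sum_e f e = \sum_e f (flip i e) by exact: reindex_inj (inv_inj (flipK i)).
by rewrite big_split/= -E; set S := \sum_e f e; field.
Qed.

Let signed_sum_flip i r e j : i \notin r -> signed_sum r (flip i e) j = signed_sum r e j.
Proof.
move=> ir; rewrite /signed_sum !big_seq; apply: eq_bigr => k kr; congr (sg _ * _).
by rewrite ffunE; case: eqP => // ki; rewrite -ki kr in ir.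
Qed.

Let inner (u u' : J -> R) : R := \sum_j u j * u' j.

Let n2_cons i r e : i \notin r ->
  let a := n2 (signed_sum r e) in let b := inner (signed_sum r e) (v i) in
  n2 (signed_sum (i :: r) e) = a + 2 * sg (e i) * b + n2 (v i) /\
  n2 (signed_sum (i :: r) (flip i e)) = a - 2 * sg (e i) * b + n2 (v i).
Proof.
move=> ir a b; split.
  rewrite /a /b /n2 /inner mulr_sumr -!big_split/=; apply: eq_bigr => j _.
  by rewrite /signed_sum big_cons; case: (e i); rewrite /sg; ring.
rewrite /a /b /n2 /inner mulr_sumr -sumrB -!big_split/=; apply: eq_bigr => j _.
rewrite [signed_sum (i :: r) _ j]big_cons -/(signed_sum r _ j) signed_sum_flip//.
by rewrite ffunE eqxx; case: (e i); rewrite /sg /=; ring.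
Qed.

Let total : R := \sum_(e : signs) 1.
Let Q (r : seq I) : R := \sum_(i <- r) n2 (v i).

Let second_moment r : uniq r -> \sum_e n2 (signed_sum r e) = total * Q r.
Proof.
elim: r => [_|i r IH /= /andP[ir ur]].
  rewrite /Q big_nil mulr0 big1// => e _; rewrite /n2 big1// => j _.
  by rewrite /signed_sum big_nil expr0n.
rewrite (sum_flip i) /Q big_cons mulrDr -/(Q r) -(IH ur) /total mulr_suml.
rewrite -big_split/= mulr_sumr; apply: eq_bigr => e _.
by have [-> ->] := n2_cons e ir; field.
Qed.

Let fourth_moment r : uniq r ->
  \sum_e n2 (signed_sum r e) ^+ 2 <= total * (3 * Q r ^+ 2).
Proof.
have total0 : 0 <= total by apply: sumr_ge0.
elim: r => [_|i r IH /= /andP[ir ur]].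
  rewrite /Q big_nil expr0n mulr0 mulr0 big1// => e _; rewrite /n2 big1 ?expr0n// => j _.
  by rewrite /signed_sum big_nil expr0n.
set c := n2 (v i).
apply: (@le_trans _ _ (\sum_e (n2 (signed_sum r e) ^+ 2 +
    6 * c * n2 (signed_sum r e) + c ^+ 2 * 1))).
  rewrite (sum_flip i) mulr_sumr; apply: ler_sum => e _.
  have [-> ->] := n2_cons e ir; rewrite -/c.
  have : inner (signed_sum r e) (v i) ^+ 2 <= n2 (signed_sum r e) * c.
    exact: sum_cauchy_schwarz.
  set a := n2 _; set b := inner _ _ => ab.
  have sg2 : sg (e i) ^+ 2 = 1 by case: (e i); rewrite /sg; ring.
  have -> : 2^-1 * ((a + 2 * sg (e i) * b + c) ^+ 2 + (a - 2 * sg (e i) * b + c) ^+ 2) =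
     (a + c) ^+ 2 + 4 * sg (e i) ^+ 2 * b ^+ 2 by field.
  by rewrite sg2; nra.
rewrite !big_split/= -!mulr_sumr second_moment// -/total.
apply: (@le_trans _ _ (total * (3 * Q r ^+ 2) + 6 * c * (total * Q r) + c ^+ 2 * total)).
  by rewrite !lerD2r IH.
rewrite /Q big_cons -/(Q r) -/c.
have -> : total * (3 * Q r ^+ 2) + 6 * c * (total * Q r) + c ^+ 2 * total =
  total * (3 * Q r ^+ 2 + 6 * c * Q r + c ^+ 2) by ring.
by apply: ler_wpM2l => //; nra.
Qed.

(** Second moment method: the square norm of a random signed sum has mean the
    sum of the square norms, and a second moment at most three times the square
    of its mean; so it exceeds half its mean with probability at least 1/10. *)
Lemma signed_sum_often_large :
  \sum_(e : signs) 1 <= 10 * \sum_(e : signs)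
    ((\sum_i \sum_j v i j ^+ 2) / 2 <=
      \sum_j (\sum_i (if e i then -1 else 1) * v i j) ^+ 2)%R%:R :> R.
Proof.
pose r := index_enum I; have ur : uniq r by exact: index_enum_uniq.
rewrite -/(Q r) -/total; pose F e := (Q r / 2 <= n2 (signed_sum r e))%R.
have Q0 : 0 <= Q r by apply: sumr_ge0 => *; apply: sumr_ge0 => *; exact: sqr_ge0.
have n20 u : 0 <= n2 u by apply: sumr_ge0 => *; exact: sqr_ge0.
have total0 : 0 <= total by apply: sumr_ge0.
change (total <= 10 * \sum_e (F e)%:R).
have [Qz|Qn] := eqVneq (Q r) 0.
  have -> : \sum_e (F e)%:R = total.
    by apply: eq_bigr => e _; rewrite /F Qz mul0r n20.
  by lra.
have Qp : 0 < Q r by rewrite lt_def Qn.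
have Q2p : 0 < Q r ^+ 2 by rewrite exprn_gt0.
rewrite -(ler_pM2r Q2p).
(* A quadratic polynomial in the square norm that is negative below half the
   mean, and at most ten times the squared mean everywhere. *)
apply: (@le_trans _ _ (\sum_e (4 * Q r * n2 (signed_sum r e)
    - 3^-1 * n2 (signed_sum r e) ^+ 2 - 2 * Q r ^+ 2 * 1))).
  rewrite !sumrB -!mulr_sumr second_moment// -/total.
  by have := fourth_moment ur; nra.
rewrite [leRHS]mulrAC [leRHS]mulr_sumr; apply: ler_sum => e _; rewrite /F.
set a := n2 _; set q := Q r in Qp *; have [aq|aq] := leP (q / 2) a => /=.
  by have := sqr_ge0 (a - 6 * q); nra.
have qa : 0 <= q * (q / 2 - a).
  by apply: mulr_ge0; rewrite ?subr_ge0; exact: ltW.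
by have := sqr_ge0 a; rewrite mulr0; nra.
Qed.

End SignAverage.

Section FrobeniusTail.
Context (R : realType).
Local Notation C := R[i].
Local Notation modulus := (@Normc.normc R).
Context (N : nat) (B : finType) (beta : B -> C) (real_case : bool).
Hypothesis N0 : (0 < N)%N.
Local Notation K := ('I_N * 'I_N * B)%type.
Hypothesis scalar_beta : forall b, scalar_number real_case (beta b).
Hypothesis beta_dual : forall z, scalar_number real_case z ->
  \sum_b (complex.Re (conjc (beta b) * z))%:C * beta b = z.
Context (sigma : R) (sigma0 : sigma != 0).
Hypothesis sigma_large : 1 <= sigma ^+ 2 * pi *+ 2.
Context d (T : measurableType d) (P : probability T R).

Definition frob2 m n (M : 'M[C]_(m, n)) : R := \sum_i \sum_j modulus (M i j) ^+ 2.

Lemma sum_re_im (g : 'I_N -> C) :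
  \sum_(j : 'I_N * bool)
    (if j.2 then complex.Im (g j.1) else complex.Re (g j.1)) ^+ 2 =
  \sum_j modulus (g j) ^+ 2.
Proof.
transitivity (\sum_j \sum_(b : bool)
    (if b then complex.Im (g j) else complex.Re (g j)) ^+ 2).
  by rewrite pair_big/=; apply: eq_bigr => -[].
by apply: eq_bigr => j _; rewrite big_bool/= modulus_sqr addrC.
Qed.

Definition large_frobenius A (X : K -> T -> R) (t : R) : set T :=
  [set w | (\det (ensemble beta A (X ^~ w)) != 0) &&
    (t ^+ 2 * N%:R ^+ 2 <= frob2 (invmx (ensemble beta A (X ^~ w))))%R].

Lemma measurable_frob2 m n (F : T -> 'M[C]_(m, n)) : mx_measurable F ->
  measurable_fun setT (fun w => frob2 (F w)).
Proof.
by move=> mF; apply: measurable_sum => i; apply: measurable_sum => j;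
  apply: measurable_modulus2; exact: mF.
Qed.

Lemma measurable_large_frobenius A X t : gaussian_family sigma P X ->
  measurable (large_frobenius A X t).
Proof.
move=> GX; have mH := measurable_ensemble beta A GX.
apply: measurable_true; apply: measurable_and.
  by apply: measurable_neq0; exact: cmeasurable_det.
apply: measurable_fun_ler => //; apply: measurable_frob2.
exact: mx_measurable_inv.
Qed.

(** A matrix with large Frobenius norm maps a positive proportion of the vectors
    of signs to large vectors, and each of them is covered by the tail bound for
    a fixed real vector. *)
Lemma frobenius_tail A X : self_adjoint A -> scalar_entries real_case A ->
  gaussian_family sigma P X ->
  forall t : R, 0 < t -> (P (large_frobenius A X t) <= (21120 / t)%:E)%E.
Proof.
move=> hA sA GX t t0.
pose phi (e : {ffun 'I_N -> bool}) : 'cV[C]_N :=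
  \col_i (if e i then -1 else 1 : R)%:C.
have tail e : (P (large beta A X (phi e) (t / 2)) <= (1056 / (t / 2))%:E)%E.
  have r0 : exists i, (if e i then -1 else 1 : R) != 0.
    by exists (Ordinal N0); case: ifP => _; rewrite ?oppr_eq0 oner_eq0.
  by apply: (vector_tail_real N0 scalar_beta beta_dual sigma0 sigma_large r0) => //;
    rewrite divr_gt0.
have phi_norm e : sqnorm (phi e) = N%:R.
  rewrite /sqnorm (eq_bigr (fun=> 1)) ?sumr_const ?card_ord// => i _.
  rewrite mxE modulus_real; case: ifP => _; rewrite ?normrN normr1 expr1n//.
set S := \sum_(e : {ffun 'I_N -> bool}) 1 : R.
have S0 : 0 < S.
  by rewrite /S sumr_const ltr0n; apply/card_gt0P; exists [ffun=> true].
have count w : S * \sum_(i : unit) \1_(large_frobenius A X t) w <=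
    10 * \sum_e \1_(large beta A X (phi e) (t / 2)) w.
  rewrite big_const card_unit /= addr0 indicE.
  case: (boolP (w \in _)) => [|_]; last by rewrite mulr0 mulr_ge0// sumr_ge0.
  rewrite inE => -[/andP[dH]]; set H := ensemble _ _ _ => big.
  pose v (i : 'I_N) (j : 'I_N * bool) : R :=
    if j.2 then complex.Im (invmx H j.1 i) else complex.Re (invmx H j.1 i).
  have v2 : \sum_i \sum_j v i j ^+ 2 = frob2 (invmx H).
    rewrite /frob2 [RHS]exchange_big/=; apply: eq_bigr => i _.
    exact: (sum_re_im (fun j => invmx H j i)).
  have n2E (e : {ffun 'I_N -> bool}) :
      \sum_j (\sum_i (if e i then -1 else 1) * v i j) ^+ 2 = sqnorm (invmx H *m phi e).
    rewrite /sqnorm -sum_re_im; apply: eq_bigr => -[j b] _.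
    rewrite /v /=; case: b; rewrite mxE raddf_sum; congr (_ ^+ 2);
      apply: eq_bigr => i _; rewrite mxE mulrC;
      by case: (invmx H j i) => x y /=; rewrite mulr0 ?subr0 ?add0r.
  rewrite mulr1; apply: le_trans (signed_sum_often_large v) _.
  apply: ler_wpM2l => //; apply: ler_sum => e _; rewrite n2E v2 indicE ler_nat.
  case: leP => //= half; rewrite lt0b; apply/mem_set; rewrite /large /= -/H dH.
  apply: le_trans half; rewrite phi_norm; nra.
have := ler_count_probability P (ltW S0) (ler0n R 10)
  (fun=> measurable_large_frobenius A t GX)
  (fun e => measurable_large beta A (phi e) (t / 2) GX) count.
rewrite big_const card_unit /= adde0 => le1.
have le2 : (S%:E * P (large_frobenius A X t) <= (S * (21120 / t))%:E)%E.
  apply: (le_trans le1); rewrite (_ : S * (21120 / t) = 10 * (S * (1056 / (t / 2)))).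
    rewrite EFinM lee_pmul2l// /S mulr_suml -sumEFin.
    by apply: lee_sum => e _; rewrite mul1r.
  by field; exact: lt0r_neq0.
move: le2; rewrite EFinM lee_pmul2l//.
Qed.
End FrobeniusTail.

(** * Phases: arbitrary complex vectors *)

Section Phases.
Context (R : realType).
Local Notation C := R[i].
Local Notation modulus := (@Normc.normc R).
Local Notation conj := (@conjc R).

Definition complex_basis (b : bool) : C := if b then 'i else 1.

Lemma scalar_complex_basis b : scalar_number false (complex_basis b).
Proof. by []. Qed.

Lemma complex_basis_dual z : scalar_number false z ->
  \sum_b (complex.Re (conj (complex_basis b) * z))%:C * complex_basis b = z.
Proof.
move=> _; rewrite big_bool/=; case: z => x y; apply/eqP; rewrite eq_complex /=.
by apply/andP; split; apply/eqP; ring.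
Qed.

Context (N : nat) (N0 : (0 < N)%N).
Local Notation K := ('I_N * 'I_N * bool)%type.
Context (sigma : R) (sigma0 : sigma != 0).
Hypothesis sigma_large : 1 <= sigma ^+ 2 * pi *+ 2.
Context d (T : measurableType d) (P : probability T R).

Let phases (u : 'I_N -> C) : 'M[C]_N := diag_mx (\row_p u p).

Let star_phases u : star (phases u) = phases (conj \o u).
Proof.
by rewrite /star tr_diag_mx map_diag_mx; congr diag_mx; apply/rowP => i; rewrite !mxE.
Qed.

Let phases_mul u v : (forall p, u p * v p = 1) -> phases u *m phases v = 1%:M.
Proof.
move=> uv; rewrite mul_diag_mx; apply/matrixP => i j; rewrite !mxE.
by case: eqP => [->|_]; rewrite ?uv ?mulr1n ?mulr0n ?mulr0.
Qed.

Let preserves_law_phases u : (forall p, modulus (u p) = 1) ->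
  preserves_law complex_basis false sigma P (phases u).
Proof.
move=> u1; have uu p : u p * conj (u p) = 1.
  by rewrite mulcJ u1 expr1n.
split=> [||//|X GX].
- by rewrite star_phases phases_mul// => p; rewrite mulrC uu.
- by rewrite star_phases phases_mul.
pose w (l : 'I_N * 'I_N) := u l.1 * conj (u l.2).
pose Y (k : K) (om : T) : R :=
  let x := X (k.1, false) om in let y := X (k.1, true) om in
  if k.2 then complex.Im (w k.1) * x + complex.Re (w k.1) * y
  else complex.Re (w k.1) * x - complex.Im (w k.1) * y.
exists Y.
  apply: (@gaussian_family_rotate _ _ sigma0 _ _ _ K ('I_N * 'I_N)%type X Y
    (fun l => (l, false)) (fun l => (l, true))
    (fun l => complex.Re (w l)) (fun l => - complex.Im (w l))) => //.
  - by move=> l l' [].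
  - by move=> l l' [].
  - by move=> l l'; apply/eqP => -[].
  - move=> l; rewrite sqrrN -modulus_sqr /w Normc.normcM modulusJ !u1.
    by rewrite mulr1 expr1n.
  - by move=> l om; rewrite /Y/= mulNr.
  - by move=> l om; rewrite /Y/= opprK.
  - move=> [l b] k1 k2 om; exfalso; case: b k1 k2 => k1 k2.
      by move/negP: k2; apply; exact: codom_f.
    by move/negP: k1; apply; exact: codom_f.
move=> om; rewrite star_phases mul_diag_mx mul_mx_diag; apply/matrixP => i j.
rewrite !mxE !big_bool/= [RHS]mulrAC -/(w (i, j)) /Y/=; case: (w (i, j)) => a b.
apply/eqP; rewrite eq_complex /=.
by apply/andP; split; apply/eqP; ring.
Qed.

(** In the complex ensemble, multiplying the coordinates of a vector by suitable
    phases makes them real. *)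
Lemma vector_tail_complex (phi : 'cV[C]_N) : phi != 0 ->
  vector_tail complex_basis false sigma P phi.
Proof.
move=> phi0.
pose u p := if phi p 0 == 0 then 1 else
  conj (phi p 0) * ((modulus (phi p 0))^-1)%:C.
have u1 p : modulus (u p) = 1.
  rewrite /u; case: eqP => [_|/eqP p0]; first by rewrite modulus_real normr1.
  rewrite Normc.normcM modulusJ modulus_real ger0_norm ?invr_ge0 ?modulus_ge0//.
  by rewrite divff// modulus_eq0.
apply: (vector_tail_unitary (preserves_law_phases u1)).
have -> : phases u *m phi = \col_i (modulus (phi i 0))%:C.
  rewrite mul_diag_mx; apply/matrixP => i j; rewrite ord1 !mxE /u.
  case: eqP => [->|/eqP p0]; first by rewrite modulus0 mulr0.
  rewrite mulrAC [conj _ * _]mulrC mulcJ -rmorphM; congr (_%:C).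
  by rewrite expr2 mulfK// modulus_eq0.
apply: (vector_tail_real N0 scalar_complex_basis complex_basis_dual sigma0 sigma_large).
move/eqP: phi0 => phi0; apply: contrapT => all0; apply: phi0.
apply/matrixP => i j; rewrite ord1 mxE; apply/eqP; rewrite -modulus_eq0.
by apply/negPn/negP => p0; apply: all0; exists i.
Qed.

End Phases.

(** * Zero sets of polynomials are null *)

Section ClosedClasses.
Context (E : Type) (A : comNzRingType) (S : (E -> A) -> Prop).
Hypothesis S_cst : forall a, S (fun=> a).
Hypothesis S_D : forall f g, S f -> S g -> S (fun x => f x + g x).
Hypothesis S_M : forall f g, S f -> S g -> S (fun x => f x * g x).

Lemma closed_sum (I : Type) (s : seq I) (p : pred I) (F : I -> E -> A) :
  (forall i, S (F i)) -> S (fun x => \sum_(i <- s | p i) F i x).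
Proof.
move=> SF; elim: s => [|i s IH].
  by under eq_fun do rewrite big_nil; exact: S_cst.
under eq_fun do rewrite big_cons.
by case: (p i) => //; exact: S_D.
Qed.

Lemma closed_prod (I : Type) (s : seq I) (p : pred I) (F : I -> E -> A) :
  (forall i, S (F i)) -> S (fun x => \prod_(i <- s | p i) F i x).
Proof.
move=> SF; elim: s => [|i s IH].
  by under eq_fun do rewrite big_nil; exact: S_cst.
under eq_fun do rewrite big_cons.
by case: (p i) => //; exact: S_M.
Qed.

Lemma closed_det n (F : E -> 'M[A]_n) :
  (forall i j, S (fun x => F x i j)) -> S (fun x => \det (F x)).
Proof.
move=> SF; apply: closed_sum => s; apply: S_M; first exact: S_cst.
by apply: closed_prod => i; exact: SF.
Qed.

End ClosedClasses.

Section PolynomialFunctions.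
Context (R : realType) (K : finType).
Local Notation C := R[i].

Inductive polynomial_function : ((K -> R) -> C) -> Prop :=
| Polynomial_cst c : polynomial_function (fun=> c)
| Polynomial_coordinate k : polynomial_function (fun x => (x k)%:C)
| PolynomialD f g : polynomial_function f -> polynomial_function g ->
    polynomial_function (fun x => f x + g x)
| PolynomialM f g : polynomial_function f -> polynomial_function g ->
    polynomial_function (fun x => f x * g x).

Definition update (x : K -> R) (k : K) (t : R) (j : K) : R :=
  if j == k then t else x j.

Lemma polynomial_function_line f x k : polynomial_function f ->
  exists p : {poly C}, forall t, f (update x k t) = p.[t%:C].
Proof.
elim=> [c|j|{}f g _ [p fp] _ [q gq]|{}f g _ [p fp] _ [q gq]].
- by exists c%:P => t; rewrite hornerC.
- exists (if j == k then 'X else ((x j)%:C)%:P) => t; rewrite /update.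
  by case: (j == k); rewrite ?hornerX ?hornerC.
- by exists (p + q) => t; rewrite hornerD fp gq.
- by exists (p * q) => t; rewrite hornerM fp gq.
Qed.

Lemma measurable_polynomial_function d (T : measurableType d) (X : K -> T -> R) f :
  (forall k, measurable_fun setT (X k)) -> polynomial_function f ->
  cmeasurable (fun w => f (X ^~ w)).
Proof.
move=> mX; elim=> [c|k|{}f g _ mf _ mg|{}f g _ mf _ mg].
- exact: cmeasurable_cst.
- exact: cmeasurable_real.
- exact: cmeasurableD.
- exact: cmeasurableM.
Qed.

Lemma finite_real_roots (p : {poly C}) : p != 0 ->
  finite_set [set t : R | p.[t%:C] = 0].
Proof.
move=> p0; have [r pr] := closed_field_poly_normal p.
apply: (@sub_finite_set _ _ [set` [seq complex.Re z | z <- r]]) => [t /=|]; last first.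
  exact: finite_seq.
rewrite pr hornerZ => /eqP; rewrite mulf_eq0 lead_coef_eq0 (negbTE p0)/=.
rewrite -[_ == 0]/(root _ _) root_prod_XsubC => tr.
by apply/mapP; exists t%:C.
Qed.

Context (sigma : R) (sigma0 : sigma != 0).
Hypothesis sigma_large : 1 <= sigma ^+ 2 * pi *+ 2.
Context d (T : measurableType d) (P : probability T R).

(** Randomize the coordinates of a point where the polynomial does not vanish,
    one at a time: almost surely the polynomial is not zero on the line along
    the new coordinate, and then it has finitely many roots there. *)
Lemma polynomial_function_neq0 f x0 (X : K -> T -> R) :
  polynomial_function f -> f x0 != 0 -> gaussian_family sigma P X ->
  P [set w | f (X ^~ w) = 0] = 0%E.
Proof.
move=> pf fx0 GX.
pose mix (ks : seq K) (x : K -> R) k := if k \in ks then x k else x0 k.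
pose zeros ks := [set x : config K R | f (mix ks x) = 0].
have mzeros ks : measurable (zeros ks).
  rewrite (_ : zeros ks = ~` [set x | f (mix ks x) != 0]); last first.
    apply/seteqP; split=> x /=; first by move=> ->; rewrite eqxx.
    by move/negP/negPn/eqP.
  apply: measurableC; apply: measurable_true; apply: measurable_neq0.
  apply: (@measurable_polynomial_function _ (config K R)
    (fun k x => mix ks x k) f) => // k.
  by rewrite /mix; case: (k \in ks); [exact: measurable_coordinate|exact: measurable_cst].
have mX ks : d.-measurable [set w : T | zeros ks (X ^~ w)].
  by have := measurable_config GX.1 measurableT (mzeros ks); rewrite setTI.
suff H ks : P [set w | zeros ks (X ^~ w)] = 0%E.
  rewrite -(H (enum K)); congr (P _); apply: eq_set => w; rewrite /zeros/=.
  by congr (f _ = 0); apply/funext => k; rewrite /mix mem_enum.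
elim: ks => [|k ks IH].
  rewrite (_ : [set w | _] = set0) ?measure0//; apply/seteqP; split=> w //=.
  rewrite /zeros /= (_ : mix [::] _ = x0); last by apply/funext => k.
  by move/eqP; rewrite (negbTE fx0).
have [kks|kks] := boolP (k \in ks).
  rewrite -IH; congr (P _); apply: eq_set => w; rewrite /zeros/=.
  congr (f _ = 0); apply/funext => j; rewrite /mix inE.
  by case: eqVneq => [->|//]; rewrite kks.
pose Y j : T * T -> R := doubled X (j, j == k).
have GY : gaussian_family sigma (P \x P)%E Y.
  apply: (gaussian_family_reindex (e := fun j => (j, j == k))).
    by move=> i j [].
  exact: gaussian_family_doubled.
rewrite (gaussian_family_law GX GY (mzeros _)).
apply/eqP; rewrite eq_le measure_ge0 andbT.
rewrite -IH -[leRHS]mul1e; apply: (@le_trans _ _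
  (\int[P]_w (\1_[set w | zeros ks (X ^~ w)] w)%:E)%E); last first.
  by rewrite integral_indic// setIT mul1e.
have mG : measurable [set z : T * T | zeros (k :: ks) (Y ^~ z)].
  by have := measurable_config GY.1 measurableT (mzeros (k :: ks)); rewrite setTI.
rewrite /product_measure1/=; apply: ge0_le_integral => //.
- exact: measurable_fun_xsection.
- by apply/measurable_EFinP; exact: measurable_indic.
move=> w _; rewrite indicE; case: (boolP (w \in _)) => [_|bad].
  by apply: probability_le1; exact: measurable_xsection.
have {}bad : f (mix ks (X ^~ w)) != 0.
  by move: bad; apply: contraNN => /eqP fz; apply/mem_set.
have [p fp] := polynomial_function_line (mix ks (X ^~ w)) k pf.
have p0 : p != 0.
  apply: contraNneq bad => p0.
  have := fp (mix ks (X ^~ w) k); rewrite p0 horner0 => <-.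
  by apply/eqP; congr (f _); apply/funext => j; rewrite /update; case: eqP => [->|].
have fin := finite_real_roots p0.
have null : lebesgue_measure [set t : R | p.[t%:C] = 0] = 0%E.
  by apply: countable_lebesgue_measure0; exact: finite_set_countable.
have mroots : measurable ([set t : R | p.[t%:C] = 0] : set (measurableTypeR R)).
  by apply: countable_measurable; [exact: measurable_set1|exact: finite_set_countable].
rewrite -[leRHS]null; apply: (le_trans _ (normal_prob_le_lebesgue sigma0 sigma_large mroots)).
rewrite -(gaussian_family_coordinate k GX mroots) le_eqVlt; apply/orP; left.
apply/eqP; congr (P _); rewrite /xsection; apply: eq_set => w'.
rewrite inE /zeros/= -fp; congr (f _ = 0); apply/funext => j.
rewrite /update /mix inE /Y /doubled/=.
by case: eqVneq => [->|].
Qed.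

End PolynomialFunctions.

(** * Almost surely the ensemble is invertible with simple spectrum *)

Section NullEvents.
Context (R : realType).
Local Notation C := R[i].
Local Notation modulus := (@Normc.normc R).
Local Notation conj := (@conjc R).

Section PolynomialPolynomials.
Context (K : finType).
Local Notation pf := (@polynomial_function R K).

Definition polynomial_coefficients (p : (K -> R) -> {poly C}) : Prop :=
  forall i, pf (fun x => (p x)`_i).

Lemma polynomial_function_sum I (s : seq I) (c : pred I) F :
  (forall i, pf (F i)) -> pf (fun x => \sum_(i <- s | c i) F i x).
Proof. exact: closed_sum (@Polynomial_cst R K) (@PolynomialD R K) _ _ _ _. Qed.

Lemma polynomial_function_det n (F : (K -> R) -> 'M[C]_n) :
  (forall i j, pf (fun x => F x i j)) -> pf (fun x => \det (F x)).
Proof.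
exact: closed_det (@Polynomial_cst R K) (@PolynomialD R K) (@PolynomialM R K) _ _.
Qed.

Lemma polynomial_coefficients_det n (F : (K -> R) -> 'M[{poly C}]_n) :
  (forall i j, polynomial_coefficients (fun x => F x i j)) ->
  polynomial_coefficients (fun x => \det (F x)).
Proof.
apply: closed_det => [p i|p q pp pq i|p q pp pq i].
- exact: Polynomial_cst.
- by under eq_fun do rewrite coefD; exact: PolynomialD.
- under eq_fun do rewrite coefM; apply: polynomial_function_sum => j.
  exact: PolynomialM.
Qed.

Lemma polynomial_coefficients_char_poly n (F : (K -> R) -> 'M[C]_n) :
  (forall i j, pf (fun x => F x i j)) ->
  polynomial_coefficients (fun x => char_poly (F x)).
Proof.
move=> pF; apply: polynomial_coefficients_det => i j k.
under eq_fun do rewrite !mxE coefB coefMn coefX coefC.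
apply: PolynomialD; first exact: Polynomial_cst.
under eq_fun do rewrite -mulN1r; apply: PolynomialM; first exact: Polynomial_cst.
by case: (k == 0); [exact: pF|exact: Polynomial_cst].
Qed.

(* The size of the Sylvester matrix depends on the degrees, which have to be
   constant. *)
Lemma polynomial_function_resultant (p q : (K -> R) -> {poly C}) a b :
  (forall x, (size (p x)).-1 = a) -> (forall x, (size (q x)).-1 = b) ->
  polynomial_coefficients p -> polynomial_coefficients q ->
  pf (fun x => resultant (p x) (q x)).
Proof.
move=> sp sq pp pq.
pose S (p q : {poly C}) : 'M[C]_(b + a) := \matrix_(i, j)
  match fintype.split i with
  | inl k => p`_(j - k) *+ (k <= j)%N | inr k => q`_(j - k) *+ (k <= j)%N end.
have E x : resultant (p x) (q x) = \det (S (p x) (q x)).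
  rewrite /S; case: _ / (sp x); case: _ / (sq x); congr (\det _).
  by apply/matrixP => i j; rewrite Sylvester_mxE mxE.
under eq_fun do rewrite E; apply: polynomial_function_det => i j.
rewrite /S; under eq_fun do rewrite mxE; case: (fintype.split i) => k.
  by case: (k <= j)%N; [exact: pp|exact: Polynomial_cst].
by case: (k <= j)%N; [exact: pq|exact: Polynomial_cst].
Qed.

End PolynomialPolynomials.

Context (N : nat) (B : finType) (beta : B -> C) (real_case : bool).
Hypothesis N0 : (0 < N)%N.
Local Notation K := ('I_N * 'I_N * B)%type.
Hypothesis scalar_beta : forall b, scalar_number real_case (beta b).
Hypothesis beta_dual : forall z, scalar_number real_case z ->
  \sum_b (complex.Re (conjc (beta b) * z))%:C * beta b = z.
Context (sigma : R) (sigma0 : sigma != 0).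
Hypothesis sigma_large : 1 <= sigma ^+ 2 * pi *+ 2.
Context d (T : measurableType d) (P : probability T R).

Lemma polynomial_function_ensemble (A : 'M[C]_N) i j :
  polynomial_function (fun x => ensemble beta A x i j).
Proof.
under eq_fun do rewrite ensembleE !mxE summxE.
apply: PolynomialD; first exact: Polynomial_cst.
apply: polynomial_function_sum => k; under eq_fun do rewrite mxE.
by apply: PolynomialM; [exact: Polynomial_coordinate|exact: Polynomial_cst].
Qed.

(** Every matrix of the space is a value of the ensemble: G + G^* = 2 G when G is
    Hermitian, so G = (D - A) / (2 wscale) gives the value D. *)
Lemma ensemble_onto (A D : 'M[C]_N) : self_adjoint A -> self_adjoint D ->
  scalar_entries real_case A -> scalar_entries real_case D ->
  exists x, ensemble beta A x = D.
Proof.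
move=> hA hD sA sD.
pose G := (2 * wscale R N)^-1%:C *: (D - A).
have w0 : wscale R N != 0.
  by rewrite /wscale invr_eq0 gt_eqF// sqrtr_gt0 ltr0n muln_gt0.
have GJ : star G = G.
  apply/matrixP => i j; rewrite !mxE conjM_real rmorphB/=.
  by have := starE D i j; have := starE A i j; rewrite hA hD => -> ->.
have sG i j : scalar_number real_case (G i j).
  by move=> r; rewrite !mxE conjM_real rmorphB/= sA// sD.
exists (fun k => complex.Re (conj (beta k.2) * G k.1.1 k.1.2)).
have -> : ensemble beta A (fun k => complex.Re (conj (beta k.2) * G k.1.1 k.1.2)) =
    A + (wscale R N)%:C *: (G + star G).
  have GE : ginibre beta (fun k => complex.Re (conj (beta k.2) * G k.1.1 k.1.2)) = G.
    by apply/matrixP => i j; rewrite mxE /= beta_dual.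
  by rewrite /ensemble GE.
have -> : G + star G = (wscale R N)^-1%:C *: (D - A).
  by rewrite GJ /G -scalerDl -rmorphD; congr (_%:C *: _); field.
by rewrite scalerA -rmorphM divff// scale1r addrC subrK.
Qed.

Let diagonal_onto (A : 'M[C]_N) (x : 'I_N -> R) : self_adjoint A -> scalar_entries real_case A ->
  exists x0, ensemble beta A x0 = diag_mx (\row_i (x i)%:C).
Proof.
move=> hA sA; apply: ensemble_onto => //.
  rewrite /self_adjoint /star tr_diag_mx map_diag_mx; congr diag_mx.
  by apply/rowP => i; rewrite !mxE; exact: conjc_real.
by move=> i j r; rewrite !mxE rmorphMn; congr (_ *+ _); exact: conjc_real.
Qed.

Lemma ensemble_invertible (A : 'M[C]_N) X : self_adjoint A -> scalar_entries real_case A ->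
  gaussian_family sigma P X ->
  P [set w | \det (ensemble beta A (X ^~ w)) = 0] = 0%E.
Proof.
move=> hA sA GX; have [x0 x0E] := diagonal_onto (fun=> 1) hA sA.
apply: (polynomial_function_neq0 (x0 := x0) sigma0 sigma_large
  (f := fun x => \det (ensemble beta A x)) _ _ GX).
  by apply: polynomial_function_det => i j; exact: polynomial_function_ensemble.
by rewrite x0E det_diag big1 ?oner_eq0// => i _; rewrite mxE.
Qed.

(** The discriminant of the characteristic polynomial does not vanish at the
    diagonal matrix with entries 0, 1, ..., N - 1. *)
Lemma ensemble_simple_spectrum (A : 'M[C]_N) X : self_adjoint A -> scalar_entries real_case A ->
  gaussian_family sigma P X ->
  exists2 E, measurable E /\ P E = 0%E &
    forall w, ~ E w -> separable_poly (char_poly (ensemble beta A (X ^~ w))).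
Proof.
move=> hA sA GX; have [x0 x0E] := diagonal_onto (fun i => i%:R) hA sA.
pose f x := resultant (char_poly (ensemble beta A x)) (char_poly (ensemble beta A x))^`().
have sepE x : separable_poly (char_poly (ensemble beta A x)) = (f x != 0).
  rewrite /f resultant_eq0 -leqNgt unlock /separable_poly /coprimep.
  rewrite eqn_leq andbC lt0n size_poly_eq0 gcdp_eq0 (_ : char_poly _ == 0 = false)//.
  by apply/negbTE; rewrite monic_neq0// char_poly_monic.
have pf : polynomial_function f.
  have pc : polynomial_coefficients (fun x => char_poly (ensemble beta A x)).
    apply: polynomial_coefficients_char_poly => i j.
    exact: polynomial_function_ensemble.
  apply: (polynomial_function_resultant (a := N) (b := N.-1)) => //.
  - by move=> x; rewrite size_char_poly.
  - move=> x; set p := char_poly _; have sp : size p = N.+1 by exact: size_char_poly.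
    suff : size p^`() = N by move=> ->.
    apply/eqP; rewrite eqn_leq -ltnS -sp lt_size_deriv ?monic_neq0 ?char_poly_monic//=.
    rewrite leqNgt; apply/negP => small.
    have : p^`()`_N.-1 = 0 by apply: nth_default; rewrite -ltnS (prednK N0).
    rewrite coef_deriv (prednK N0) -mulr_natr => /eqP.
    rewrite mulf_eq0 pnatr_eq0 (gtn_eqF N0) orbF.
    have := monicP (char_poly_monic (ensemble beta A x)).
    by rewrite lead_coefE -/p sp /= => ->; rewrite oner_eq0.
  - move=> i; under eq_fun do rewrite coef_deriv -mulr_natr.
    by apply: PolynomialM; [exact: pc|exact: Polynomial_cst].
exists [set w | f (X ^~ w) = 0].
  split; last first.
    apply: (polynomial_function_neq0 (x0 := x0) sigma0 sigma_large pf _ GX).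
    rewrite -sepE x0E char_poly_trig; last exact: diag_mx_is_trig.
    rewrite -(big_map (fun i : 'I_N => diag_mx (\row_i0 (i0%:R : R)%:C) i i) xpredT
      (fun z => 'X - z%:P)) separable_prod_XsubC map_inj_uniq ?index_enum_uniq//.
    move=> i j; rewrite !mxE !eqxx !mulr1n => /complexI/eqP.
    by rewrite eqr_nat => /eqP; exact: val_inj.
  rewrite (_ : [set w | _] = ~` [set w | f (X ^~ w) != 0]); last first.
    apply/seteqP; split=> x /=; first by move=> ->; rewrite eqxx.
    by move/negP/negPn/eqP.
  apply: measurableC; apply: measurable_true; apply: measurable_neq0.
  by apply: measurable_polynomial_function pf; exact: GX.1.
by move=> w /= fw; rewrite sepE; apply/eqP.
Qed.

End NullEvents.

(** * The density of states *)

Section LinearAlgebra.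
Context (R : realType).
Local Notation C := R[i].
Local Notation modulus := (@Normc.normc R).

Lemma modulus_sum_le (I : finType) (F : I -> C) :
  modulus (\sum_i F i) <= \sum_i modulus (F i).
Proof.
elim/big_ind2: _ => [|x1 x2 y1 y2 h1 h2|//]; first by rewrite modulus0.
by apply: le_trans (le_normcD _ _) _; exact: lerD.
Qed.

Lemma sqnorm_mulmx_le m n (M : 'M[C]_(m, n)) (v : 'cV[C]_n) :
  sqnorm (M *m v) <= frob2 M * sqnorm v.
Proof.
rewrite /frob2 mulr_suml; apply: ler_sum => i _; rewrite mxE.
apply: le_trans (sum_cauchy_schwarz _ _).
have le0 : modulus (\sum_j M i j * v j 0) <= \sum_j modulus (M i j) * modulus (v j 0).
  apply: (le_trans (modulus_sum_le _)); apply: ler_sum => j _.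
  by rewrite Normc.normcM.
by apply: lerXn2r => //; rewrite nnegrE; [exact: modulus_ge0|exact: le_trans (modulus_ge0 _) le0].
Qed.

Lemma frob2_tr m n (M : 'M[C]_(m, n)) : frob2 M^T = frob2 M.
Proof.
rewrite /frob2 exchange_big/=; apply: eq_bigr => i _; apply: eq_bigr => j _.
by rewrite mxE.
Qed.

(** An eigenvector of H with eigenvalue z is an eigenvector of the inverse of
    H - x with eigenvalue 1 / (z - x). *)
Lemma inverse_large_near_eigenvalue n (H : 'M[C]_n) (z x : C) :
  \det (H - x%:M) != 0 -> root (char_poly H) z ->
  1 <= modulus (z - x) ^+ 2 * frob2 (invmx (H - x%:M)).
Proof.
move=> dH; rewrite -eigenvalue_root_char => /eigenvalueP[v vH v0].
have Hu : H - x%:M \in unitmx by rewrite unitmxE unitfE.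
have vHx : v *m (H - x%:M) = (z - x) *: v.
  by rewrite mulmxBr vH mul_mx_scalar scalerBl.
have vE : v = (z - x) *: (v *m invmx (H - x%:M)).
  by rewrite -[LHS](mulmxK Hu) vHx scalemxAl.
have vt0 : 0 < sqnorm v^T.
  rewrite lt_def sqnorm_ge0 sqnorm_eq0 andbT; apply: contraNneq v0 => vt.
  by rewrite -[v]trmxK vt trmx0.
rewrite -(ler_pM2r vt0) mul1r -mulrA -frob2_tr {1}vE linearZ/= sqnormZ trmx_mul.
by apply: ler_wpM2l; [exact: sqr_ge0|exact: sqnorm_mulmx_le].
Qed.

Lemma mup_eq0 (F : fieldType) (p : {poly F}) x : p != 0 -> ~~ root p x -> mup x p = 0%N.
Proof.
by move=> p0 px; apply/eqP; rewrite -leqn0 leqNgt -XsubC_dvd// dvdp_XsubCl.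
Qed.

Lemma mup_separable (F : fieldType) (p : {poly F}) x :
  p != 0 -> separable_poly p -> (mup x p <= 1)%N.
Proof.
move=> p0 /separable_polyP[sp _]; rewrite mup_leq//; apply/negP => dp.
have : coprimep ('X - x%:P) ('X - x%:P) by apply: sp; rewrite -expr2.
by rewrite coprimepp size_XsubC.
Qed.

Lemma mup_map (F L : fieldType) (f : {rmorphism F -> L}) (p : {poly F}) x :
  p != 0 -> mup (f x) (map_poly f p) = mup x p.
Proof.
move=> p0; have fp0 : map_poly f p != 0 by rewrite map_poly_eq0.
have E n : (n <= mup (f x) (map_poly f p))%N = (n <= mup x p)%N.
  by rewrite !mup_geq// -(dvdp_map f) rmorphXn/= rmorphB/= map_polyX map_polyC.
by apply/eqP; rewrite eqn_leq E leqnn -E leqnn.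
Qed.

(** Each root of a separable polynomial has multiplicity one, so that counting
    multiplicities is counting distinct real roots. *)
Lemma num_eigenvalues_simple n (H : 'M[C]_n) (I : interval R) :
  separable_poly (char_poly H) ->
  exists s : seq R, [/\ uniq s, {in s, forall x, x \in I},
    {in s, forall x, root (char_poly H) x%:C} &
    (num_eigenvalues (real_complex R) H I <= size s)%N].
Proof.
move=> sep; set p := char_poly H.
have p0 : p != 0 by rewrite monic_neq0// char_poly_monic.
pose S := [set x | (x \in I) && root p x%:C].
have finS : finite_set S.
  apply: sub_finite_set (finite_real_roots p0) => x /andP[_ /rootP]//.
exists (finmap.enum_fset (fset_set S)).
have inS x : x \in finmap.enum_fset (fset_set S) -> S x.
  by move=> xs; apply: set_mem; rewrite -(in_fset_set finS).
split.
- exact: finmap.fset_uniq.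
- by move=> x /inS/andP[].
- by move=> x /inS/andP[].
rewrite /num_eigenvalues -/p -(@fsbig_widen _ _ _ _ S); last 2 first.
- by move=> x /andP[].
- move=> x [xI Sx]; rewrite /preimage/=; apply: mup_eq0 => //.
  by apply/negP => px; apply: Sx; apply/andP; split.
rewrite fsbig_finite// -sum1_size; apply: leq_sum => x _.
exact: mup_separable.
Qed.

End LinearAlgebra.

Section Cells.
Context (R : realType).

Lemma seq_separated (s : seq R) : exists2 delta, 0 < delta &
  {in s &, forall x y, x != y -> delta <= `|x - y|}.
Proof.
have low (l : seq R) : {in l, forall x, 0 < x} ->
    exists2 delta, 0 < delta & {in l, forall x, delta <= x}.
  elim: l => [_|a l IH la]; first by exists 1.
  have [|delta d0 dl] := IH; first by move=> x xl; apply: la; rewrite inE xl orbT.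
  exists (Num.min a delta); first by rewrite lt_min d0 la// inE eqxx.
  by move=> x; rewrite inE ge_min => /orP[/eqP ->|/dl ->]; rewrite ?lexx ?orbT.
have [|delta d0 dl] := low [seq `|p.1 - p.2| | p <- [seq (x, y) | x <- s, y <- s] & p.1 != p.2].
  by move=> x /mapP[[a b]]; rewrite mem_filter /= => /andP[ab _] ->; rewrite normr_gt0 subr_eq0.
exists delta => // x y xs ys xy; apply: dl; apply/mapP; exists (x, y) => //.
by rewrite mem_filter/= xy; exact: allpairs_f.
Qed.

Definition cell_centre (a h : R) (k : nat) : R := a + h * k%:R + h / 2.

Lemma cell_cover (a b x : R) n : a < b -> a <= x <= b ->
  exists k : 'I_n.+1, `|x - cell_centre a ((b - a) / n.+1%:R) k| <= (b - a) / n.+1%:R / 2.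
Proof.
move=> ab /andP[ax xb]; set h := (b - a) / _.
have n0 : 0 < n.+1%:R :> R by rewrite ltr0n.
have h0 : 0 < h by rewrite divr_gt0// subr_gt0.
have hn : h * n.+1%:R = b - a by rewrite /h divfK// gt_eqF.
pose y := (x - a) / h.
have y0 : 0 <= y by rewrite divr_ge0 ?subr_ge0// ltW.
have xy : x = a + h * y by rewrite /y mulrCA divff ?gt_eqF// mulr1 addrC subrK.
have yn : y <= n.+1%:R by rewrite ler_pdivrMr// mulrC hn lerD2r.
have [yn'|yn'] := ltP y n.+1%:R.
  have /andP[t1 t2] := truncn_itv y0.
  have tn : (Num.truncn y < n.+1)%N by rewrite -(ltr_nat R); exact: le_lt_trans yn'.
  exists (Ordinal tn); rewrite /cell_centre /= xy.
  move: t1 t2; rewrite -natr1; set k := _%:R => t1 t2.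
  rewrite (_ : _ - _ = h * (y - k - 2^-1)); last by field.
  rewrite normrM gtr0_norm// ler_pM2l// ler_norml; apply/andP; split; lra.
exists ord_max; rewrite /cell_centre /= xy.
have -> : y = n%:R + 1 by rewrite natr1; apply/eqP; rewrite eq_le yn yn'.
rewrite (_ : _ - _ = h / 2); last by field.
by rewrite gtr0_norm// divr_gt0.
Qed.

(** Points that are further apart than the length of a cell lie in different
    cells. *)
Lemma count_cells (a b : R) n (s : seq R) (hit : 'I_n.+1 -> bool) : a < b -> uniq s ->
  {in s, forall x, a <= x <= b} ->
  {in s &, forall x y, x != y -> (b - a) / n.+1%:R < `|x - y|} ->
  (forall x (k : 'I_n.+1), x \in s ->
    `|x - cell_centre a ((b - a) / n.+1%:R) k| <= (b - a) / n.+1%:R / 2 -> hit k) ->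
  (size s <= \sum_k (hit k : nat))%N.
Proof.
move=> ab us sab sep hits; set h := (b - a) / _ in sep hits.
have cover x : exists k : 'I_n.+1, a <= x <= b ->
    `|x - cell_centre a h k| <= h / 2.
  have [xab|] := pselect (a <= x <= b); last by exists ord0.
  by have [k] := cell_cover n ab xab; exists k.
have [cell cellP] := choice cover.
have inj : {in s &, injective cell}.
  move=> x y xs ys exy; apply/eqP; apply: contraT => /(sep _ _ xs ys).
  have := cellP _ (sab _ ys); have := cellP _ (sab _ xs); rewrite -exy => hx hy.
  rewrite ltNge => /negP[]; rewrite -(subrK (cell_centre a h (cell x)) x) -addrA.
  apply: (le_trans (ler_normD _ _)).
  rewrite [`|_ - y|]distrC; lra.
have /card_uniqP us' : uniq [seq cell x | x <- s] by rewrite map_inj_in_uniq.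
rewrite -(size_map cell) -us' -sum1_card big_mkcond/=; apply: leq_sum => k _.
case: ifPn => // /mapP[x xs ->]; rewrite lt0b.
by apply: (hits x) => //; apply: cellP; exact: sab.
Qed.

End Cells.

Section EventualBound.
Import HBNNSimple.
Context d (T : measurableType d) (R : realType) (mu : {measure set T -> \bar R}).

(** The function f may fail to be measurable, but its integral is the supremum of
    the integrals of the simple functions below it, and Fatou's lemma applies to
    these. *)
Lemma integral_le_eventually (f : T -> R) (S : nat -> T -> \bar R) (c : \bar R) (E : set T) :
  (forall w, 0 <= f w) -> measurable E -> mu E = 0%E ->
  (forall n, measurable_fun setT (S n)) -> (forall n w, (0 <= S n w)%E) ->
  (forall n, (\int[mu]_w S n w <= c)%E) ->
  (forall w, ~ E w -> exists n0, forall n, (n0 <= n)%N -> ((f w)%:E <= S n w)%E) ->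
  (\int[mu]_w (f w)%:E <= c)%E.
Proof.
move=> f0 mE E0 mS S0 Sc fS.
rewrite ge0_integralTE => [|w]; last by rewrite lee_fin.
apply: ge_ereal_sup => _ [h /= hf <-]; rewrite -integralT_nnsfun.
apply: (@le_trans _ _ (\int[mu]_w limn_einf (S ^~ w))%E).
  apply: ae_ge0_le_integral => //.
  - by move=> w _; rewrite lee_fin; exact: fun_ge0.
  - by apply/measurable_EFinP; exact: measurable_funP.
  - move=> w _; rewrite limn_einf_lim; apply: lime_ge; first exact: is_cvg_einfs.
    by apply: nearW => n; apply: le_ereal_inf_tmp => _ [k _ <-].
  - rewrite /limn_einf; apply: (measurableT_comp (@oppe_measurable R setT)).
    apply: measurable_fun_limn_esup => n.
    exact: (measurableT_comp (@oppe_measurable R setT)).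
  exists E; split => // w /= bad; apply: contrapT => Ew; apply: bad => _.
  have [n0 n0P] := fS w Ew.
  apply: (le_trans (hf w)); rewrite limn_einf_lim.
  apply: lime_ge; first exact: is_cvg_einfs.
  exists n0 => // n /= n0n; apply: le_ereal_inf_tmp => _ [k /= nk <-].
  by apply: n0P; exact: leq_trans nk.
apply: (le_trans (fatou _ _ _ _)) => //.
rewrite limn_einf_lim; apply: lime_le; first exact: is_cvg_einfs.
apply: nearW => n; apply: ge_ereal_inf; exists (\int[mu]_w S n w)%E => //.
by exists n => /=.
Qed.

End EventualBound.

Section DensityOfStates.
Context (R : realType).
Local Notation C := R[i].
Context (N : nat) (B : finType) (beta : B -> C) (real_case : bool).
Hypothesis N0 : (0 < N)%N.
Local Notation K := ('I_N * 'I_N * B)%type.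
Hypothesis scalar_beta : forall b, scalar_number real_case (beta b).
Hypothesis beta_dual : forall z, scalar_number real_case z ->
  \sum_b (complex.Re (conjc (beta b) * z))%:C * beta b = z.
Context (sigma : R) (sigma0 : sigma != 0).
Hypothesis sigma_large : 1 <= sigma ^+ 2 * pi *+ 2.
Context d (T : measurableType d) (P : probability T R).
Context (A : 'M[C]_N) (X : K -> T -> R).
Hypotheses (hA : self_adjoint A) (sA : scalar_entries real_case A)
  (GX : gaussian_family sigma P X).

Let H w := ensemble beta A (X ^~ w).
Let shift (x : R) : 'M[C]_N := A - (x%:C)%:M.

Let ensemble_shift x w : ensemble beta (shift x) (X ^~ w) = H w - (x%:C)%:M.
Proof. by rewrite /H /ensemble /shift addrAC. Qed.

Let shift_self_adjoint x : self_adjoint (shift x).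
Proof.
apply/matrixP => i j; have := starE A i j; rewrite hA => Aij.
rewrite !mxE rmorphB/= rmorphMn/= Aij eq_sym; congr (_ - _ *+ _); exact: conjc_real.
Qed.

Let shift_scalar x : scalar_entries real_case (shift x).
Proof.
move=> i j r; rewrite !mxE rmorphB/= rmorphMn/= sA//; congr (_ - _ *+ _).
exact: conjc_real.
Qed.

Let near_spectrum (x t : R) : set T :=
  [set w | \det (ensemble beta (shift x) (X ^~ w)) = 0] `|`
  large_frobenius beta (shift x) X t.

Let measurable_singular x : measurable [set w | \det (ensemble beta (shift x) (X ^~ w)) = 0].
Proof.
rewrite (_ : [set w | _] = ~` [set w | \det (ensemble beta (shift x) (X ^~ w)) != 0]).
  apply: measurableC; apply: measurable_true; apply: measurable_neq0.
  by apply: cmeasurable_det; exact: measurable_ensemble GX.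
apply/seteqP; split=> w /=; first by move=> ->; rewrite eqxx.
by move/negP/negPn/eqP.
Qed.

Let measurable_near_spectrum x t : measurable (near_spectrum x t).
Proof.
by apply: measurableU => //; exact: measurable_large_frobenius GX.
Qed.

Let near_spectrum_le x t : 0 < t -> (P (near_spectrum x t) <= (21120 / t)%:E)%E.
Proof.
move=> t0; have mL := measurable_large_frobenius beta (shift x) t GX.
apply: (@le_trans _ _ (P [set w | \det (ensemble beta (shift x) (X ^~ w)) = 0%R]
    + P (large_frobenius beta (shift x) X t))%E); first exact: measureU2.
rewrite (ensemble_invertible N0 beta_dual sigma0 sigma_large
  (shift_self_adjoint x) (@shift_scalar x) GX) add0e.
exact: (frobenius_tail N0 scalar_beta beta_dual sigma0 sigma_large
  (shift_self_adjoint x) (@shift_scalar x) GX).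
Qed.

(** Cut the interval in small cells. When the spectrum is simple and the cells
    are short enough, every eigenvalue has its own cell, and then the inverse of
    H minus the centre of the cell is large. *)
Lemma density_of_states_le (I : interval R) (a b : R) : a < b ->
  (forall x, x \in I -> a <= x <= b) ->
  (\int[P]_w ((num_eigenvalues (real_complex R) (H w) I)%:R)%:E
    <= (10560 * N%:R * (b - a))%:E)%E.
Proof.
move=> ab Iab.
have [E [mE E0] simple] := ensemble_simple_spectrum N0 beta_dual sigma0
  sigma_large hA sA GX.
pose h n : R := (b - a) / n.+1%:R.
have N1 : 0 < N%:R :> R by rewrite ltr0n.
have h0 n : 0 < h n by rewrite divr_gt0 ?subr_gt0// ltr0n.
pose t n := 2 / (h n * N%:R).
have t0 n : 0 < t n by rewrite divr_gt0// mulr_gt0.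
pose F n (k : 'I_n.+1) := near_spectrum (cell_centre a (h n) k) (t n).
apply: (@integral_le_eventually _ _ _ P _
  (fun n w => (\sum_k \1_(F n k) w)%:E) _ E) => //.
- move=> n; apply/measurable_EFinP; apply: measurable_sum => k.
  by apply: measurable_indic; exact: measurable_near_spectrum.
- by move=> n w; rewrite lee_fin sumr_ge0.
- move=> n.
  have -> : (\int[P]_w (\sum_k \1_(F n k) w)%:E = \sum_k P (F n k))%E.
    rewrite -[RHS]mul1e sum_probabilityE// => [|k]; last exact: measurable_near_spectrum.
    by apply: eq_integral => w _; rewrite mul1r.
  have Nht : N%:R * h n * t n = 2 by rewrite /t; field; rewrite !gt_eqF.
  apply: (@le_trans _ _ (\sum_(k : 'I_n.+1) (10560 * (N%:R * h n))%:E)%E).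
    apply: lee_sum => k _; apply: (le_trans (near_spectrum_le _ (t0 n))).
    by rewrite lee_fin ler_pdivrMr// -mulrA Nht; lra.
  have hn : h n * n.+1%:R = b - a by rewrite /h divfK// pnatr_eq0.
  rewrite sumEFin lee_fin sumr_const card_ord.
  have sumE (c : R) : c * (N%:R * h n) *+ n.+1 = c * N%:R * (b - a).
    by rewrite -[LHS]mulr_natr -hn; ring.
  by rewrite sumE.
move=> w Ew; have [s [us sI sroot num]] := num_eigenvalues_simple I (simple w Ew).
have [delta d0 dP] := seq_separated s.
exists (Num.truncn ((b - a) / delta)) => n n0.
have hd : h n < delta.
  rewrite /h ltr_pdivrMr ?ltr0n// mulrC -ltr_pdivrMr//.
  apply: (lt_le_trans (truncnS_gt _)); by rewrite ler_nat ltnS.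
rewrite lee_fin; apply: (@le_trans _ _ (size s)%:R); first by rewrite ler_nat.
have : (size s <= \sum_k ((w \in F n k) : nat))%N.
  apply: (count_cells (n := n) ab us) => [x /sI/Iab//|x y xs ys xy|x k xs xk].
    exact: lt_le_trans hd (dP _ _ xs ys xy).
  apply/mem_set; rewrite /F /near_spectrum.
  case: (eqVneq (\det (ensemble beta (shift (cell_centre a (h n) k)) (X ^~ w))) 0).
    by left.
  move=> dk; right; rewrite /large_frobenius/= dk/=; move: dk.
  rewrite ensemble_shift => dk.
  have := inverse_large_near_eigenvalue dk (sroot x xs).
  rewrite -rmorphB modulus_real real_normK ?num_real//.
  set f2 := frob2 _; move: xk; rewrite -/(h n); set u := x - _ => xk uf.
  have f20 : 0 <= f2 by apply: sumr_ge0 => *; apply: sumr_ge0 => *; exact: sqr_ge0.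
  have -> : t n ^+ 2 * N%:R ^+ 2 = (2 / h n) ^+ 2.
    by rewrite /t; field; rewrite !gt_eqF.
  have u2 : u ^+ 2 <= (h n / 2) ^+ 2.
    by rewrite -(real_normK (num_real u)) lerXn2r// nnegrE// divr_ge0// ltW.
  rewrite expr_div_n ler_pdivrMr ?exprn_gt0//.
  have := ler_wpM2r f20 u2; rewrite expr_div_n; set h2 := h n ^+ 2; lra.
rewrite -(ler_nat R) => /le_trans; apply; rewrite natr_sum.
by apply: ler_sum => k _; rewrite indicE.
Qed.

End DensityOfStates.

(** * The operator norm *)

Section RationalPoints.
Context (R : realType) (K : finType).
Local Notation C := R[i].

Lemma polynomial_function_conj (f : (K -> R) -> C) : polynomial_function f ->
  polynomial_function (fun x => conjc (f x)).
Proof.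
elim=> [c|k|{}f g _ pf _ pg|{}f g _ pf _ pg].
- exact: Polynomial_cst.
- by under eq_fun do rewrite conjc_real; exact: Polynomial_coordinate.
- by under eq_fun do rewrite rmorphD/=; exact: PolynomialD.
- by under eq_fun do rewrite rmorphM/=; exact: PolynomialM.
Qed.

Lemma poly_gt0_rational (q : {poly R}) t : 0 < q.[t] -> exists r : rat, 0 < q.[ratr r].
Proof.
move=> qt; have cq : {for t, continuous (horner q)} by exact: continuous_horner.
have /nbhs_ballP[e /= e0 eP] : \forall y \near t, 0 < q.[y].
  exact: (cvgr_gt _ cq _ qt).
have te : t - e < t + e by lra.
have [r] := rat_in_itvoo te; rewrite in_itv/= => /andP[r1 r2].
exists r; apply: eP; rewrite /ball/= distrC ltr_distl; apply/andP; split; lra.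
Qed.

(** The rational points are dense: move to a rational value one coordinate after
    the other. *)
Lemma polynomial_function_gt0_rational (f : (K -> R) -> C) x :
  polynomial_function f -> 0 < complex.Re (f x) ->
  exists y : {ffun K -> rat}, 0 < complex.Re (f (fun k => ratr (y k))).
Proof.
move=> pf fx.
have line z k : exists q : {poly R}, forall t, complex.Re (f (update z k t)) = q.[t].
  have [p fp] := polynomial_function_line z k pf.
  exists (\poly_(i < size p) complex.Re p`_i) => t.
  rewrite fp horner_coef horner_poly raddf_sum/=; apply: eq_bigr => i _.
  by rewrite -rmorphXn/= mulrC ReM_real mulrC.
suff H (ks : seq K) : exists y : {ffun K -> rat},
    0 < complex.Re (f (fun k => if k \in ks then ratr (y k) else x k)).
  have [y yP] := H (enum K); exists y; move: yP.
  by under [X in f X]eq_fun do rewrite mem_enum.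
elim: ks => [|k ks [y IH]]; first by exists [ffun=> 0].
set z := fun j => _ in IH; have [q qE] := line z k.
have : 0 < q.[z k].
  rewrite -qE (_ : update z k (z k) = z)//.
  by apply/funext => j; rewrite /update; case: eqP => [->|].
move=> /poly_gt0_rational[r]; rewrite -qE => rq.
exists [ffun j => if j == k then r else y j].
rewrite (_ : (fun j => _) = update z k (ratr r))//.
by apply/funext => j; rewrite /update /z inE ffunE; case: eqP.
Qed.

End RationalPoints.

Section OperatorNorm.
Context (R : realType).
Local Notation C := R[i].
Local Notation modulus := (@Normc.normc R).
Context (N : nat) (B : finType) (beta : B -> C) (real_case : bool).
Hypothesis N0 : (0 < N)%N.
Hypothesis scalar_beta : forall b, scalar_number real_case (beta b).
Hypothesis beta_dual : forall z, scalar_number real_case z ->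
  \sum_b (complex.Re (conjc (beta b) * z))%:C * beta b = z.

Definition scalar_vector (v : 'cV[C]_N) : Prop := forall i, scalar_number real_case (v i 0).

(** The operator norm over the scalars, which may be the real numbers although
    the entries are complex numbers. *)
Definition scalar_op_norm (M : 'M[C]_N) : R :=
  sup [set Num.sqrt (sqnorm (M *m v)) / Num.sqrt (sqnorm v)
      | v in [set v : 'cV[C]_N | v != 0 /\ scalar_vector v]].

Let ratios (M : 'M[C]_N) := [set Num.sqrt (sqnorm (M *m v)) / Num.sqrt (sqnorm v)
      | v in [set v : 'cV[C]_N | v != 0 /\ scalar_vector v]].

Let norm_gt0 (v : 'cV[C]_N) : v != 0 -> 0 < Num.sqrt (sqnorm v).
Proof. by move=> v0; rewrite sqrtr_gt0 lt_def sqnorm_eq0 v0 sqnorm_ge0. Qed.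

Let ratios_nonempty M : ratios M !=set0.
Proof.
pose v : 'cV[C]_N := const_mx 1.
exists (Num.sqrt (sqnorm (M *m v)) / Num.sqrt (sqnorm v)), v => //; split.
  apply/negP => /eqP/matrixP/(_ (Ordinal N0) 0)/eqP.
  by rewrite !mxE oner_eq0.
by move=> i _; rewrite mxE; exact: conjc_real.
Qed.

Let ratios_bound M : ubound (ratios M) (Num.sqrt (frob2 M)).
Proof.
move=> _ [v [v0 _] <-]; rewrite ler_pdivrMr ?norm_gt0//.
have f0 : 0 <= frob2 M by apply: sumr_ge0 => *; apply: sumr_ge0 => *; exact: sqr_ge0.
rewrite -sqrtrM// ler_sqrt ?mulr_ge0 ?sqnorm_ge0//.
exact: sqnorm_mulmx_le.
Qed.

Lemma scalar_op_norm_le_frobenius M : scalar_op_norm M <= Num.sqrt (frob2 M).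
Proof. by apply: ge_sup; [exact: ratios_nonempty|exact: ratios_bound]. Qed.

Let vec (x : 'I_N * B -> R) : 'cV[C]_N := \col_i \sum_b (x (i, b))%:C * beta b.

Let scalar_vec x : scalar_vector (vec x).
Proof.
by move=> i; rewrite mxE; apply: scalar_sum => b r; rewrite conjM_real scalar_beta.
Qed.

Let vec_onto v : scalar_vector v -> exists x, vec x = v.
Proof.
move=> sv; exists (fun k => complex.Re (conjc (beta k.2) * v k.1 0)).
by apply/matrixP => i j; rewrite ord1 mxE /= beta_dual.
Qed.

Let polynomial_vec i : polynomial_function (fun x => vec x i 0).
Proof.
under eq_fun do rewrite mxE.
apply: polynomial_function_sum => b.
by apply: PolynomialM; [exact: Polynomial_coordinate|exact: Polynomial_cst].
Qed.

Let polynomial_sqnorm m (f : ('I_N * B -> R) -> 'cV[C]_m) :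
  (forall i, polynomial_function (fun x => f x i 0)) ->
  polynomial_function (fun x => (sqnorm (f x))%:C).
Proof.
move=> pf; under eq_fun do rewrite sqnormE mxE.
apply: polynomial_function_sum => i; apply: PolynomialM; last exact: pf.
by under eq_fun do rewrite starE; exact: polynomial_function_conj.
Qed.

(** The ratio between the two norms is continuous, so rational vectors are
    enough to approach its supremum. *)
Let rational_ratio (M : 'M[C]_N) v (s : R) : scalar_vector v -> 0 <= s ->
  s ^+ 2 * sqnorm v < sqnorm (M *m v) ->
  exists y : {ffun 'I_N * B -> rat}, let u := vec (fun k => ratr (y k)) in
    s ^+ 2 * sqnorm u < sqnorm (M *m u).
Proof.
move=> /vec_onto[x <-] s0 sx.
pose f x := (sqnorm (M *m vec x))%:C + (- s ^+ 2)%:C * (sqnorm (vec x))%:C.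
have fE z : complex.Re (f z) = sqnorm (M *m vec z) - s ^+ 2 * sqnorm (vec z).
  by rewrite /f /= mul0r subr0 mulNr.
have pf : polynomial_function f.
  apply: PolynomialD.
    apply: polynomial_sqnorm => i; under eq_fun do rewrite mxE.
    apply: polynomial_function_sum => j; apply: PolynomialM; last exact: polynomial_vec.
    exact: Polynomial_cst.
  apply: PolynomialM; first exact: Polynomial_cst.
  by apply: polynomial_sqnorm => i; exact: polynomial_vec.
have fx : 0 < complex.Re (f x) by rewrite fE subr_gt0.
have [y] := polynomial_function_gt0_rational pf fx.
by rewrite fE subr_gt0; exists y.
Qed.

Let op_norm_geE (M : 'M[C]_N) (c : R) : 0 < c ->
  (c <= scalar_op_norm M) <-> forall n : nat, exists y : {ffun 'I_N * B -> rat},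
    let u := vec (fun k => ratr (y k)) in
    (c * n%:R / n.+1%:R) ^+ 2 * sqnorm u < sqnorm (M *m u).
Proof.
move=> c0; pose s n : R := c * n%:R / n.+1%:R.
have s0 n : 0 <= s n by rewrite divr_ge0// mulr_ge0// ltW.
have sc n : s n < c.
  by rewrite ltr_pdivrMr ?ltr0n// ltr_pM2l// ltr_nat.
split=> [cM n|H].
  have [_ [v [v0 sv] <-]] := sup_gt (ratios_nonempty M) (lt_le_trans (sc n) cM).
  rewrite ltr_pdivlMr ?norm_gt0// => lt; apply: rational_ratio sv (s0 n) _.
  rewrite -[X in _ * X](sqr_sqrtr (sqnorm_ge0 _)) -exprMn.
  rewrite -[ltRHS](sqr_sqrtr (sqnorm_ge0 _)) ltr_pXn2r// nnegrE ?sqrtr_ge0//.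
  by apply: mulr_ge0; [exact: s0|exact: sqrtr_ge0].
have sM n : s n <= scalar_op_norm M.
  have [y] := H n; set u := vec _ => /= lt.
  have u0 : u != 0.
    have /eqP sq0 : sqnorm (0 : 'cV[C]_N) == 0 by rewrite sqnorm_eq0.
    by apply: contraTneq lt => ->; rewrite mulmx0 sq0 mulr0 ltxx.
  apply: (@le_trans _ _ (Num.sqrt (sqnorm (M *m u)) / Num.sqrt (sqnorm u))).
    rewrite ler_pdivlMr ?norm_gt0// -[s n]ger0_norm// -sqrtr_sqr -sqrtrM ?sqr_ge0//.
    by rewrite ler_sqrt ?sqnorm_ge0// ltW.
  apply: ub_le_sup; first by exists (Num.sqrt (frob2 M)); exact: ratios_bound.
  by exists u => //; split=> //; exact: scalar_vec.
rewrite leNgt; apply/negP => Mc; set S := scalar_op_norm M in sM Mc.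
pose n := Num.truncn (c / (c - S)).
have := sM n; rewrite leNgt => /negP; apply.
have d0 : 0 < c - S by rewrite subr_gt0.
have : c / (c - S) < n.+1%:R by exact: truncnS_gt.
rewrite ltr_pdivrMr// => lt; rewrite /s ltr_pdivlMr ?ltr0n//.
move: lt; rewrite -natr1; set k := n%:R; lra.
Qed.

Lemma measurable_op_norm_ge d (T : measurableType d) (F : T -> 'M[C]_N) (c : R) :
  0 < c -> mx_measurable F -> measurable [set w | c <= scalar_op_norm (F w)].
Proof.
move=> c0 mF.
pose u (y : {ffun 'I_N * B -> rat}) := vec (fun k => ratr (y k)).
rewrite (_ : [set w | _] = \bigcap_n \bigcup_y
    [set w | ((c * n%:R / n.+1%:R) ^+ 2 * sqnorm (u y) < sqnorm (F w *m u y))%R]).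
  apply: bigcap_measurable; first by exists 0%N.
  move=> n _; apply: countable_bigcupT_measurable => // y.
  apply: measurable_true; apply: measurable_fun_ltr => //; apply: measurable_sqnorm.
  by apply: mx_measurableM => //; exact: mx_measurable_cst.
apply/seteqP; split=> w /=.
  by move/(op_norm_geE _ c0) => H n _; have [y] := H n; exists y.
by move=> H; apply/(op_norm_geE _ c0) => n; have [y] := H n I; exists y.
Qed.

End OperatorNorm.

(** * Bounds for the ensembles *)

(** A bound proportional to the length of a compact interval extends to all
    intervals: a degenerate one is contained in arbitrarily short ones. *)
Lemma interval_bound (R : realType) (I : interval R) (L : \bar R) (c : R) :
  0 < c ->
  (forall a b, a < b -> (forall x, x \in I -> a <= x <= b) -> (L <= (c * (b - a))%:E)%E) ->
  (L <= c%:E * lebesgue_measure [set` I])%E.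
Proof.
move=> c0 cover.
have small a : (forall x, x \in I -> x = a) -> (L <= 0)%E.
  move=> Ia; apply/lee_addgt0Pr => e e0; rewrite add0e.
  have e1 : a < a + e / c by rewrite ltrDl divr_gt0.
  apply: (le_trans (cover _ _ e1 _)) => [x /Ia ->|].
    by rewrite lexx ltW.
  by rewrite lee_fin addrAC subrr add0r mulrC divfK// gt_eqF.
rewrite lebesgue_measure_itv.
case: I cover small => -[l a|[]] [r b|[]] cover small /=;
  rewrite ?ltry ?ltNyr ?ltxx ?mule0; try exact: leey.
all: try (by apply: (small 0) => x; rewrite in_itv/= ?andbF).
- rewrite lte_fin; case: ltP => [ab|ba].
    rewrite -EFinD -EFinM; apply: (cover a b ab) => x.
    by case: l r {cover small} => -[]; rewrite in_itv/= => /andP[];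
      do ?[move/ltW ->|move->].
  rewrite mule0; apply: (small a) => x xI.
  have /andP[ax xb] : a <= x <= b.
    by case: l r xI {cover small} => -[]; rewrite in_itv/= => /andP[];
      do ?[move/ltW ->|move->].
  by apply/eqP; rewrite eq_le ax (le_trans xb ba).
- by rewrite addye// gt0_muley ?lte_fin// leey.
- by rewrite addey// gt0_muley ?lte_fin// leey.
- by rewrite addye// gt0_muley ?lte_fin// leey.
Qed.

Section Bounds.
Context (R : realType).
Local Notation C := R[i].
Context (N : nat) (B : finType) (beta : B -> C) (real_case : bool).
Hypothesis N0 : (0 < N)%N.
Local Notation K := ('I_N * 'I_N * B)%type.
Hypothesis scalar_beta : forall b, scalar_number real_case (beta b).
Hypothesis beta_dual : forall z, scalar_number real_case z ->
  \sum_b (complex.Re (conjc (beta b) * z))%:C * beta b = z.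
Context (sigma : R) (sigma0 : sigma != 0).
Hypothesis sigma_large : 1 <= sigma ^+ 2 * pi *+ 2.
Context d (T : measurableType d) (P : probability T R).
Context (A : 'M[C]_N) (X : K -> T -> R).
Hypotheses (hA : self_adjoint A) (sA : scalar_entries real_case A)
  (GX : gaussian_family sigma P X).

Let H w := ensemble beta A (X ^~ w).

Let mH : mx_measurable (fun w => invmx (H w)).
Proof. by apply: mx_measurable_inv; exact: measurable_ensemble GX. Qed.

(* The bounds are proved for invertible matrices; the others form a null set. *)
Let probability_invertible (E F : set T) : measurable E -> measurable F ->
  (forall w, \det (H w) != 0 -> E w -> F w) -> (P E <= P F)%E.
Proof.
move=> mE mF EF.
have mS : measurable [set w | \det (H w) = 0].
  rewrite (_ : [set w | _] = ~` [set w | \det (H w) != 0]).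
    apply: measurableC; apply: measurable_true; apply: measurable_neq0.
    by apply: cmeasurable_det; exact: measurable_ensemble GX.
  apply/seteqP; split=> w /=; first by move=> ->; rewrite eqxx.
  by move/negP/negPn/eqP.
apply: (@le_trans _ _ (P ([set w | \det (H w) = 0%R] `|` F))).
  apply: le_measure; rewrite ?inE//; first exact: measurableU.
  move=> w Ew; have [dw|dw] := eqVneq (\det (H w)) 0; first by left.
  by right; exact: EF.
apply: (@le_trans _ _ (P [set w | \det (H w) = 0%R] + P F)%E); first exact: measureU2.
by rewrite (ensemble_invertible N0 beta_dual sigma0 sigma_large hA sA GX) add0e.
Qed.

Lemma vector_bound (phi : 'cV[C]_N) (t : R) : vector_tail beta real_case sigma P phi ->
  0 < t ->
  (P [set w | (t * Num.sqrt N%:R * Num.sqrt (sqnorm phi)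
    <= Num.sqrt (sqnorm (invmx (H w) *m phi)))%R] <= (1056 / t)%:E)%E.
Proof.
move=> tail t0; apply: le_trans (tail A X hA sA GX t t0).
apply: probability_invertible.
- apply: measurable_true; apply: measurable_fun_ler => //; apply: measurable_sqrt.
  by apply: measurable_sqnorm; apply: mx_measurableM => //; exact: mx_measurable_cst.
- exact: measurable_large GX.
move=> w dH /= le; rewrite /large/= -/(H w) dH/=.
rewrite -(sqr_sqrtr (sqnorm_ge0 (invmx _ *m _))) -{1}(sqr_sqrtr (sqnorm_ge0 phi)).
rewrite -[X in _ * X * _](@sqr_sqrtr R)// -!exprMn.
by apply: lerXn2r => //; rewrite nnegrE ?mulr_ge0 ?sqrtr_ge0// ltW.
Qed.

Lemma frobenius_bound (t : R) : 0 < t ->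
  (P [set w | (t * N%:R <= Num.sqrt (frob2 (invmx (H w))))%R] <= (21120 / t)%:E)%E.
Proof.
move=> t0.
apply: le_trans (frobenius_tail N0 scalar_beta beta_dual sigma0 sigma_large hA sA GX t0).
apply: probability_invertible.
- apply: measurable_true; apply: measurable_fun_ler => //; apply: measurable_sqrt.
  exact: measurable_frob2.
- exact: measurable_large_frobenius GX.
move=> w dH /= le; rewrite /large_frobenius/= -/(H w) dH/=.
have f0 : 0 <= frob2 (invmx (H w)).
  by apply: sumr_ge0 => *; apply: sumr_ge0 => *; exact: sqr_ge0.
rewrite -(sqr_sqrtr f0) -exprMn.
by apply: lerXn2r => //; rewrite nnegrE ?mulr_ge0 ?sqrtr_ge0// ltW.
Qed.

Lemma op_norm_bound (c : R) : 0 < c ->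
  (P [set w | (c <= scalar_op_norm real_case (invmx (H w)))%R] <=
   P [set w | (c <= Num.sqrt (frob2 (invmx (H w))))%R])%E.
Proof.
move=> c0; apply: le_measure; rewrite ?inE.
- exact: (measurable_op_norm_ge N0 scalar_beta beta_dual c0).
- apply: measurable_true; apply: measurable_fun_ler => //; apply: measurable_sqrt.
  exact: measurable_frob2.
move=> w /= /le_trans; apply; exact: scalar_op_norm_le_frobenius.
Qed.

Lemma density_of_states (I : interval R) :
  (\int[P]_w ((num_eigenvalues (real_complex R) (H w) I)%:R)%:E
    <= (10560 * N%:R)%:E * lebesgue_measure [set` I])%E.
Proof.
apply: interval_bound; first by apply: mulr_gt0; [lra|rewrite ltr0n].
exact: (density_of_states_le N0 scalar_beta beta_dual sigma0 sigma_large hA sA GX).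
Qed.

End Bounds.

(** * The two ensembles *)

Section Independence.
Context (R : realType) d (T : measurableType d) (P : probability T R) (K : finType).

Lemma gaussian_family_independent (X : K -> {RV P >-> R}) (s : R) :
  mutually_independent X -> (forall k, normally_distributed (X k) 0 s) ->
  gaussian_family s P (fun k => X k).
Proof.
move=> indep normal; split=> [k|B mB]; first exact: measurable_funP.
have := indep finset.setT B (fun k _ => mB k).
rewrite (_ : \bigcap_(i in _) _ = [set w | forall k, B k (X k w)]); last first.
  apply/seteqP; split=> w /= H k; last by move=> _; exact: H.
  by apply: H; rewrite /= inE.
move=> ->; apply: eq_big => [k|k _]; first by rewrite inE.
exact: normal k (B k) (mB k).
Qed.

End Independence.

Section GUE.
Context (R : realType).
Local Notation C := R[i].
Context (N : nat) (N0 : (0 < N)%N).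
Context d (T : measurableType d) (P : probability T R).

Let sigma : R := Num.sqrt 2^-1.

Let sigma2 : sigma ^+ 2 = 2^-1.
Proof. by rewrite sqr_sqrtr// invr_ge0. Qed.

Let sigma0 : sigma != 0.
Proof. by rewrite -sqrf_eq0 sigma2 invr_eq0. Qed.

Let sigma_large : 1 <= sigma ^+ 2 * pi *+ 2.
Proof. by rewrite sigma2; have := pi_ge2 R; lra. Qed.

Lemma op_norm_complex (M : 'M[C]_N) :
  op_norm (@Normc.normc R) M = scalar_op_norm false M.
Proof.
congr (sup _); apply/seteqP; split=> _ [v v0 <-]; last by exists v => //; case: v0.
by exists v => //; split.
Qed.

Lemma frobenius_norm_complexE (M : 'M[C]_N) :
  frobenius_norm_complex M = Num.sqrt (frob2 M).
Proof.
congr Num.sqrt; rewrite /mxtrace raddf_sum/=; apply: eq_bigr => i _.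
rewrite mxE raddf_sum/=; apply: eq_bigr => j _.
by rewrite !mxE -[RHS]/(complex.Re ((Normc.normc (M i j) ^+ 2)%:C)) -mulcJ.
Qed.

Lemma GUE_bounds (c : R) (A : 'M[C]_N) (phi : 'cV[C]_N) (V : T -> 'M[C]_N) :
  1056 <= c -> 21120 <= c -> 10560 <= c -> A \is hermsymmx -> phi != 0 -> is_GUE P V ->
  let H := fun w : T => A + V w in
  let norm := @euclid_norm R R[i] (@Normc.normc R) N in
  let opn := @op_norm R R[i] (@Normc.normc R) N in
  let frob := @frobenius_norm_complex R N in
  [/\ forall t : R, 1 <= t ->
        (P [set w | (norm (invmx (H w) *m phi) >= t * Num.sqrt N%:R * norm phi)%R]
         <= (c / t)%:E)%E,
      forall t : R, 1 <= t ->
        (P [set w | (opn (invmx (H w)) >= t * N%:R)%R]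
         <= P [set w | (frob (invmx (H w)) >= t * N%:R)%R])%E /\
        (P [set w | (frob (invmx (H w)) >= t * N%:R)%R] <= (c / t)%:E)%E &
      forall I : interval R,
        ('E_P[fun w => (num_eigenvalues (real_complex R) (H w) I)%:R]
         <= (c * N%:R)%:E * lebesgue_measure [set` I])%E].
Proof.
move=> c1 c2 c3 hA phi0 [X [indep normal VE]] H norm opn frob.
have GX : gaussian_family sigma P (fun k => X k).
  exact: gaussian_family_independent indep normal.
have {}hA : self_adjoint A.
  have /is_hermitianmxP := hA; rewrite expr0 scale1r => AE.
  exact: esym AE.
have sA : scalar_entries false A by [].
have HE w : H w = ensemble (@complex_basis R) A (fun k => X k w).
  rewrite /H VE /ensemble /wscale; congr (_ + _ *: _).
  have -> : ginibre (@complex_basis R) (fun k => X k w) =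
      \matrix_(i, j) (X (i, j, false) w +i* X (i, j, true) w).
    apply/matrixP => i j; rewrite !mxE big_bool/=.
    by apply/eqP; rewrite eq_complex/=; apply/andP; split; apply/eqP; ring.
  by [].
have tail_le (x y t : R) : 0 < t -> x <= y -> ((x / t)%:E <= (y / t)%:E)%E.
  by move=> t0 xy; rewrite lee_fin ler_wpM2r// invr_ge0 ltW.
split.
- move=> t t1; have t0 : 0 < t by apply: lt_le_trans t1.
  have bound := vector_bound N0 (@complex_basis_dual R) sigma0 sigma_large hA sA GX
    (vector_tail_complex N0 sigma0 sigma_large phi0) t0.
  rewrite (_ : [set w | _] = [set w | (t * Num.sqrt N%:R * Num.sqrt (sqnorm phi) <=
      Num.sqrt (sqnorm (invmx (ensemble (@complex_basis R) A (fun k => X k w)) *m phi)))%R]).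
    exact: (le_trans bound (tail_le _ _ _ t0 c1)).
  by apply: eq_set => w; rewrite HE.
- move=> t t1; have t0 : 0 < t by apply: lt_le_trans t1.
  have tN : 0 < t * N%:R by rewrite mulr_gt0// ltr0n.
  have frobE : [set w | (frob (invmx (H w)) >= t * N%:R)%R] = [set w | (t * N%:R <=
      Num.sqrt (frob2 (invmx (ensemble (@complex_basis R) A (fun k => X k w)))))%R].
    by apply: eq_set => w; rewrite /frob frobenius_norm_complexE HE.
  have opE : [set w | (opn (invmx (H w)) >= t * N%:R)%R] = [set w | (t * N%:R <=
      scalar_op_norm false (invmx (ensemble (@complex_basis R) A (fun k => X k w))))%R].
    by apply: eq_set => w; rewrite /opn op_norm_complex HE.
  rewrite frobE opE; split.
    exact: (op_norm_bound N0 (@scalar_complex_basis R) (@complex_basis_dual R) A GX tN).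
  apply: le_trans (tail_le _ _ _ t0 c2).
  exact: (frobenius_bound N0 (@scalar_complex_basis R) (@complex_basis_dual R)
    sigma0 sigma_large hA sA GX t0).
- move=> I; rewrite unlock.
  have dos := density_of_states N0 (@scalar_complex_basis R) (@complex_basis_dual R)
    sigma0 sigma_large hA sA GX I.
  under eq_integral do rewrite HE.
  apply: (le_trans dos); apply: lee_wpmul2r; first exact: measure_ge0.
  by rewrite lee_fin; exact: ler_wpM2r c3.
Qed.

End GUE.

Section GOE.
Context (R : realType).
Local Notation C := R[i].
Context (N : nat) (N0 : (0 < N)%N).
Context d (T : measurableType d) (P : probability T R).

Let cplx := real_complex R.

Definition real_basis (_ : unit) : C := 1.

Let sum_unit (F : unit -> C) : \sum_b F b = F tt.
Proof. by rewrite (bigD1 tt)//= big1 ?addr0// => -[]. Qed.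

Lemma scalar_real_basis b : scalar_number true (real_basis b).
Proof. by move=> _; exact: conjc1. Qed.

Lemma real_basis_dual z : scalar_number true z ->
  \sum_b (complex.Re (conjc (real_basis b) * z))%:C * real_basis b = z.
Proof.
move=> /(_ isT); rewrite sum_unit /real_basis mulr1.
case: z => x y [] /eqP; rewrite eq_sym -addr_eq0 => y0.
have {y0} -> : y = 0 by lra.
by apply/eqP; rewrite eq_complex/=; apply/andP; split; apply/eqP; ring.
Qed.

Let sigma0 : (1 : R) != 0. Proof. exact: oner_neq0. Qed.

Let sigma_large : 1 <= (1 : R) ^+ 2 * pi *+ 2.
Proof. by rewrite expr1n; have := pi_ge2 R; lra. Qed.

Lemma euclid_norm_real (v : 'cV[R]_N) :
  euclid_norm Num.norm v = Num.sqrt (sqnorm (map_mx cplx v)).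
Proof.
by congr Num.sqrt; apply: eq_bigr => i _; rewrite mxE modulus_real.
Qed.

Lemma op_norm_real (M : 'M[R]_N) :
  op_norm Num.norm M = scalar_op_norm true (map_mx cplx M).
Proof.
congr (sup _); apply/seteqP; split=> [_ [v v0 <-]|_ [v [v0 sv] <-]].
  exists (map_mx cplx v); last by rewrite !euclid_norm_real map_mxM.
  split; first by rewrite map_mx_eq0.
  by move=> i _; rewrite mxE; exact: conjc_real.
have vE : map_mx cplx (map_mx (@complex.Re R) v) = v.
  apply/matrixP => i j; rewrite ord1 !mxE; have := sv i isT.
  case: (v i 0) => x y [] /eqP; rewrite eq_sym -addr_eq0 => y0.
  by rewrite /cplx /real_complex_def; congr (_ +i* _); lra.
exists (map_mx (@complex.Re R) v); last by rewrite !euclid_norm_real map_mxM vE.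
by apply: contraNneq v0 => v0; rewrite -vE v0 map_mx0.
Qed.

Lemma frobenius_norm_realE (M : 'M[R]_N) :
  frobenius_norm_real M = Num.sqrt (frob2 (map_mx cplx M)).
Proof.
congr Num.sqrt; apply: eq_bigr => i _; rewrite mxE; apply: eq_bigr => j _.
by rewrite !mxE modulus_real real_normK ?num_real.
Qed.

Lemma num_eigenvalues_real (M : 'M[R]_N) I :
  num_eigenvalues id M I = num_eigenvalues (real_complex R) (map_mx cplx M) I.
Proof.
apply: eq_fsbigr => x _; rewrite -map_char_poly.
by rewrite mup_map// monic_neq0// char_poly_monic.
Qed.

Lemma GOE_bounds (c : R) (A : 'M[R]_N) (phi : 'cV[R]_N) (V : T -> 'M[R]_N) :
  1056 <= c -> 21120 <= c -> 10560 <= c -> A \is symmetricmx -> phi != 0 -> is_GOE P V ->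
  let H := fun w : T => A + V w in
  let norm := @euclid_norm R R Num.norm N in
  let opn := @op_norm R R Num.norm N in
  let frob := @frobenius_norm_real R N in
  [/\ forall t : R, 1 <= t ->
        (P [set w | (norm (invmx (H w) *m phi) >= t * Num.sqrt N%:R * norm phi)%R]
         <= (c / t)%:E)%E,
      forall t : R, 1 <= t ->
        (P [set w | (opn (invmx (H w)) >= t * N%:R)%R]
         <= P [set w | (frob (invmx (H w)) >= t * N%:R)%R])%E /\
        (P [set w | (frob (invmx (H w)) >= t * N%:R)%R] <= (c / t)%:E)%E &
      forall I : interval R,
        ('E_P[fun w => (num_eigenvalues id (H w) I)%:R]
         <= (c * N%:R)%:E * lebesgue_measure [set` I])%E].
Proof.
move=> c1 c2 c3 symA phi0 [X [indep normal VE]] H norm opn frob.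
pose Y (k : 'I_N * 'I_N * unit) : T -> R := X k.1.
have GY : gaussian_family 1 P Y.
  apply: (@gaussian_family_reindex _ _ _ _ _ _ _ (fun ij => X ij : T -> R)
    (fun k : 'I_N * 'I_N * unit => k.1)); first by move=> [? []] [? []] /= ->.
  exact: gaussian_family_independent indep normal.
pose A' := map_mx cplx A.
have hA : self_adjoint A'.
  have /is_hermitianmxP := symA; rewrite expr0 scale1r => AE.
  apply/matrixP => i j; rewrite starE !mxE {2}AE !mxE; exact: conjc_real.
have sA : scalar_entries true A' by move=> i j _; rewrite mxE; exact: conjc_real.
have HE w : map_mx cplx (H w) = ensemble real_basis A' (Y ^~ w).
  apply/matrixP => i j; rewrite /H VE /= !mxE !sum_unit.
  have mapE (a b x y : R) : cplx (a + b * (x + y)) = cplx a + b%:C * (x%:C + y%:C).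
    by apply/eqP; rewrite eq_complex/=; apply/andP; split; apply/eqP; ring.
  by rewrite mapE /real_basis !mulr1 conjc_real.
have invE w : map_mx cplx (invmx (H w)) = invmx (ensemble real_basis A' (Y ^~ w)).
  by rewrite map_invmx HE.
have tail_le (x y t : R) : 0 < t -> x <= y -> ((x / t)%:E <= (y / t)%:E)%E.
  by move=> t0 xy; rewrite lee_fin ler_wpM2r// invr_ge0 ltW.
split.
- move=> t t1; have t0 : 0 < t by apply: lt_le_trans t1.
  have phi_tail : vector_tail real_basis true 1 P (map_mx cplx phi).
    have -> : map_mx cplx phi = \col_i (phi i 0)%:C.
      by apply/matrixP => i j; rewrite ord1 !mxE.
    apply: (vector_tail_real N0 scalar_real_basis real_basis_dual sigma0 sigma_large).
    apply: contrapT => all0; move/eqP: phi0; apply.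
    apply/matrixP => i j; rewrite ord1 mxE; apply/eqP.
    by apply/negPn/negP => p0; apply: all0; exists i.
  have bound := vector_bound N0 real_basis_dual sigma0 sigma_large hA sA GY phi_tail t0.
  rewrite (_ : [set w | _] = [set w | (t * Num.sqrt N%:R * Num.sqrt (sqnorm (map_mx cplx phi))
    <= Num.sqrt (sqnorm (invmx (ensemble real_basis A' (Y ^~ w)) *m map_mx cplx phi)))%R]).
    exact: (le_trans bound (tail_le _ _ _ t0 c1)).
  by apply: eq_set => w; rewrite /norm !euclid_norm_real map_mxM invE.
- move=> t t1; have t0 : 0 < t by apply: lt_le_trans t1.
  have tN : 0 < t * N%:R by rewrite mulr_gt0// ltr0n.
  have frobE : [set w | (frob (invmx (H w)) >= t * N%:R)%R] = [set w | (t * N%:R <=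
      Num.sqrt (frob2 (invmx (ensemble real_basis A' (Y ^~ w)))))%R].
    by apply: eq_set => w; rewrite /frob frobenius_norm_realE invE.
  have opE : [set w | (opn (invmx (H w)) >= t * N%:R)%R] = [set w | (t * N%:R <=
      scalar_op_norm true (invmx (ensemble real_basis A' (Y ^~ w))))%R].
    by apply: eq_set => w; rewrite /opn op_norm_real invE.
  rewrite frobE opE; split.
    exact: (op_norm_bound N0 scalar_real_basis real_basis_dual A' GY tN).
  apply: le_trans (tail_le _ _ _ t0 c2).
  exact: (frobenius_bound N0 scalar_real_basis real_basis_dual
    sigma0 sigma_large hA sA GY t0).
- move=> I; rewrite unlock.
  have dos := density_of_states N0 scalar_real_basis real_basis_dual
    sigma0 sigma_large hA sA GY I.
  under eq_integral do rewrite num_eigenvalues_real HE.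
  apply: (le_trans dos); apply: lee_wpmul2r; first exact: measure_ge0.
  by rewrite lee_fin; exact: ler_wpM2r c3.
Qed.

End GOE.

Theorem theorem1 (R : realType) :
  exists C : R, forall N : nat, (0 < N)%N ->
    (forall (d : measure_display) (T : measurableType d) (P : probability T R)
        (A : 'M[R]_N) (phi : 'cV[R]_N) (V : T -> 'M[R]_N),
      A \is symmetricmx -> phi != 0 -> is_GOE P V ->
      let H := fun w : T => A + V w in
      let norm := @euclid_norm R R Num.norm N in
      let opn := @op_norm R R Num.norm N in
      let frob := @frobenius_norm_real R N in
      [/\ forall t : R, 1 <= t ->
            (P [set w | (norm (invmx (H w) *m phi) >=
                         t * Num.sqrt N%:R * norm phi)%R]
             <= (C / t)%:E)%E,
          forall t : R, 1 <= t ->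
            (P [set w | (opn (invmx (H w)) >= t * N%:R)%R]
             <= P [set w | (frob (invmx (H w)) >= t * N%:R)%R])%E /\
            (P [set w | (frob (invmx (H w)) >= t * N%:R)%R]
             <= (C / t)%:E)%E &
          forall I : interval R,
            ('E_P[fun w => (num_eigenvalues id (H w) I)%:R]
             <= (C * N%:R)%:E * lebesgue_measure [set` I])%E])
    /\
    (forall (d : measure_display) (T : measurableType d) (P : probability T R)
        (A : 'M[R[i]]_N) (phi : 'cV[R[i]]_N) (V : T -> 'M[R[i]]_N),
      A \is hermsymmx -> phi != 0 -> is_GUE P V ->
      let H := fun w : T => A + V w in
      let norm := @euclid_norm R R[i] (@Normc.normc R) N in
      let opn := @op_norm R R[i] (@Normc.normc R) N in
      let frob := @frobenius_norm_complex R N in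
      [/\ forall t : R, 1 <= t ->
            (P [set w | (norm (invmx (H w) *m phi) >=
                         t * Num.sqrt N%:R * norm phi)%R]
             <= (C / t)%:E)%E,
          forall t : R, 1 <= t ->
            (P [set w | (opn (invmx (H w)) >= t * N%:R)%R]
             <= P [set w | (frob (invmx (H w)) >= t * N%:R)%R])%E /\
            (P [set w | (frob (invmx (H w)) >= t * N%:R)%R]
             <= (C / t)%:E)%E &
          forall I : interval R,
            ('E_P[fun w => (num_eigenvalues (real_complex R) (H w) I)%:R]
             <= (C * N%:R)%:E * lebesgue_measure [set` I])%E]).
Proof.
have [c [c1 c2 c3]] : exists c : R, [/\ 1056 <= c, 21120 <= c & 10560 <= c].
  by exists 21120; split; lra.
exists c => N N0; split=> d T P A phi V; first exact: GOE_bounds.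
exact: GUE_bounds.
Qed.
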